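(* Let $\mu$ be a probability measure on $\mathbb{C}$ whose support is not the whole complex plane, and let $\{z_n\}_{n\ge1}$ be a $\mu$-distributed sequence of complex numbers that is not dense in $\mathbb{C}$. Let $0<p<1$. Choose a random subsequence $\{z_{n_k}\}_{k\ge1}$ by including each $z_n$ in the subsequence with probability $p$, independently of the others. Define $P_k(z):=(z-z_{n_1})(z-z_{n_2})\cdots(z-z_{n_k})$. Then $\mathscr{M}(P_k)\xrightarrow{w}\mu$ almost surely and $\mathscr{M}(P_k')\xrightarrow{w}\mu$ in probability, as $k\to\infty$.
   Context: For a nonconstant complex polynomial $P$, $\mathscr{M}(P)$ denotes the uniform probability measure on the multiset of zeros of $P$ (zeros counted with multiplicity); $P'$ is the derivative ($k\ge 2$ when $P_k'$ is considered). A sequence of probability measures $\mu_n$ on $\mathbb{C}$ converges weakly to a probability measure $\mu$ (written $\mu_n\xrightarrow{w}\mu$) if $\int f\,d\mu_n\to\int f\,d\mu$ for every $f\in C_c^\infty(\mathbb{C})$. For random probability measures $\mu_n$: $\mu_n\xrightarrow{w}\mu$ in probability means $\lim_{n\to\infty}\mathbb{P}(\mu_n\in N)=1$ for every neighbourhood $N$ of $\mu$ in the weak topology; $\mu_n\xrightarrow{w}\mu$ almost surely means that with probability one $\mu_n\to\mu$ weakly. A sequence $\{z_n\}_{n\ge1}$ of complex numbers is $\mu$-distributed if $\frac1n\sum_{i=1}^n\delta_{z_i}\xrightarrow{w}\mu$. The indices $n_1<n_2<\cdots$ are the (random) indices of the included terms in increasing order. *)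

(* Defs.v *)
From HB Require Import structures.
From mathcomp Require Import all_boot all_order all_algebra.
From mathcomp Require Import all_classical all_reals all_analysis.
From mathcomp.real_closed Require Export complex.

Set Implicit Arguments.
Unset Strict Implicit.
Unset Printing Implicit Defensive.

Import Order.TTheory GRing.Theory Num.Theory.
Import numFieldNormedType.Exports.

Local Open Scope classical_set_scope.
Local Open Scope ring_scope.
Local Open Scope complex_scope.

(* R[i] carries the topology of its norm, and the Borel sigma-algebra of that
   topology. *)
HB.instance Definition _ (R : realType) :=
  PseudoPointedMetric.copy R[i] R[i]^o.

HB.instance Definition _ (R : realType) :=
  @isMeasurable.Build (sigma_display (@open R[i])) R[i]
    <<s @open R[i] >> (@sigma_algebra0 _ setT _) (@sigma_algebraC _ _)
    (@sigma_algebra_bigcup _ setT _).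

Section Measures.
Context {R : realType}.
Implicit Types (f : R[i] -> R) (mu nu : probability R[i] R).

Definition measure_support mu : set R[i] :=
  [set w | forall U : set R[i], open_nbhs w U -> (0 < mu U)%E].

(* The partial derivatives of f with respect to the real and imaginary parts
   of its argument. *)
Definition dRe f : R[i] -> R := fun w => derive1 (fun t : R => f (t +i* complex.Im w)) (complex.Re w).
Definition dIm f : R[i] -> R := fun w => derive1 (fun t : R => f (complex.Re w +i* t)) (complex.Im w).

Fixpoint Ck (k : nat) f : Prop :=
  continuous f /\
  if k is k'.+1 then
    [/\ forall w : R[i], derivable (fun t : R => f (t +i* complex.Im w)) (complex.Re w) 1,
        forall w : R[i], derivable (fun t : R => f (complex.Re w +i* t)) (complex.Im w) 1,
        Ck k' (dRe f) & Ck k' (dIm f)]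
  else True.

Definition test_function f : Prop :=
  (forall k, Ck k f) /\ compact (closure [set w | f w != 0]).

Definition weak_cvg (mu_ : nat -> probability R[i] R) mu : Prop :=
  forall f, test_function f ->
    \int[mu_ n]_w f w @[n --> \oo] --> \int[mu]_w f w.

(* The coarsest topology on probability measures making the integral of every
   test function continuous. *)
Definition integrals mu : {ptws {f | test_function f} -> R} :=
  fun phi => \int[mu]_w sval phi w.

Definition weak_topology := initial_topology integrals.

(* On the empty sequence, the junk value is the Dirac mass at 0. *)
Definition uniform_on (s : seq R[i]) : probability R[i] R :=
  mnormalize (msum (fun i => \d_(s`_i)) (size s)) (\d_(0 : R[i])).

Definition zeros (Q : {poly R[i]}) : seq R[i] :=
  sval (closed_field_poly_normal Q).

Definition zero_measure (Q : {poly R[i]}) : probability R[i] R :=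
  uniform_on (zeros Q).

Definition distributed mu (z : nat -> R[i]) : Prop :=
  weak_cvg (fun n => uniform_on (mkseq z n)) mu.

End Measures.

Section RandomMeasures.
Context {R : realType} {d : measure_display} {Omega : measurableType d}.
Variable P : probability Omega R.
Implicit Types (M : nat -> Omega -> probability R[i] R) (mu : probability R[i] R).

Definition weak_cvg_as M mu : Prop := {ae P, forall w, weak_cvg (M ^~ w) mu}.

(* A measure is unspecified on non-measurable sets, so the events whose
   probabilities are considered are required to be measurable. *)
Definition weak_cvg_in_probability M mu : Prop :=
  forall N : set (probability R[i] R), nbhs (mu : weak_topology) N ->
    (forall k, measurable [set w | N (M k w)]) /\
    P [set w | N (M k w)] @[k --> \oo] --> 1%E.

Definition mutually_independent (A : nat -> set Omega) : Prop :=
  forall s : seq nat, uniq s ->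
    P (\bigcap_(i in [set` s]) A i) = (\prod_(i <- s) P (A i))%E.

End RandomMeasures.

Section RandomSubsequence.
Context {R : realType} {Omega : Type}.
Implicit Types (A : nat -> set Omega) (w : Omega).

(* A n is the event that the n-th term is included. Counting from 0, the k-th
   included index is the included n with exactly k included indices below it;
   it is 0 by default if fewer than k + 1 indices are included. *)
Definition included_index A w (k : nat) : nat :=
  xget 0%N [set n | A n w /\ (\sum_(i < n) (w \in A i) = k)%N].

Definition random_poly (z : nat -> R[i]) A (k : nat) w : {poly R[i]} :=
  \prod_(j < k) ('X - (z (included_index A w j))%:P).

End RandomSubsequence.

(* Main.v *)
(* For the first statement, the strong law of large numbers is applied to the
   numbers of included terms in each of countably many square cells. The k-th
   included index is handled by comparing the sum over the first k included
   terms with the sum over the included n < k / p.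

   For the second one, let G(y) = ln max(|y - c|, r). Finite linear combinations
   of such functions approximate test functions uniformly, so it suffices that
   (sum of G over the zeros of P_k') - (sum of G over the zeros of P_k) is o(k) in
   probability. Up to O(k / m) the difference is the sum of
   ln |L(a) / k| / m over the m points a = c + r w^i, w^m = 1, where
   L = P_k' / P_k is the sum of the 1 / (a - z_{n_j}); the zeros of P_k' close to
   a are controlled by a discrete Jensen inequality. The upper bound on |L(a)| is
   elementary after moving c by a suitable vector of a fine grid. For the lower
   bound, let x0 be a cluster point of (z_n), which exists because mu has total
   mass 1. If z_n -> x0, then all the terms of L(a) but boundedly many are close
   to 1 / (a - x0), and |L(a)| is large. Otherwise infinitely many disjoint pairs
   (i, j) have 1 / (a - z_i) and 1 / (a - z_j) apart, and an
   Erdos-Littlewood-Offord argument shows that |L(a)| is bounded below with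
   probability close to 1. *)
Require Import Defs.
From HB Require Import structures.
From mathcomp Require Import all_boot all_order all_algebra.
From mathcomp Require Import all_classical all_reals all_analysis.
From mathcomp Require Import measurable_realfun.
From mathcomp Require Import cyclic separable cyclotomic zify ring lra.
Import Order.TTheory GRing.Theory Num.Theory.
Import numFieldNormedType.Exports.
Local Open Scope classical_set_scope.
Local Open Scope ring_scope.
Set Implicit Arguments.
Unset Strict Implicit.
Unset Printing Implicit Defensive.

(** Up to ln k, ln |P'/P| is the difference of the logarithmic potentials of the critical points and
    of the zeros, and [logmax c r y] is the mean of ln |y - a| over the circle |a - c| = r; hence
    the choice of G. Means over m equally spaced points replace circle means, so that only finitely
    many points a need a probability estimate and a union bound suffices. The price is that a zero
    or a critical point may lie next to one of these points, where the m-point mean is far from G;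
    [excess] measures this. The z_n are deterministic, so no fixed centre can be assumed to keep the
    1 / |a - z_n| under control. But 1 / |x| is locally integrable in the plane: away from a few
    nodes, its average over a grid of shifts is bounded uniformly in z_n, and most shifts are good.
    Anti-concentration, however, is a statement about one fixed shift, while the good shift depends
    on the sample; Markov's inequality for the number of bad shifts reconciles the two. Losses of
    order ln k are harmless, as the target is o(k). *)

(** * Discrete Jensen inequality *)

Section Modulus.
Context {R : realType}.
Implicit Types (x y : R[i]) (t : R).

(** The norm of [R[i]] takes its values in [R[i]]; a modulus with values in [R] makes [ln], [expR]
    and [lra] available. *)
Definition normc x : R := ComplexField.Normc.normc x.

Lemma normcE x : `|x| = real_complex R (normc x).
Proof. by rewrite normc_def; case: x. Qed.

Lemma normc_ge0 x : 0 <= normc x.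
Proof. by rewrite -lecR -normcE normr_ge0. Qed.

Lemma normc0 : normc 0 = 0. Proof. exact: ComplexField.Normc.normc0. Qed.

Lemma normc1 : normc 1 = 1. Proof. exact: ComplexField.Normc.normc1. Qed.

Lemma normcM x y : normc (x * y) = normc x * normc y.
Proof. exact: ComplexField.Normc.normcM. Qed.

Lemma normcV x : normc x^-1 = (normc x)^-1.
Proof. exact: ComplexField.Normc.normcV. Qed.

Lemma normcD x y : normc (x + y) <= normc x + normc y.
Proof. exact: le_normcD. Qed.

Lemma normcN x : normc (- x) = normc x.
Proof. exact: complex.normcN. Qed.

Lemma normc_distC x y : normc (x - y) = normc (y - x).
Proof. by rewrite -normcN opprB. Qed.

Lemma normcB_ge x y : normc x - normc y <= normc (x - y).
Proof. by rewrite lerBlDr -{1}(subrK y x) normcD. Qed.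

Lemma normc_triangle z x y : normc (x - y) <= normc (x - z) + normc (z - y).
Proof. by rewrite (le_trans _ (normcD _ _))// addrA subrK. Qed.

Lemma normc_eq0 x : (normc x == 0) = (x == 0).
Proof. by apply/eqP/eqP => [/ComplexField.Normc.eq0_normc|->]; rewrite ?normc0. Qed.

Lemma normc_gt0 x : (0 < normc x) = (x != 0).
Proof. by rewrite lt_neqAle normc_ge0 andbT eq_sym normc_eq0. Qed.

Lemma normcX x n : normc (x ^+ n) = normc x ^+ n.
Proof. by elim: n => [|n IH]; rewrite ?expr0 ?normc1// !exprS normcM IH. Qed.

Lemma normc_prod I (r : seq I) (F : I -> R[i]) :
  normc (\prod_(i <- r) F i) = \prod_(i <- r) normc (F i).
Proof. exact: (big_morph _ normcM normc1). Qed.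

Lemma normc_sum I (r : seq I) (p : pred I) (F : I -> R[i]) :
  normc (\sum_(i <- r | p i) F i) <= \sum_(i <- r | p i) normc (F i).
Proof.
elim/big_ind2 : _ => [|x1 x2 y1 y2 le1 le2|//]; first by rewrite normc0.
by rewrite (le_trans (normcD _ _)) ?lerD.
Qed.

Lemma normcR t : normc (real_complex R t) = `|t|.
Proof. by rewrite /normc /= expr0n /= addr0 sqrtr_sqr. Qed.

Lemma normc_nat n : normc n%:R = n%:R.
Proof. by rewrite -(rmorph_nat (real_complex R)) normcR ger0_norm. Qed.

Lemma normc_Re x : `|complex.Re x| <= normc x.
Proof.
case: x => a b /=; rewrite -sqrtr_sqr /normc /=.
by apply: ler_wsqrtr; rewrite lerDl sqr_ge0.
Qed.

Lemma normc_Im x : `|complex.Im x| <= normc x.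
Proof.
case: x => a b /=; rewrite -sqrtr_sqr /normc /=.
by apply: ler_wsqrtr; rewrite lerDr sqr_ge0.
Qed.

Lemma normc_le_ReIm x : normc x <= `|complex.Re x| + `|complex.Im x|.
Proof.
case: x => a b.
have -> : complex.Complex a b = real_complex R a + complex.Complex 0 b.
  by apply/eqP; rewrite eq_complex /= addr0 add0r !eqxx.
rewrite (le_trans (normcD _ _))// normcR /= addr0 add0r lerD2l.
by rewrite /normc /= expr0n add0r sqrtr_sqr.
Qed.

Lemma normc_conj x : normc (conjc x) = normc x.
Proof. by case: x => a b; rewrite /normc /= sqrrN. Qed.

End Modulus.

Section DiscreteJensen.
Context {R : realType}.
Implicit Types (a c w x y z : R[i]) (s : R) (Q : {poly R[i]}) (ws zs : seq R[i]).

(** X^n - 1 is separable in characteristic 0, so it has n distinct roots, and n distinct n-th roots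
    of unity include a primitive one. *)
Lemma prim_root_complex n : (0 < n)%N -> exists w : R[i], n.-primitive_root w.
Proof.
move=> n0; pose p : {poly R[i]} := 'X^n - 1.
have [r pE] := closed_field_poly_normal p.
have sz : size p = n.+1 by rewrite size_XnsubC.
have lc : lead_coef p = 1 by rewrite lead_coefXnsubC.
have rU : all n.-unity_root r.
  apply/allP => x xr; rewrite unity_rootE -subr_eq0.
  have : root p x by rewrite pE lc scale1r root_prod_XsubC.
  by rewrite rootE /p !hornerE.
have ur : uniq r.
  rewrite -separable_prod_XsubC -[X in separable_poly X]scale1r -lc -pE.
  apply: separable_Xn_sub_1.
  by rewrite pnatr_eq0 -lt0n.
have szr : size r = n by move: sz; rewrite pE lc scale1r size_prod_XsubC => -[].
have : has n.-primitive_root r by apply: has_prim_root; rewrite // ?szr.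
by case/hasP => w _ pw; exists w.
Qed.

Lemma normc_prim_root n (w : R[i]) i : n.-primitive_root w -> normc (w ^+ i) = 1.
Proof.
move=> pw; suff w1 : normc w = 1 by rewrite normcX w1 expr1n.
have /(congr1 normc) := prim_expr_order pw.
rewrite normcX normc1 => /eqP; rewrite pexpr_eq1 ?(prim_order_gt0 pw) ?normc_ge0//.
by move/eqP.
Qed.

Lemma sum_prim_root n (w : R[i]) l : n.-primitive_root w -> ~~ (n %| l)%N ->
  \sum_(i < n) (w ^+ i) ^+ l = 0.
Proof.
move=> pw ndiv; have wl : w ^+ l != 1 by rewrite -(prim_order_dvd pw).
under eq_bigr do rewrite exprAC.
apply: (mulfI (_ : w ^+ l - 1 != 0)); first by rewrite subr_eq0.
by rewrite mulr0 -subrX1 exprAC (prim_expr_order pw) expr1n subrr.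
Qed.

(** A mean value property without integrals: summing over n equally spaced points kills every
    monomial whose degree is not a multiple of n, and below degree n only the constant term
    survives. *)
Lemma poly_mean n (w : R[i]) Q t : n.-primitive_root w -> (size Q <= n)%N ->
  \sum_(i < n) Q.[t * w ^+ i] = n%:R * Q.[0].
Proof.
move=> pw szQ.
under eq_bigr do rewrite (horner_coef_wide _ szQ).
rewrite exchange_big /=.
case: n szQ pw => [|n] szQ pw; first by rewrite big_ord0 mul0r.
rewrite big_ord_recl [X in _ + X]big1 ?addr0 => [|i _]; last first.
  under eq_bigr do rewrite exprMn mulrA.
  rewrite -mulr_sumr sum_prim_root ?mulr0//.
  by rewrite lift0 gtnNdvd// ltnS ltn_ord.
under eq_bigr do rewrite !expr0 mulr1.
by rewrite sumr_const card_ord horner_coef0 mulr_natl.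
Qed.

(** The maximum principle, read off from [poly_mean] centred at a. One point more than the size is
    used, so that there is a point even for the zero polynomial. *)
Lemma poly_max Q a s M : 0 <= s ->
  (forall x, normc (x - a) = s -> normc Q.[x] <= M) -> normc Q.[a] <= M.
Proof.
move=> s0 leM; pose n := (size (Q \Po ('X + a%:P))).+1.
have [w pw] := prim_root_complex (ltn0Sn (size (Q \Po ('X + a%:P)))).
have /(congr1 normc) := poly_mean (real_complex R s) pw (leqnSn _).
rewrite normcM normc_nat horner_comp !hornerE /= => E.
have n0 : 0 < n%:R :> R by rewrite ltr0n.
rewrite -(ler_pM2l n0) -E (le_trans (normc_sum _ _ _))//.
apply: le_trans (_ : \sum_(i < n) M <= _); last by rewrite sumr_const card_ord mulr_natl.
apply: ler_sum => i _; rewrite horner_comp !hornerE /=; apply: leM.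
rewrite addrK normcM normcR normcX ger0_norm//.
by rewrite -normcX (normc_prim_root _ pw) mulr1.
Qed.

(* Each factor X - w with |w - a| < s is traded for its reflection in the
   circle, which has the same modulus on the circle and modulus s at a. *)
Lemma discrete_jensen Q ws a s M : 0 < s ->
  (forall x, normc (x - a) = s ->
     normc Q.[x] * \prod_(w <- ws) normc (x - w) <= M) ->
  normc Q.[a] * \prod_(w <- ws) Num.max (normc (a - w)) s <= M.
Proof.
move=> s0; elim: ws Q => [|w ws IH] Q leM.
  rewrite big_nil mulr1; apply: (poly_max (ltW s0)) => x xs.
  by have := leM _ xs; rewrite big_nil mulr1.
rewrite big_cons; have [ws'|sw] := leP s (normc (a - w)).
  have QE x : normc (Q * ('X - w%:P)).[x] = normc Q.[x] * normc (x - w).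
    by rewrite hornerM hornerXsubC normcM.
  rewrite mulrA -QE; apply: IH => x xs.
  by rewrite QE -mulrA; have := leM _ xs; rewrite big_cons.
have s0C : real_complex R s != 0 by rewrite -normc_eq0 normcR gt_eqF// gtr0_norm.
pose B : {poly R[i]} := (real_complex R s)%:P
  - (conjc (w - a) / real_complex R s) *: ('X - a%:P).
have Ba : normc B.[a] = s.
  by rewrite /B !hornerE subrr mulr0 subr0 normcR gtr0_norm.
rewrite mulrA -[X in _ * X * _ <= _]Ba -normcM -hornerM; apply: IH => x xs.
rewrite hornerM normcM -mulrA; have := leM _ xs; rewrite big_cons.
suff -> : normc B.[x] = normc (x - w) by [].
have -> : x - w = (x - a) - (w - a) by ring.
have -> : B.[x] = real_complex R s - conjc (w - a) / real_complex R s * (x - a).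
  by rewrite /B !hornerE.
move: (w - a) (x - a) xs => b y ys.
have yE : y * conjc y = real_complex R s ^+ 2.
  by rewrite -sqr_normc normcE ys.
have -> : real_complex R s - conjc b / real_complex R s * y =
    (y / real_complex R s) * conjc (y - b).
  have yE' : y / real_complex R s * conjc y = real_complex R s.
    by rewrite mulrAC yE expr2 mulfK.
  rewrite rmorphB /= mulrBr yE'; congr (_ - _).
  by rewrite mulrAC [conjc b * y]mulrC mulrAC.
by rewrite normcM normcM normcV normcR gtr0_norm// ys divff ?gt_eqF// mul1r normc_conj.
Qed.

End DiscreteJensen.

(** * Critical points and circles *)

Section CriticalPoints.
Context {R : realType}.
Implicit Types (a c w x y z : R[i]) (s r : R) (ws zs : seq R[i]).

Definition poly_of zs : {poly R[i]} := \prod_(z <- zs) ('X - z%:P).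
Definition logder zs a : R[i] := \sum_(z <- zs) (a - z)^-1.
Definition absder zs a : R := \sum_(z <- zs) (normc (a - z))^-1.

Lemma poly_ofE zs x : (poly_of zs).[x] = \prod_(z <- zs) (x - z).
Proof. by rewrite horner_prod; under eq_bigr do rewrite hornerXsubC. Qed.

Lemma absder_ge0 zs a : 0 <= absder zs a.
Proof. by apply: sumr_ge0 => z _; rewrite invr_ge0 normc_ge0. Qed.

Lemma normc_logder zs a : normc (logder zs a) <= absder zs a.
Proof.
rewrite (le_trans (normc_sum _ _ _))//.
by apply: ler_sum => z _; rewrite normcV.
Qed.

Lemma poly_of_neq0 zs a : a \notin zs -> (poly_of zs).[a] != 0.
Proof.
rewrite poly_ofE prodf_seq_neq0 => az; apply/allP => z zz /=.
by rewrite subr_eq0; apply: contraNneq az => ->.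
Qed.

Lemma deriv_poly_of zs a : a \notin zs ->
  (poly_of zs)^`().[a] = (poly_of zs).[a] * logder zs a.
Proof.
elim: zs => [|z zs IH].
  by rewrite /poly_of /logder !big_nil derivC horner0 mulr0.
rewrite inE negb_or => /andP[az azs].
have az0 : a - z != 0 by rewrite subr_eq0.
rewrite /poly_of /logder !big_cons -/(poly_of zs) -/(logder zs a).
rewrite derivM derivXsubC mul1r !hornerE IH// mulrDr.
by rewrite mulrAC mulfV// mul1r mulrA.
Qed.

(** Moving from a by at most s multiplies the factor |a - z| by at most 1 + s / |a - z| <= exp (s /
    |a - z|). *)
Lemma poly_of_bound zs a x s : a \notin zs -> normc (x - a) <= s ->
  normc (poly_of zs).[x] <= normc (poly_of zs).[a] * expR (s * absder zs a).
Proof.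
move=> + xs; elim: zs => [|z zs IH].
  by rewrite /poly_of /absder !big_nil !hornerE ?mulr0 expR0 mulr1.
rewrite inE negb_or => /andP[az azs].
have az0 : 0 < normc (a - z) by rewrite normc_gt0 subr_eq0.
rewrite !poly_ofE /absder !big_cons -/(absder zs a) -!poly_ofE !normcM mulrDr expRD.
rewrite [leRHS]mulrACA; apply: ler_pM; rewrite ?normc_ge0//; last exact: IH.
have /(ler_wpM2l (ltW az0)) h1 := expR_ge1Dx (s / normc (a - z)); apply: (le_trans _ h1).
rewrite mulrDr mulr1 mulrCA divff ?gt_eqF// mulr1.
by rewrite (le_trans (normc_triangle a _ _))// addrC lerD2l.
Qed.

(** By induction on the factors with the product rule. The sum of moduli [absder] replaces
    |[logder]| because cancellations in P'/P at a need not persist at x. *)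
Lemma deriv_poly_of_bound zs a x s : a \notin zs -> normc (x - a) <= s ->
  normc (poly_of zs)^`().[x] <=
  normc (poly_of zs).[a] * (absder zs a * expR (s * absder zs a)).
Proof.
move=> + xs; elim: zs => [|z zs IH].
  by rewrite /poly_of /absder !big_nil derivC horner0 normc0 mul0r mulr0.
rewrite inE negb_or => /andP[az azs].
have az0 : 0 < normc (a - z) by rewrite normc_gt0 subr_eq0.
have s0 : 0 <= s by rewrite (le_trans (normc_ge0 _) xs).
rewrite /poly_of /absder !big_cons -/(poly_of zs) -/(absder zs a).
rewrite derivM derivXsubC mul1r !hornerE normcM.
rewrite (le_trans (normcD _ _))// normcM mulrDr expRD /=.
set H := absder zs a; set h := (normc (a - z))^-1; set E := expR (s * H).
have H0 : 0 <= H := absder_ge0 zs a.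
have xz : normc (x - z) <= normc (a - z) * expR (s * h).
  have /(ler_wpM2l (ltW az0)) h1 := expR_ge1Dx (s * h); apply: (le_trans _ h1).
  rewrite mulrDr mulr1 mulrCA divff ?gt_eqF// mulr1.
  by rewrite (le_trans (normc_triangle a _ _))// addrC lerD2l.
have e1 : 1 <= expR (s * h) by rewrite -expR0 ler_expR mulr_ge0// invr_ge0 normc_ge0.
have p1 : normc (poly_of zs).[x] <= normc (poly_of zs).[a] * E by exact: poly_of_bound.
have := IH azs; rewrite -/H -/E => p2.
have -> : normc (a - z) * normc (poly_of zs).[a] * (h + H) * (expR (s * h) * E) =
   expR (s * h) * (normc (poly_of zs).[a] * E) +
   normc (a - z) * expR (s * h) * (normc (poly_of zs).[a] * (H * E)).
  by rewrite /h; field; rewrite gt_eqF.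
apply: lerD.
  by rewrite (le_trans p1)// ler_peMl// mulr_ge0 ?normc_ge0// expR_ge0.
by apply: ler_pM; rewrite ?normc_ge0.
Qed.

Lemma size_poly_of zs : size (poly_of zs) = (size zs).+1.
Proof. exact: size_prod_XsubC. Qed.

Lemma lead_coef_deriv_poly_of zs : (0 < size zs)%N ->
  size (poly_of zs)^`() = size zs /\ lead_coef (poly_of zs)^`() = (size zs)%:R.
Proof.
move=> zs0; have k0 : (size zs)%:R != 0 :> R[i] by rewrite pnatr_eq0 -lt0n.
have lc : ((poly_of zs)^`())`_(size zs).-1 = (size zs)%:R.
  rewrite coef_deriv prednK//.
  have /monicP := monic_prod_XsubC zs (fun=> true) id.
  by rewrite lead_coefE size_prod_XsubC /= => ->.
have szle : (size (poly_of zs)^`() <= size zs)%N.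
  rewrite -ltnS -size_poly_of lt_size_deriv//.
  by rewrite -size_poly_eq0 size_poly_of.
have sz : size (poly_of zs)^`() = size zs.
  apply/eqP; rewrite eqn_leq szle -(prednK zs0); apply: contra_neqT k0.
  by rewrite -ltnNge ltnS -lc => /(nth_default 0).
by split=> //; rewrite lead_coefE sz.
Qed.

Lemma zerosE (Q : {poly R[i]}) : Q = lead_coef Q *: poly_of (zeros Q).
Proof. by rewrite /zeros /poly_of; case: closed_field_poly_normal. Qed.

Lemma zeros_poly_of zs : perm_eq (zeros (poly_of zs)) zs.
Proof.
have := zerosE (poly_of zs).
have /monicP -> := monic_prod_XsubC zs (fun=> true) id; rewrite scale1r => E.
by apply: prod_XsubC_eq; exact: esym E.
Qed.

Lemma size_zeros_deriv zs : (0 < size zs)%N ->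
  size (zeros (poly_of zs)^`()) = (size zs).-1.
Proof.
move=> zs0; have [sz lc] := lead_coef_deriv_poly_of zs0.
have lc0 : lead_coef (poly_of zs)^`() != 0 by rewrite lc pnatr_eq0 -lt0n.
by rewrite -sz [in RHS](zerosE (poly_of zs)^`()) size_scale// size_poly_of.
Qed.

Lemma sum_ln (I : eqType) (t : seq I) (F : I -> R) :
  (forall i, i \in t -> 0 < F i) ->
  0 < \prod_(i <- t) F i /\ \sum_(i <- t) ln (F i) = ln (\prod_(i <- t) F i).
Proof.
elim: t => [|i t IH] F0; first by rewrite !big_nil ln1.
rewrite !big_cons; have Fi : 0 < F i by apply: F0; rewrite mem_head.
have [j jt|p0 E] := IH; first by apply: F0; rewrite inE jt orbT.
by rewrite E lnM ?posrE// mulr_gt0.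
Qed.

(** The cost of truncating |a - w| at s inside the logarithm. It vanishes unless w lies within s of
    a, so it detects zeros next to a sample point. *)
Definition excess s a w : R := ln (Num.max (normc (a - w)) s) - ln (normc (a - w)).

Lemma excess_ge0 s a w : a != w -> 0 <= excess s a w.
Proof.
move=> aw; have aw0 : 0 < normc (a - w) by rewrite normc_gt0 subr_eq0.
by rewrite subr_ge0 ler_ln ?posrE// ?lt_max ?aw0// le_max lexx.
Qed.

Lemma excess_le s a w : 0 < s -> a != w -> excess s a w <= s / normc (a - w).
Proof.
move=> s0 aw; have aw0 : 0 < normc (a - w) by rewrite normc_gt0 subr_eq0.
rewrite /excess -ln_div ?posrE ?lt_max ?aw0//.
set u := normc (a - w) in aw0 *; have su : 0 < s / u by rewrite divr_gt0.
apply: le_trans (le_ln1Dx (lt_trans _ su)); last by rewrite ltrN10.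
rewrite ler_ln ?posrE ?divr_gt0 ?lt_max ?aw0 ?addr_gt0// ler_pdivrMr// mulrDl mul1r.
by rewrite divfK ?gt_eqF// ge_max lerDl lerDr !ltW.
Qed.

Section AtPoint.
Variables (zs : seq R[i]) (a : R[i]).
Hypotheses (zs0 : (0 < size zs)%N) (azs : a \notin zs) (La : logder zs a != 0).
Let ws := zeros (poly_of zs)^`().

Lemma deriv_factor x : (poly_of zs)^`().[x] = (size zs)%:R * (poly_of ws).[x].
Proof.
by rewrite {1}(zerosE (poly_of zs)^`()) hornerZ (lead_coef_deriv_poly_of zs0).2.
Qed.

Lemma deriv_neq0 : (poly_of zs)^`().[a] != 0.
Proof. by rewrite deriv_poly_of// mulf_neq0// poly_of_neq0. Qed.

Lemma notin_critical w : w \in ws -> a != w.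
Proof.
move=> ww; apply: contraNneq deriv_neq0 => aw; rewrite deriv_factor poly_ofE.
by rewrite (big_rem w)//= aw subrr mul0r mulr0.
Qed.

(** Logarithms of the two expressions P(a) L(a) and k times the product of the a - w for P'(a). *)
Lemma sum_ln_critical :
  \sum_(w <- ws) ln (normc (a - w)) - \sum_(z <- zs) ln (normc (a - z)) =
  ln (normc (logder zs a)) - ln (size zs)%:R.
Proof.
have [|/= zp ->] := @sum_ln _ zs (fun z => normc (a - z)).
  move=> z zz; rewrite normc_gt0 subr_eq0.
  by apply: contraNneq azs => ->.
have [|/= wp ->] := @sum_ln _ ws (fun w => normc (a - w)).
  by move=> w ww; rewrite normc_gt0 subr_eq0 notin_critical.
apply/eqP; rewrite subr_eq addrAC eq_sym subr_eq; apply/eqP.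
rewrite -!lnM ?posrE ?ltr0n// ?normc_gt0//; congr ln.
rewrite -!normc_prod -!poly_ofE mulrC -[in RHS](normc_nat (size zs)) -!normcM.
by rewrite [X in _ = normc X]mulrC -deriv_factor deriv_poly_of.
Qed.

(** Dividing the Jensen bound for P' on the circle |x - a| = s by |P'(a)| = |P(a) L(a)| cancels
    P(a). What is left is H exp (s H) / |L(a)| with H = [absder zs a]. *)
Lemma sum_excess_critical s : 0 < s ->
  \sum_(w <- ws) excess s a w <=
  ln (absder zs a) + s * absder zs a - ln (normc (logder zs a)).
Proof.
move=> s0.
have L0 : 0 < normc (logder zs a) by rewrite normc_gt0.
have H0 : 0 < absder zs a by rewrite (lt_le_trans L0)// normc_logder.
have P0 : 0 < normc (poly_of zs).[a] by rewrite normc_gt0 poly_of_neq0.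
rewrite /excess sumrB.
have [|/= wp ->] := @sum_ln _ ws (fun w => normc (a - w)).
  by move=> w ww; rewrite normc_gt0 subr_eq0 notin_critical.
have [|/= mp ->] := @sum_ln _ ws (fun w => Num.max (normc (a - w)) s).
  by move=> w ww; rewrite lt_max s0 orbT.
rewrite lerBlDr addrAC lerBrDr -[s * _]expRK -!lnM ?posrE ?mulr_gt0// ?expR_gt0//.
rewrite ler_ln ?posrE ?mulr_gt0// ?expR_gt0//.
(* [Q] is the leading coefficient of P', so that its product with the factors X - w, w in [ws], is
   P' itself. *)
rewrite -(ler_pM2l P0); pose Q : {poly R[i]} := ((size zs)%:R)%:P.
have -> : normc (poly_of zs).[a] * (\prod_(j <- ws) Num.max (normc (a - j)) s *
    normc (logder zs a)) =
    normc (poly_of zs)^`().[a] * \prod_(j <- ws) Num.max (normc (a - j)) s.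
  by rewrite deriv_poly_of// normcM mulrCA mulrC.
have -> : normc (poly_of zs)^`().[a] = normc Q.[a] * \prod_(w <- ws) normc (a - w).
  by rewrite deriv_factor /Q !hornerE normcM -normc_prod poly_ofE.
rewrite mulrAC (mulrA (normc _)) mulrA ler_pM2r//.
apply: discrete_jensen => // x xs.
rewrite -normc_prod -poly_ofE /Q hornerC -normcM -deriv_factor -mulrA.
by apply: deriv_poly_of_bound; rewrite ?xs.
Qed.

End AtPoint.
End CriticalPoints.

(** * Logarithmic means over equally spaced points of a circle *)

Section Circles.
Context {R : realType}.
Implicit Types (a c w x y z : R[i]) (s r : R) (ws zs : seq R[i]).

Definition circle_point c r w (i : nat) : R[i] := c + real_complex R r * w ^+ i.
(** By Jensen's formula, the mean of ln |y - a| over the circle |a - c| = r. *)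
Definition logmax c r y : R := ln (Num.max (normc (y - c)) r).

Lemma circle_prod m w c r y : 0 < r -> m.-primitive_root w ->
  \prod_(i < m) (y - circle_point c r w i) = (y - c) ^+ m - real_complex R r ^+ m.
Proof.
move=> r0 pw; have rC : real_complex R r != 0.
  by rewrite -normc_eq0 normcR gtr0_norm// gt_eqF.
have /(congr1 (fun p => p.[(y - c) / real_complex R r])) := factor_Xn_sub_1 pw.
rewrite big_mkord horner_prod; under eq_bigr do rewrite hornerXsubC.
rewrite !hornerE /= => E.
transitivity (real_complex R r ^+ m * (((y - c) / real_complex R r) ^+ m - 1)); last first.
  by rewrite mulrBr mulr1 -exprMn mulrCA divff// mulr1.
rewrite -E -[X in _ ^+ X]card_ord -prodr_const -big_split /=; apply: eq_bigr => i _.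
by rewrite /circle_point mulrBr mulrCA divff// mulr1 opprD addrA.
Qed.

(* The product of the |v - r w^j| over j != i is at least max(|v|, r)^(m - 1)
   for some i, because the cofactors S i sum to m v^(m - 1), and to
   m r^(m - 1) when weighted by w^i. *)
Lemma circle_nearest m w v r : 0 < r -> (0 < m)%N -> m.-primitive_root w ->
  exists i : 'I_m, Num.max (normc v) r ^+ m.-1 * normc (v - real_complex R r * w ^+ i)
    <= normc (v ^+ m - real_complex R r ^+ m).
Proof.
move=> r0 m0 pw; set rC := real_complex R r; set M := Num.max _ _.
pose S (i : nat) := \sum_(l < m) v ^+ (m.-1 - l) * (rC * w ^+ i) ^+ l.
have SE i : v ^+ m - rC ^+ m = (v - rC * w ^+ i) * S i.
  by rewrite -subrXX exprMn -exprM mulnC exprM (prim_expr_order pw) expr1n mulr1.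
have mR0 : 0 < m%:R :> R by rewrite ltr0n.
have sumS : \sum_(i < m) S i = m%:R * v ^+ m.-1.
  rewrite exchange_big /=; case: m m0 pw @S SE mR0 => // m _ pw _ _ _.
  rewrite big_ord_recl [X in _ + X]big1 ?addr0 => [|l _]; last first.
    under eq_bigr do rewrite exprMn mulrA.
    rewrite -mulr_sumr sum_prim_root ?mulr0//.
    by rewrite lift0 gtnNdvd// ltnS ltn_ord.
  under eq_bigr do rewrite expr0 mulr1 subn0.
  by rewrite sumr_const card_ord mulr_natl.
have sumwS : \sum_(i < m) w ^+ i * S i = m%:R * rC ^+ m.-1.
  have E i X l : w ^+ i * (X * (rC * w ^+ i) ^+ l) = X * rC ^+ l * (w ^+ i) ^+ l.+1.
    by rewrite exprMn exprS; ring.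
  under eq_bigr do (rewrite mulr_sumr; under eq_bigr do rewrite E).
  rewrite exchange_big /=; case: m m0 pw @S SE mR0 {sumS} => // m _ pw _ _ _.
  rewrite big_ord_recr /= [X in X + _]big1 ?add0r => [|l _]; last first.
    by rewrite -mulr_sumr sum_prim_root ?mulr0// gtnNdvd// ltnS ltn_ord.
  rewrite subnn expr0; under eq_bigr do
    rewrite mul1r exprAC (prim_expr_order pw) expr1n mulr1.
  by rewrite sumr_const card_ord mulr_natl.
have MS : exists i : 'I_m, M ^+ m.-1 <= normc (S i).
  apply: contrapT => /forallNP lt.
  have ltS (i : 'I_m) : normc (S i) < M ^+ m.-1 by rewrite ltNge; apply/negP/lt.
  have : \sum_(i < m) normc (S i) < m%:R * M ^+ m.-1.
    have -> : m%:R * M ^+ m.-1 = \sum_(i < m) M ^+ m.-1.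
      by rewrite sumr_const card_ord mulr_natl.
    by apply: ltr_sum => //; apply/hasP; exists (Ordinal m0); rewrite ?mem_index_enum.
  apply/negP; rewrite -leNgt /M.
  have [vr|rv] := leP (normc v) r.
    rewrite -[r]gtr0_norm// -normcR -normcX -normc_nat -normcM -sumwS.
    rewrite (le_trans (normc_sum _ _ _))//; apply: ler_sum => i _.
    by rewrite normcM (normc_prim_root _ pw) mul1r.
  by rewrite -normcX -normc_nat -normcM -sumS normc_sum.
case: MS => i Mi; exists i; rewrite (SE i) normcM mulrC.
by apply: ler_wpM2l; rewrite ?normc_ge0.
Qed.

Section Points.
Variables (m : nat) (w : R[i]) (c : R[i]) (r : R).
Hypotheses (m0 : (0 < m)%N) (pw : m.-primitive_root w) (r0 : 0 < r).
Let a i := circle_point c r w i.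

Lemma sum_ln_circle y : (forall i : 'I_m, a i != y) ->
  \sum_(i < m) ln (normc (a i - y)) = ln (normc ((y - c) ^+ m - real_complex R r ^+ m))
  /\ 0 < normc ((y - c) ^+ m - real_complex R r ^+ m).
Proof.
move=> ay; have [|/= p0 ->] := @sum_ln _ _ (index_enum 'I_m) (fun i => normc (a i - y)).
  by move=> i _; rewrite normc_gt0 subr_eq0.
rewrite -(circle_prod c y r0 pw) normc_prod.
under [in X in _ = ln X]eq_bigr do rewrite normc_distC.
split=> //; under eq_bigr do rewrite normc_distC.
exact: p0.
Qed.

Lemma logmax_gt0 y : 0 < Num.max (normc (y - c)) r.
Proof. by rewrite lt_max r0 orbT. Qed.

(** From |v^m - r^m| <= 2 max(|v|, r)^m with v = y - c. This direction needs no [excess]: closeness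
    of y to a sample point only lowers the left side. *)
Lemma sum_ln_circle_le y : (forall i : 'I_m, a i != y) ->
  \sum_(i < m) ln (normc (a i - y)) <= ln 2 + m%:R * logmax c r y.
Proof.
move=> /sum_ln_circle[-> p0]; rewrite /logmax mulr_natl -lnXn ?logmax_gt0//.
rewrite -lnM ?posrE ?exprn_gt0 ?logmax_gt0// ler_ln ?posrE ?mulr_gt0 ?exprn_gt0 ?logmax_gt0//.
rewrite (le_trans (normcD _ _))// normcN !normcX normcR gtr0_norm// mulrDl mul1r.
by rewrite lerD// lerXn2r ?nnegrE ?normc_ge0 ?(ltW (logmax_gt0 _)) ?(ltW r0)// le_max lexx ?orbT.
Qed.

(** [circle_nearest] bounds |v^m - r^m| from below by max(|v|, r)^(m - 1) times a single distance |a
    i - y|. The one missing factor max(|v|, r) is paid for by ln (2 r / s) and the excess at that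
    i. *)
Lemma sum_ln_circle_ge y s : 0 < s -> s <= r -> (forall i : 'I_m, a i != y) ->
  m%:R * logmax c r y <= \sum_(i < m) ln (normc (a i - y)) + ln (2 * r / s) +
    \sum_(i < m) excess s (a i) y.
Proof.
move=> s0 sr ay; have [-> p0] := sum_ln_circle ay.
have [i le_i] := circle_nearest (y - c) r0 m0 pw.
have dE : normc (y - c - real_complex R r * w ^+ i) = normc (a i - y).
  by rewrite /a /circle_point [RHS]normc_distC opprD addrA.
rewrite dE in le_i.
have le_e : excess s (a i) y <= \sum_(i < m) excess s (a i) y.
  by rewrite (bigD1 i)//= lerDl sumr_ge0// => j _; rewrite excess_ge0.
apply: le_trans (lerD (lexx _) le_e); rewrite -lerBlDr.
rewrite -lerBlDr /excess.
have ai0 : 0 < normc (a i - y) by rewrite normc_gt0 subr_eq0.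
set M := Num.max (normc (y - c)) r in le_i *; have M0 : 0 < M by exact: logmax_gt0.
have le1 : m.-1%:R * logmax c r y + ln (normc (a i - y)) <=
    ln (normc ((y - c) ^+ m - real_complex R r ^+ m)).
  rewrite /logmax mulr_natl -lnXn// -lnM ?posrE ?exprn_gt0//.
  by rewrite ler_ln ?posrE ?mulr_gt0 ?exprn_gt0//.
(* If M <= 2 r, the truncation at s suffices. Otherwise M = |y - c|, so |a i - y| >= M - r >= M / 2,
   and 2 <= 2 r / s. *)
have le2 : logmax c r y <= ln (Num.max (normc (a i - y)) s) + ln (2 * r / s).
  have q0 : 0 < 2 * r / s by rewrite divr_gt0// mulr_gt0.
  have mx0 : 0 < Num.max (normc (a i - y)) s by rewrite lt_max s0 orbT.
  rewrite -lnM ?posrE// ler_ln ?posrE ?mulr_gt0 ?invr_gt0//.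
  have [le|gt] := leP M (2 * r).
    rewrite (le_trans le)// -[leLHS](divfK (_ : s != 0)) ?gt_eqF// mulrC.
    by rewrite ler_pM2r// le_max lexx orbT.
  have Mv : M = normc (y - c).
    rewrite /M; apply/max_idPl; rewrite leNgt; apply/negP => lt.
    by move: gt; rewrite /M (max_idPr (ltW lt)) mulrDl mul1r ltNge lerDl ltW.
  have h1 : M / 2 <= normc (a i - y).
    have := normcB_ge (y - c) (real_complex R r * w ^+ i).
    rewrite dE normcM normcR (normc_prim_root _ pw) mulr1 gtr0_norm// -Mv.
    by move: gt; lra.
  have h2 : 2 <= 2 * r / s by rewrite ler_pdivlMr// ler_pM2l.
  rewrite -/M -[leLHS](divfK (_ : 2 != 0))//; apply: ler_pM => //; first by rewrite divr_ge0 ?ltW.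
  by rewrite le_max h1.
have -> : m%:R * logmax c r y = m.-1%:R * logmax c r y + logmax c r y.
  by rewrite -[in LHS](prednK m0) -addn1 natrD mulrDl mul1r.
by rewrite /logmax -/M in le1 le2 *; move: le1 le2; lra.
Qed.

(** [sum_ln_critical] is summed over the m points, and both root sums are compared with their
    [logmax] sums. A zero costs ln 2 on one side and ln (2 r / s) on the other, which add up to ln
    (4 r / s), divided by m. *)
Lemma critical_circle zs s d B : (0 < size zs)%N -> 0 < s -> s <= r ->
  0 < d -> d <= 1 -> 1 <= B ->
  (forall i : 'I_m, a i \notin zs) ->
  (forall i : 'I_m, d <= normc (logder zs (a i))) ->
  (forall i : 'I_m, absder zs (a i) <= B) ->
  `|\sum_(w <- zeros (poly_of zs)^`()) logmax c r w - \sum_(z <- zs) logmax c r z|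
  <= (size zs)%:R / m%:R * ln (4 * r / s)
   + s / m%:R * \sum_(i < m) absder zs (a i) + ln (size zs)%:R + ln B - ln d.
Proof.
move=> zs0 s0 sr d0 d1 B1 azs dL HB; set ws := zeros _; set k := size zs.
have mR0 : 0 < m%:R :> R by rewrite ltr0n.
have L0 (i : 'I_m) : logder zs (a i) != 0.
  by rewrite -normc_gt0 (lt_le_trans d0).
have H0 (i : 'I_m) : 0 < absder zs (a i).
  by rewrite (lt_le_trans d0)// (le_trans (dL i))// normc_logder.
have aws y (i : 'I_m) : y \in ws -> a i != y.
  exact: (notin_critical zs0 (azs i) (L0 i)).
have azs' y (i : 'I_m) : y \in zs -> a i != y.
  by move=> yz; apply: contraNneq (azs i) => ->.
have kw : (size ws <= k)%N by rewrite /ws size_zeros_deriv// leq_pred.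
set l2 := ln (2 * r / s).
have l20 : 0 <= l2.
  rewrite ln_ge0// ler_pdivlMr// mul1r (le_trans sr)//.
  by rewrite ler_peMl ?ltW// ltr1n.
have -> : ln (4 * r / s) = ln 2 + l2.
  rewrite -lnM ?posrE ?divr_gt0 ?mulr_gt0//; congr ln; rewrite !mulrA -natrM.
  by [].
set T := \sum_(i < m) absder zs (a i).
have T0 : 0 <= s * T.
  by rewrite mulr_ge0 ?(ltW s0)// sumr_ge0// => i _; exact: absder_ge0.
pose SW := \sum_(i < m) \sum_(w <- ws) ln (normc (a i - w)).
pose SZ := \sum_(i < m) \sum_(z <- zs) ln (normc (a i - z)).
pose lam := \sum_(i < m) ln (normc (logder zs (a i))).
pose h := \sum_(i < m) ln (absder zs (a i)).
have sum_m (u : R) : \sum_(i < m) u = m%:R * u by rewrite sumr_const card_ord mulr_natl.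
have sum_s (t : seq R[i]) (u : R) : \sum_(z <- t) u = (size t)%:R * u.
  by rewrite big_const_seq count_predT iter_addr addr0 mulr_natl.
have SWZ : SW - SZ = lam - m%:R * ln k%:R.
  rewrite -sumrB -sum_m -sumrB; apply: eq_bigr => i _.
  exact: (sum_ln_critical zs0 (azs i) (L0 i)).
have hB : h <= m%:R * ln B.
  rewrite -sum_m; apply: ler_sum => i _; rewrite ler_ln ?posrE ?H0//.
  by rewrite (lt_le_trans ltr01).
have lamd : m%:R * ln d <= lam.
  by rewrite -sum_m; apply: ler_sum => i _; rewrite ler_ln ?posrE// normc_gt0.
have exW : \sum_(w <- ws) \sum_(i < m) excess s (a i) w <= h + s * T - lam.
  rewrite exchange_big /= mulr_sumr -big_split -sumrB /=; apply: ler_sum => i _.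
  exact: (sum_excess_critical zs0 (azs i) (L0 i) s0).
have exZ : \sum_(z <- zs) \sum_(i < m) excess s (a i) z <= s * T.
  rewrite exchange_big /= mulr_sumr; apply: ler_sum => i _.
  rewrite mulr_sumr big_seq [leRHS]big_seq; apply: ler_sum => z zz.
  by rewrite excess_le// azs'.
have up (t : seq R[i]) : (forall y (i : 'I_m), y \in t -> a i != y) ->
    \sum_(i < m) \sum_(y <- t) ln (normc (a i - y)) <=
    (size t)%:R * ln 2 + m%:R * \sum_(y <- t) logmax c r y.
  move=> at'; rewrite exchange_big /= mulr_sumr -sum_s -big_split /=.
  rewrite big_seq [leRHS]big_seq; apply: ler_sum => y yt.
  by apply: sum_ln_circle_le => i; exact: at'.
have lo (t : seq R[i]) : (forall y (i : 'I_m), y \in t -> a i != y) ->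
    m%:R * \sum_(y <- t) logmax c r y <=
    \sum_(i < m) \sum_(y <- t) ln (normc (a i - y)) + (size t)%:R * l2
    + \sum_(y <- t) \sum_(i < m) excess s (a i) y.
  move=> at'; rewrite [X in _ <= X + _ + _]exchange_big /= mulr_sumr -sum_s -!big_split /=.
  rewrite big_seq [leRHS]big_seq; apply: ler_sum => y yt.
  by apply: sum_ln_circle_ge => // i; exact: at'.
have upW := up _ aws; have upZ := up _ azs'.
have loW := lo _ aws; have loZ := lo _ azs'.
rewrite -/SW -/SZ -/k in upW upZ loW loZ.
have kwR : (size ws)%:R <= k%:R :> R by rewrite ler_nat.
have ln20 : 0 <= ln 2 :> R by rewrite ln_ge0// ler1n.
have k1 : (size ws)%:R * ln 2 <= k%:R * ln 2 :> R by rewrite ler_wpM2r.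
have k2 : (size ws)%:R * l2 <= k%:R * l2 by rewrite ler_wpM2r.
have mlB : 0 <= m%:R * ln B by rewrite mulr_ge0// ln_ge0.
have mlk : 0 <= m%:R * ln k%:R :> R by rewrite mulr_ge0// ln_ge0// ler1n.
have mld : m%:R * ln d <= 0 by rewrite mulr_ge0_le0// ln_le0.
have -> : k%:R / m%:R * (ln 2 + l2) + s / m%:R * T + ln k%:R + ln B - ln d =
  m%:R^-1 * (k%:R * ln 2 + k%:R * l2 + s * T + m%:R * ln k%:R + m%:R * ln B - m%:R * ln d).
  by field; rewrite gt_eqF.
rewrite -(ler_pM2l mR0) mulrA divff ?gt_eqF// mul1r.
rewrite -[X in X * `|_|]gtr0_norm// -normrM mulrBr.
set GW := m%:R * _ in upW loW *; set GZ := m%:R * _ in upZ loZ *.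
(* When the sum over the critical points is bounded from above, [lam] cancels between [SWZ] and
   [exW], and [hB] finishes. In the other direction - [lam] remains: there the lower bound d on the
   logarithmic derivative enters, through [lamd]. *)
rewrite ler_norml; apply/andP; split; lra.
Qed.

End Points.
End Circles.

(** * Moving the centre along a grid *)

Lemma leq_card_predU (T : finType) (A B : {pred T}) : (#|[predU A & B]| <= #|A| + #|B|)%N.
Proof. by rewrite -cardUI leq_addr. Qed.

Section Grid.
Context {R : realType}.
Implicit Types (x y h : R) (b : R[i]) (K : nat).

(** [Num.sqrt] is 0 on negative numbers, so this is the odd extension of the square root. Twice it
    is an antiderivative of |x|^(-1/2), and its increments turn sums of inverse square roots into
    telescoping ones. *)
Let g x : R := Num.sqrt x - Num.sqrt (- x).

Let g_mono x : g (x - 1) <= g x.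
Proof. by rewrite lerB// ler_wsqrtr// ?lerN2 lerBlDr lerDl. Qed.

Let g_step x : 1 <= `|x| -> (Num.sqrt `|x|)^-1 <= 4 * (g x - g (x - 1)).
Proof.
have aux (p q : R) : 0 < q -> p ^+ 2 = q ^+ 2 + 1 -> 0 <= p -> p <= 2 * q -> 
    q^-1 <= 4 * (p - q).
  move=> q0 pq p0 p2q.
  rewrite -(ler_pM2l q0) divff ?gt_eqF//.
  have : (p - q) * (p + q) = 1 by rewrite -subr_sqr pq addrC addKr.
  have qp : q <= p by nra.
  nra.
have [x0|x0] := ger0P x => x1.
  have s0 : 0 < Num.sqrt x by rewrite sqrtr_gt0 (lt_le_trans _ x1).
  rewrite /g !(ler0_sqrtr (a := - x)) ?oppr_le0// (ler0_sqrtr (a := - (x - 1))) ?oppr_le0 ?subr_ge0//.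
  rewrite !subr0 -(ler_pM2l s0) divff ?gt_eqF//.
  have q0 := sqrtr_ge0 (x - 1).
  have E : Num.sqrt x ^+ 2 = Num.sqrt (x - 1) ^+ 2 + 1.
    by rewrite !sqr_sqrtr ?subrK// subr_ge0.
  nra.
rewrite /g (ler0_sqrtr (ltW x0)) (ler0_sqrtr (a := x - 1)) ?subr_le0; last by lra.
rewrite !sub0r opprK addrC; apply: aux; rewrite ?sqrtr_ge0//.
- by rewrite sqrtr_gt0; lra.
- by rewrite !sqr_sqrtr; lra.
- rewrite -[2]gtr0_norm// -sqrtr_sqr -sqrtrM ?sqr_ge0//; apply: ler_wsqrtr; lra.
Qed.

Let g_diff x y : 0 <= y -> g (x + y) - g x <= 2 * Num.sqrt y.
Proof.
move=> y0.
have sub (a c : R) : 0 <= a -> 0 <= c -> Num.sqrt (a + c) <= Num.sqrt a + Num.sqrt c.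
  move=> a0 c0; rewrite -[leRHS]ger0_norm ?addr_ge0 ?sqrtr_ge0// -sqrtr_sqr.
  apply: ler_wsqrtr; rewrite sqrrD !sqr_sqrtr// lerD2r lerDl.
  by rewrite mulrn_wge0// mulr_ge0 ?sqrtr_ge0.
have [x0|x0] := leP 0 x.
  rewrite /g !(ler0_sqrtr (a := - _)) ?oppr_le0 ?addr_ge0//.
  have := sub _ _ x0 y0; have := sqrtr_ge0 y; lra.
rewrite /g (ler0_sqrtr (ltW x0)).
have [xy|xy] := leP 0 (x + y).
  rewrite (ler0_sqrtr (a := - (x + y))) ?oppr_le0//.
  have : Num.sqrt (x + y) <= Num.sqrt y by apply: ler_wsqrtr; lra.
  have : Num.sqrt (- x) <= Num.sqrt y by apply: ler_wsqrtr; lra.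
  by lra.
rewrite (ler0_sqrtr (ltW xy)).
have : Num.sqrt (- (x + y) + y) <= _ := sub (- (x + y)) y _ y0.
have -> : - (x + y) + y = - x by lra.
have := sqrtr_ge0 y; move=> ? H; have := H _; lra.
Qed.

(** Each term is at most 4 times an increment of [g], and [g] grows by at most 2 sqrt K over K unit
    steps, wherever x is. *)
Lemma sum_invsqrt_far K x :
  \sum_(u < K | 1 <= `|u%:R - x|) (Num.sqrt `|u%:R - x|)^-1 <= 8 * Num.sqrt K%:R.
Proof.
have step (u : 'I_K) : 1 <= `|u%:R - x| ->
    (Num.sqrt `|u%:R - x|)^-1 <= 4 * (g (u.+1%:R - 1 - x) - g (u%:R - 1 - x)).
  by move=> /g_step; rewrite -[u.+1%:R]natr1 addrK [u%:R - 1 - x]addrAC.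
rewrite (le_trans (ler_sum _ step))//.
apply: le_trans (_ : \sum_(u < K) 4 * (g (u.+1%:R - 1 - x) - g (u%:R - 1 - x)) <= _).
  rewrite big_mkcond; apply: ler_sum => u _; case: ifP => // _.
  rewrite mulr_ge0// subr_ge0 -[u.+1%:R]natr1 addrK.
  by rewrite [u%:R - 1 - x]addrAC g_mono.
rewrite -mulr_sumr -(big_mkord xpredT (fun u => g (u.+1%:R - 1 - x) - g (u%:R - 1 - x))).
rewrite telescope_sumr// sub0r.
have := g_diff (- 1 - x) (ler0n R K).
have -> : - 1 - x + K%:R = K%:R - 1 - x by lra.
lra.
Qed.

Lemma card_near K x : (#|[pred u : 'I_K | (`|u%:R - x| < 1)%R]| <= 2)%N.
Proof.
pose f (u : 'I_K) : int := u%:Z.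
have fi : injective f by move=> u v [] /ord_inj.
rewrite cardE -(size_map f); apply: (@uniq_leq_size _ _ [:: Num.floor x; Num.floor x + 1]).
  by rewrite map_inj_uniq// enum_uniq.
move=> _ /mapP[u + ->]; rewrite mem_enum !inE => ux.
move: ux; rewrite ltr_norml => /andP[xu ux].
have le1 : f u <= Num.floor x + 1.
  by rewrite -lerBlDr floor_ge_int rmorphB /= -[(f u)%:~R]/(u%:R : R); lra.
have le2 : Num.floor x <= f u.
  rewrite -ltzD1 -(ltr_int R) rmorphD /= -[(f u)%:~R]/(u%:R : R).
  by have := floor_le x; lra.
lia.
Qed.

Section Shifts.
Variables (h : R) (K : nat).
Hypotheses (h0 : 0 < h) (K0 : (0 < K)%N).

Definition shift (p : 'I_K * 'I_K) : R[i] :=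
  complex.Complex (h / K%:R * p.1%:R) (h / K%:R * p.2%:R).

(** Removing a cross around b rather than a disc costs at most 4 K nodes and leaves a product set,
    so that the sum over far nodes factors. *)
Definition far b (p : 'I_K * 'I_K) : bool :=
  (1 <= `|p.1%:R - complex.Re b * (K%:R / h)|) &&
  (1 <= `|p.2%:R - complex.Im b * (K%:R / h)|).

Let KR0 : 0 < K%:R :> R. Proof. by rewrite ltr0n. Qed.

Let shiftE p b : normc (shift p - b) = h / K%:R * Num.sqrt (
   (p.1%:R - complex.Re b * (K%:R / h)) ^+ 2 + (p.2%:R - complex.Im b * (K%:R / h)) ^+ 2).
Proof.
case: b => b1 b2; rewrite /shift /normc /=.
rewrite -[h / K%:R in RHS]gtr0_norm ?divr_gt0// -sqrtr_sqr -sqrtrM ?sqr_ge0//.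
congr Num.sqrt; rewrite mulrDr -!exprMn; congr (_ ^+ 2 + _ ^+ 2);
by field; rewrite !gt_eqF.
Qed.

Lemma far_dist b p : far b p -> h / K%:R <= normc (shift p - b).
Proof.
case/andP => f1 _; rewrite shiftE ler_pMr ?divr_gt0//.
rewrite (le_trans f1)// -sqrtr_sqr; apply: ler_wsqrtr.
by rewrite lerDl sqr_ge0.
Qed.

(* |x + iy|^2 >= |x| |y| reduces the planar sum to two linear ones. *)
Lemma sum_far b :
  \sum_(p | far b p) (normc (shift p - b))^-1 <= 64 * K%:R ^+ 2 / h.
Proof.
set X := complex.Re b * (K%:R / h); set Y := complex.Im b * (K%:R / h).
pose F (x : R) (u : 'I_K) := (Num.sqrt `|u%:R - x|)^-1.
have le1 p : far b p -> (normc (shift p - b))^-1 <= K%:R / h * (F X p.1 * F Y p.2).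
  case/andP; rewrite -/X -/Y => f1 f2; rewrite shiftE -/X -/Y invfM invf_div.
  rewrite ler_pM2l ?divr_gt0// /F -invfM lef_pV2 ?posrE; last 2 first.
  - rewrite sqrtr_gt0 ltr_pwDl ?sqr_ge0// exprn_even_gt0//.
    by rewrite -normr_gt0 (lt_le_trans ltr01).
  - by rewrite mulr_gt0// sqrtr_gt0 (lt_le_trans ltr01).
  rewrite -sqrtrM//; apply: ler_wsqrtr.
  rewrite -(real_normK (num_real (p.1%:R - X))) -(real_normK (num_real (p.2%:R - Y))).
  by nra.
rewrite (le_trans (ler_sum _ le1))// -mulr_sumr.
rewrite /far -/X -/Y.
rewrite -(pair_big (fun u : 'I_K => 1 <= `|u%:R - X|) (fun u : 'I_K => 1 <= `|u%:R - Y|)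
   (fun u v => F X u * F Y v)) /=.
under eq_bigr do rewrite -mulr_sumr.
rewrite -mulr_suml.
have F0 x (u : 'I_K) : 0 <= F x u by rewrite invr_ge0 sqrtr_ge0.
have -> : 64 * K%:R ^+ 2 / h = K%:R / h * (8 * Num.sqrt K%:R * (8 * Num.sqrt K%:R)) :> R.
  have := sqr_sqrtr (ltW KR0); move: (Num.sqrt _) => q <-; ring.
rewrite ler_pM2l ?divr_gt0//; apply: ler_pM; rewrite ?sumr_ge0//; exact: sum_invsqrt_far.
Qed.

Lemma card_not_far b : (#|[pred p | ~~ far b p]| <= 4 * K)%N.
Proof.
pose N x := [pred u : 'I_K | (`|u%:R - x| < 1)%R].
set X := complex.Re b * (K%:R / h); set Y := complex.Im b * (K%:R / h).
have sub : [pred p | ~~ far b p] \subset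
    [predU [predX N X & 'I_K] & [predX 'I_K & N Y]].
  apply/fintype.subsetP => -[u v]; rewrite !inE negb_and -!ltNge /= -/X -/Y.
  by rewrite andbT.
rewrite (leq_trans (subset_leq_card sub))// (leq_trans (leq_card_predU _ _))//.
rewrite !cardX card_ord -(addn2 2) mulnDl leq_add//.
  by rewrite leq_mul2r card_near orbT.
by rewrite mulnC leq_mul2r card_near orbT.
Qed.

Lemma card_all_far bs : (#|[pred p | ~~ all (far^~ p) bs]| <= 4 * K * size bs)%N.
Proof.
elim: bs => [|b bs IH] /=; first by rewrite muln0 eq_card0.
rewrite mulnS; apply: leq_trans (leq_add (card_not_far b) IH).
rewrite (leq_trans _ (leq_card_predU _ _))//; apply: subset_leq_card.
by apply/fintype.subsetP => p; rewrite !inE negb_and.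
Qed.

(** Markov's inequality on the grid: by [sum_far] the mean of the sum is at most 64 / h per element
    of bs, and 512 = 8 * 64. *)
Lemma card_large_sum bs :
  (8 * #|[pred p | all (far^~ p) bs &
     (512 / h * (size bs)%:R < \sum_(b <- bs) (normc (shift p - b))^-1)%R]| <= K ^ 2)%N.
Proof.
pose S p := \sum_(b <- bs) (normc (shift p - b))^-1.
pose D := [pred p | all (far^~ p) bs & (512 / h * (size bs)%:R < S p)%R].
rewrite -/D.
have [n0|n0] := posnP (size bs).
  rewrite eq_card0 ?muln0// => p; rewrite !inE /S (size0nil n0) big_nil mulr0 ltxx.
  by rewrite andbF.
have n0R : 0 < (size bs)%:R :> R by rewrite ltr0n.
have le1 : #|D|%:R * (512 / h * (size bs)%:R) <= \sum_(p in D) S p.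
  rewrite -sum1_card natr_sum mulr_suml; apply: ler_sum => p.
  by rewrite inE mul1r => /andP[_ /ltW].
have le2 : \sum_(p in D) S p <= (size bs)%:R * (64 * K%:R ^+ 2 / h).
  rewrite /S exchange_big /=.
  have -> : (size bs)%:R * (64 * K%:R ^+ 2 / h) = \sum_(b <- bs) (64 * K%:R ^+ 2 / h) :> R.
    by rewrite big_const_seq count_predT iter_addr addr0 mulr_natl.
  rewrite big_seq [leRHS]big_seq; apply: ler_sum => b bb.
  apply: le_trans (sum_far b).
  rewrite big_mkcond [leRHS]big_mkcond; apply: ler_sum => p _.
  rewrite inE; case: ifP => [/andP[/allP/(_ _ bb) -> _]|_]//.
  by case: ifP; rewrite // invr_ge0 normc_ge0.
have := le_trans le1 le2; rewrite -(ler_nat R) natrM natrX.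
have -> : #|D|%:R * (512 / h * (size bs)%:R) = (8%:R * #|D|%:R) * (64 / h * (size bs)%:R) :> R.
  by field; rewrite gt_eqF.
have -> : (size bs)%:R * (64 * K%:R ^+ 2 / h) = K%:R ^+ 2 * (64 / h * (size bs)%:R) :> R by ring.
by rewrite ler_pM2r// mulr_gt0// divr_gt0.
Qed.

(** There are five exceptional sets of at most K^2 / 8 nodes each: D, the three sets of
    [card_large_sum], and the nodes that are not far, at most 4 K per element of the lists. *)
Lemma shift_select (bs1 bs2 bs3 : seq R[i]) (D : pred ('I_K * 'I_K)) :
  (32 * (size bs1 + size bs2 + size bs3) <= K)%N -> (8 * #|D| <= K ^ 2)%N ->
  exists p, [/\ ~~ D p, all (far^~ p) (bs1 ++ bs2 ++ bs3) &
    forall bs, bs \in [:: bs1; bs2; bs3] ->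
      \sum_(b <- bs) (normc (shift p - b))^-1 <= 512 / h * (size bs)%:R].
Proof.
move=> szK cD.
pose N := [pred p | ~~ all (far^~ p) (bs1 ++ bs2 ++ bs3)].
pose L bs := [pred p | all (far^~ p) bs &
     (512 / h * (size bs)%:R < \sum_(b <- bs) (normc (shift p - b))^-1)%R].
pose U : pred _ := [predU D & [predU N & [predU L bs1 & [predU L bs2 & L bs3]]]].
have cU : (8 * #|U| < 8 * K ^ 2)%N.
  have h1 : (#|U| <= #|D| + (#|N| + (#|L bs1| + (#|L bs2| + #|L bs3|))))%N.
    by do 4! [rewrite (leq_trans (leq_card_predU _ _))// ?leq_add2l].
  have := card_all_far (bs1 ++ bs2 ++ bs3); rewrite !size_cat addnA -/N => h2.
  have := card_large_sum bs1; rewrite -/(L bs1) => h3.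
  have := card_large_sum bs2; rewrite -/(L bs2) => h4.
  have := card_large_sum bs3; rewrite -/(L bs3) => h5.
  have : (K * (32 * (size bs1 + size bs2 + size bs3)) <= K * K)%N by rewrite leq_mul2l szK orbT.
  have : (0 < K ^ 2)%N by rewrite expn_gt0 K0.
  have -> : (K ^ 2 = K * K)%N by rewrite expnS expn1.
  move: h3 h4 h5 cD; have -> : (K ^ 2 = K * K)%N by rewrite expnS expn1.
  lia.
have /existsP[p pU] : [exists p, p \notin U].
  rewrite -negb_forall; apply: contraTN cU => /forallP UT.
  rewrite -leqNgt leq_mul2l/=; have -> : #|U| = #|{: 'I_K * 'I_K}|.
    by apply: eq_card => p; rewrite UT.
  by rewrite card_prod card_ord expnS expn1.
exists p; move: pU; rewrite !inE !negb_or => /and5P[nD nN n1 n2 n3].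
have allf : all (far^~ p) (bs1 ++ bs2 ++ bs3) by move: nN; rewrite negbK.
move: (allf); rewrite !all_cat => /and3P[a1 a2 a3].
split; [exact: nD | by rewrite a1 a2 a3 | move=> bs]; rewrite !inE => /or3P[] /eqP->; rewrite leNgt.
- by move: n1; rewrite a1.
- by move: n2; rewrite a2.
- by move: n3; rewrite a3.
Qed.

End Shifts.
End Grid.

(** * Anti-concentration *)

Section Antichains.
Context {R : realType}.

(** The LYM inequality, by induction on V. Unless V itself is the only member, the inequality holds
    for the members avoiding i inside V minus i; summing over i counts each S exactly |V| - |S|
    times, and (n - s) C(n, s) = n C(n - 1, s). *)
Lemma lym (T : finType) (V : {set T}) (B : {set {set T}}) :
  (forall S, S \in B -> S \subset V) ->
  (forall S S', S \in B -> S' \in B -> S \subset S' -> S = S') ->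
  \sum_(S in B) ('C(#|V|, #|S|)%:R)^-1 <= 1 :> R.
Proof.
have [n] := ubnP #|V|; elim: n V B => // n IH V B Vn BV anti.
have [VB|VB] := boolP (V \in B).
  have -> : B = [set V]%SET.
    apply/finset.setP => S; rewrite inE; apply/idP/eqP => [SB|->//].
    exact: (anti S V SB VB (BV S SB)).
  by rewrite big_set1 binn invr1.
have [V0|V0] := posnP #|V|.
  rewrite big1// => S SB; case/negP: VB.
  by have := BV S SB; rewrite (cards0_eq V0) finset.subset0 => /eqP <-.
have V0R : 0 < #|V|%:R :> R by rewrite ltr0n.
have sz S : S \in B -> (#|S| < #|V|)%N.
  move=> SB; rewrite ltn_neqAle subset_leq_card ?BV// andbT.
  apply: contraNneq VB => SV; suff <- : S = V by [].
  by apply/eqP; rewrite eqEcard BV// SV leqnn.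
pose Bi i := [set S in B | i \notin S]%SET.
have le1 i : i \in V -> \sum_(S in Bi i) ('C(#|V|.-1, #|S|)%:R)^-1 <= 1 :> R.
  move=> iV; have cV : #|V|.-1 = #|V :\ i| by rewrite (cardsD1 i V) iV.
  rewrite cV; apply: IH.
  - by rewrite -cV; move: Vn; rewrite -(prednK V0) ltnS.
  - move=> S; rewrite inE => /andP[SB iS]; rewrite finset.subsetD1 iS andbT; exact: BV.
  - by move=> S S'; rewrite !inE => /andP[SB _] /andP[SB' _]; exact: anti.
have : \sum_(i in V) \sum_(S in Bi i) ('C(#|V|.-1, #|S|)%:R)^-1 <= #|V|%:R :> R.
  have -> : #|V|%:R = \sum_(i in V) 1 :> R by rewrite sumr_const.
  by apply: ler_sum => i iV; exact: le1.
rewrite (exchange_big_dep (fun S => S \in B)) /=; last first.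
  by move=> i S _; rewrite inE => /andP[].
have -> : \sum_(S in B) \sum_(i in V | S \in Bi i)
    ('C(#|V|.-1, #|S|)%:R)^-1 = #|V|%:R * \sum_(S in B) ('C(#|V|, #|S|)%:R)^-1 :> R.
  rewrite mulr_sumr; apply: eq_bigr => S SB.
  rewrite (eq_bigl (fun i => i \in V :\: S)) => [|i]; last first.
    by rewrite !inE SB /= andbC.
  rewrite sumr_const cardsD (finset.setIidPr (BV S SB)) -[LHS]mulr_natl.
  have c0 : ('C(#|V|, #|S|)%:R : R) != 0 by rewrite pnatr_eq0 -lt0n bin_gt0 ltnW// sz.
  have c1 : ('C(#|V|.-1, #|S|)%:R : R) != 0.
    by rewrite pnatr_eq0 -lt0n bin_gt0 -ltnS prednK// sz.
  apply/eqP; rewrite eqr_div// -!natrM; apply/eqP; congr _%:R.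
  by rewrite mul_bin_down mulnC.
by rewrite -ler_pdivlMl// mulVf// gt_eqF.
Qed.

(** Sperner's bound with X standing for the largest binomial coefficient, so that the middle level
    need not be located. *)
Lemma card_antichain_le (T : finType) (V : {set T}) (B : {set {set T}}) (X : R) :
  (forall S, S \in B -> S \subset V) ->
  (forall S S', S \in B -> S' \in B -> S \subset S' -> S = S') ->
  (forall h, 'C(#|V|, h)%:R <= X) -> #|B|%:R <= X.
Proof.
move=> BV anti CX.
have X0 : 0 < X by apply: lt_le_trans (CX 0%N); rewrite bin0.
rewrite -[X]mul1r -ler_pdivrMr//; apply: le_trans (lym BV anti).
rewrite -sum1_card natr_sum mulr_suml; apply: ler_sum => S SB.
rewrite mul1r lef_pV2 ?posrE// ltr0n bin_gt0.
exact/subset_leq_card/BV.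
Qed.

(** C(2m, m) <= 4^m / sqrt (2m + 1), squared to stay in [nat]. The induction step reduces to (2m +
    3) (2m + 1) <= 4 (m + 1)^2. *)
Lemma central_bin m : ((2 * m).+1 * 'C(2 * m, m) ^ 2 <= 16 ^ m)%N.
Proof.
elim: m => // m IH.
have e : (m.+1 * 'C(2 * m.+1, m.+1) = 2 * (2 * m).+1 * 'C(2 * m, m))%N.
  have h3 := mul_bin_down (2 * m).+1 m.
  have -> : (2 * m.+1 = (2 * m).+2)%N by lia.
  have h4 := mul_bin_diag (2 * m).+2 m.
  move: h3 h4 => /=.
  have -> : ((2 * m).+1 - m = m.+1)%N by lia.
  move=> h3 <-; rewrite -[RHS]mulnA h3; lia.
have : ((m.+1 * m.+1) * ((2 * m.+1).+1 * 'C(2 * m.+1, m.+1) ^ 2) <=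
        (m.+1 * m.+1) * 16 ^ m.+1)%N.
  have -> : ((m.+1 * m.+1) * ((2 * m.+1).+1 * 'C(2 * m.+1, m.+1) ^ 2) =
    (2 * m.+1).+1 * (m.+1 * 'C(2 * m.+1, m.+1)) ^ 2)%N by rewrite expnMn; ring.
  rewrite e expnMn.
  have -> : ((2 * m.+1).+1 * ((2 * (2 * m).+1) ^ 2 * 'C(2 * m, m) ^ 2) =
    4 * ((2 * m).+3 * (2 * m).+1) * ((2 * m).+1 * 'C(2 * m, m) ^ 2))%N by ring.
  have -> : ((m.+1 * m.+1) * 16 ^ m.+1 = 16 * (m.+1 * m.+1) * 16 ^ m)%N by rewrite expnS; ring.
  by apply: leq_mul => //; nia.
by rewrite leq_pmul2l.
Qed.

(** By Vandermonde C(n, h)^2 <= C(2n, n), which treats every level and both parities of n at once.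
    The resulting decay of order n^(-1/4) is not optimal, but any decay will do. *)
Lemma bin_pow4 n h : ((2 * n).+1 * 'C(n, h) ^ 4 <= 16 ^ n)%N.
Proof.
have [hn|hn] := leqP h n; last by rewrite bin_small// exp0n// muln0.
have c2 : ('C(n, h) ^ 2 <= 'C(2 * n, n))%N.
  rewrite mul2n -addnn -(binomial.Vandermonde n n n).
  rewrite (bigD1 (inord h)) //= inordK ?ltnS// bin_sub// expnS expn1.
  exact: leq_addr.
apply: leq_trans (central_bin n); rewrite leq_mul2l -[4%N]/(2 * 2)%N expnM.
by rewrite leq_exp2r.
Qed.

Lemma bin_small_frac (e : R) : 0 < e ->
  exists Q, forall q h, (Q <= q)%N -> 'C(q, h)%:R <= e * 2 ^+ q.
Proof.
move=> e0; have e4 : 0 < e ^+ 4 by rewrite exprn_gt0.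
exists (Num.truncn (e ^+ 4)^-1).+1 => q h Qq.
rewrite -(ler_pXn2r (n := 4)) ?nnegrE// ?mulr_ge0 ?exprn_ge0 ?(ltW e0)//.
rewrite exprMn -exprM mulnC exprM.
have q0 : 0 < ((2 * q).+1)%:R :> R by rewrite ltr0n.
rewrite -(ler_pM2l q0) -natrX -natrM.
apply: le_trans (_ : (16 ^ q)%:R <= _); first by rewrite ler_nat bin_pow4.
have -> : (16 ^ q)%:R = 2 ^+ 4 ^+ q :> R.
  by rewrite -[16%N]/(2 ^ 4)%N !natrX.
rewrite mulrA ler_peMl ?exprn_ge0//.
rewrite -ler_pdivrMr// mul1r ltW//.
apply: lt_le_trans (truncnS_gt _) _; rewrite ler_nat.
by apply: leq_trans Qq _; lia.
Qed.

(* Flipping the sign of the negative increments turns the family into an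
   antichain, because any enlargement moves the sum by at least g. *)
Lemma card_small_sums (M : nat) (v : 'I_M -> R) (W : {set 'I_M}) (u g X : R) : 0 < g ->
  (forall l, l \in W -> g <= `|v l|) ->
  (forall h, 'C(#|W|, h)%:R <= X * 2 ^+ #|W|) ->
  #|[pred S : {set 'I_M} | (`|u + \sum_(l in S) v l| < g / 2)%R]|%:R <= X * 2 ^+ M.
Proof.
move=> g0 Wg CX.
pose D := [set S : {set 'I_M} | (`|u + \sum_(l in S) v l| < g / 2)%R]%SET.
have -> : #|[pred S : {set 'I_M} | (`|u + \sum_(l in S) v l| < g / 2)%R]| = #|D|.
  by apply: eq_card => S; rewrite !inE.
(* The part of S outside W is frozen, because only the increments in W are known to be large;
   Sperner's bound is then used in each fibre. *)
pose fiber (U : {set 'I_M}) := [set S in D | S :\: W == U]%SET.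
have fib U : #|fiber U|%:R <= X * 2 ^+ #|W|.
  pose F := [set l in W | (v l < 0)%R]%SET.
  pose flip (S : {set 'I_M}) := ((S :&: W) :\: F) :|: (F :\: S).
  have flipE S l : (l \in flip S) = (l \in W) && ((l \in S) (+) (v l < 0)).
    rewrite !inE; case: (l \in W); case: (l \in S); case: (v l < 0) => //=;
    by rewrite ?andbF ?orbF.
  have inj : {in fiber U &, injective flip}.
    move=> S S'; rewrite !inE => /andP[_ /eqP SU] /andP[_ /eqP SU'] E.
    apply/finset.setP => l; have [lW|lW] := boolP (l \in W).
      by have := congr1 (fun A : {set 'I_M} => l \in A) E; rewrite !flipE lW /= => /addIb.
    have := congr1 (fun A : {set 'I_M} => l \in A) (etrans SU (esym SU')).
    by rewrite !inE lW.
  rewrite -(card_in_imset inj); apply: (@card_antichain_le _ W) => //.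
    move=> _ /imsetP[S _ ->]; apply/fintype.subsetP => l; rewrite flipE.
    by case/andP.
  move=> _ _ /imsetP[S SD ->] /imsetP[S' SD' ->] sub.
  apply/eqP; rewrite finset.eqEsubset sub /=; apply/fintype.subsetP => l lS'.
  apply: contrapT => /negP lS.
  have sumE (Z : {set 'I_M}) : Z \in fiber U -> \sum_(l in Z) v l =
      \sum_(l in flip Z) `|v l| + (\sum_(l in U) v l - \sum_(l in F) `|v l|).
    rewrite inE => /andP[_ /eqP ZU]; rewrite big_mkcond [X in X + _]big_mkcond.
    rewrite [X in _ + (X - _)]big_mkcond [X in _ + (_ - X)]big_mkcond /=.
    rewrite -sumrB -big_split /=; apply: eq_bigr => j _.
    rewrite flipE -ZU !inE.
    have [vj|vj] := ltrP (v j) 0;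
      rewrite ?(ltr0_norm vj) ?(ger0_norm vj);
      by case: (j \in W); case: (j \in Z) => /=; lra.
  have gl : g <= `|v l|.
    by move: lS'; rewrite flipE => /andP[/Wg].
  have sumS : \sum_(j in flip S') `|v j| >= \sum_(j in flip S) `|v j| + g.
    rewrite [leRHS](big_setID (flip S)) /= (finset.setIidPr sub) lerD2l.
    rewrite (bigD1 l) /=; last by rewrite inE lS lS'.
    by rewrite ler_wpDr// sumr_ge0.
  have : `|u + \sum_(l in S) v l| < g / 2 by move: SD; rewrite !inE => /andP[].
  have : `|u + \sum_(l in S') v l| < g / 2 by move: SD'; rewrite !inE => /andP[].
  rewrite (sumE _ SD) (sumE _ SD') !ltr_norml => /andP[h1 h2] /andP[h3 h4].
  by move: sumS h1 h2 h3 h4; lra.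
rewrite -sum1_card (partition_big (fun S => S :\: W) (fun U => U \subset ~: W)) /=; last first.
  move=> S _; apply/fintype.subsetP => l; rewrite !inE; by case/andP.
rewrite natr_sum.
have le U : (\sum_(S in D | S :\: W == U) 1)%:R <= X * 2 ^+ #|W|.
  by apply: le_trans (fib U); rewrite -sum1_card ler_nat; apply/eq_leq/eq_bigl => S; rewrite !inE.
rewrite (le_trans (ler_sum _ (fun U _ => le U)))// sumr_const.
have -> : #|(fun U : {set 'I_M} => U \subset ~: W)| = (2 ^ #|~: W|)%N.
  by rewrite -card_powerset; apply: eq_card => U; rewrite !inE.
rewrite -[leLHS]mulr_natr -mulrA natrX -exprD; have -> // : (#|W| + #|~: W| = M)%N.
by rewrite cardsC card_ord.
Qed.

End Antichains.

(** * Events depending on finitely many indices, and Chebyshev's inequality *)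

Section FiniteLaws.
Context {R : realType} {d : measure_display} {Omega : measurableType d}.
Variable P : probability Omega R.
Implicit Types (E : nat -> set Omega) (N : nat).

(** An event that factors through this finite type is measurable, and its probability is a finite
    sum of values of [law]; probabilistic arguments become finite counting. *)
Definition pattern N E (w : Omega) : {ffun 'I_N -> bool} := [ffun i : 'I_N => w \in E i].

Section Law.
Variables (N : nat) (E : nat -> set Omega).
Hypothesis mE : forall n, measurable (E n).

Lemma measurable_pattern (F : set {ffun 'I_N -> bool}) :
  measurable [set w | F (pattern N E w)].
Proof.
have -> : [set w | F (pattern N E w)] =
    \bigcup_(x in F) [set w | pattern N E w = x].
  apply/seteqP; split=> [w Fw|w [x Fx /= wx]] /=; last by rewrite wx.
  by exists (pattern N E w).
apply: fin_bigcup_measurable => [|x _]; first exact: finite_finset.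
have -> : [set w | pattern N E w = x] =
    \bigcap_(i in [set: 'I_N]) (if x i then E i else ~` E i).
  apply/seteqP; split=> [w <- i _|w Ew].
    by rewrite ffunE; case: ifPn => [/set_mem|/negP wE Ei]//; apply: wE; apply/mem_set.
  apply/ffunP => i; rewrite ffunE; have := Ew i I.
  by case: (x i) => [Ei|nEi]; [exact/mem_set|apply/negbTE/negP => /set_mem].
apply: fin_bigcap_measurable => [|i _]; first exact: finite_finset.
by case: (x i) => //; exact: measurableC.
Qed.

Definition law (x : {ffun 'I_N -> bool}) : R := fine (P [set w | pattern N E w = x]).

Lemma law_ge0 x : 0 <= law x.
Proof. exact/fine_ge0/measure_ge0. Qed.

Lemma lawE x : P [set w | pattern N E w = x] = (law x)%:E.
Proof.
rewrite fineK// ge0_fin_numE// (le_lt_trans (probability_le1 _ _)) ?ltry//.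
exact: (measurable_pattern [set x]).
Qed.

Lemma prob_pattern (F : pred {ffun 'I_N -> bool}) :
  P [set w | F (pattern N E w)] = (\sum_(x | F x) law x)%:E.
Proof.
have -> : [set w | F (pattern N E w)] =
    \bigcup_(x in [set` enum F]) [set w | pattern N E w = x].
  apply/seteqP; split=> [w Fw|w [x /= xF wx]] /=.
    by exists (pattern N E w) => //=; rewrite mem_enum.
  by move: xF; rewrite mem_enum wx.
rewrite measure_fin_bigcup//=; last 2 first.
- by move=> x y _ _ [w [/= <- <-]].
- by move=> x _; exact: (measurable_pattern [set x]).
rewrite -(fsbig_seq _ _ (enum_uniq _)) big_enum /= -sumEFin.
by apply: eq_bigr => x _; rewrite lawE.
Qed.

Lemma sum_law : \sum_x law x = 1.
Proof.
apply: EFin_inj; rewrite -(prob_pattern xpredT) -(probability_setT P).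
by congr (P _); apply/seteqP; split.
Qed.

Lemma sum_law_event (i : 'I_N) : (\sum_(x : {ffun 'I_N -> bool} | x i) law x)%:E = P (E i).
Proof.
rewrite -(prob_pattern (fun x : {ffun 'I_N -> bool} => x i)); congr (P _).
by apply/seteqP; split=> w /=; rewrite ffunE in_setE.
Qed.

Lemma sum_law_event2 (i j : 'I_N) :
  (\sum_(x : {ffun 'I_N -> bool} | x i && x j) law x)%:E = P (E i `&` E j).
Proof.
rewrite -(prob_pattern (fun x : {ffun 'I_N -> bool} => x i && x j)); congr (P _).
apply/seteqP; split=> w /=; rewrite !ffunE; first by move=> /andP[]; rewrite !in_setE.
by move=> [? ?]; apply/andP; rewrite !in_setE.
Qed.

Lemma measurable_deviation (b : nat -> R) (q t : R) :
  measurable [set w | t <= `|\sum_(i < N) b i * ((w \in E i)%:R - q)|].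
Proof.
have -> : [set w | t <= `|\sum_(i < N) b i * ((w \in E i)%:R - q)|] =
   [set w | [set x : {ffun 'I_N -> bool} | t <= `|\sum_(i < N) b i * ((x i)%:R - q)|]
     (pattern N E w)].
  have SE w : \sum_(i < N) b i * ((pattern N E w i)%:R - q) =
      \sum_(i < N) b i * ((w \in E i)%:R - q).
    by apply: eq_bigr => i _; rewrite ffunE.
  by apply/seteqP; split=> w /=; rewrite SE.
exact: measurable_pattern.
Qed.

Section Chebyshev.
Variables (q : R) (b : nat -> R).
Hypotheses (q01 : 0 <= q <= 1) (qE : forall i, (i < N)%N -> P (E i) = q%:E).
Hypothesis qE2 : forall i j, (i < N)%N -> (j < N)%N -> i != j ->
  P (E i `&` E j) = (q ^+ 2)%:E.

Let S (x : {ffun 'I_N -> bool}) : R := \sum_(i < N) b i * ((x i)%:R - q).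

(** Pairwise independence makes the cross terms vanish, and each diagonal term carries q (1 - q) <=
    1. The events E are kept general because they are later both the inclusions A n and the events
    [split_event]. *)
Lemma law_variance : \sum_x law x * S x ^+ 2 <= \sum_(i < N) b i ^+ 2.
Proof.
have [q0 q1] := andP q01.
have s1 (i : 'I_N) : \sum_x law x * (x i)%:R = q.
  apply: EFin_inj; rewrite -(qE (ltn_ord i)) -sum_law_event [X in _ = X%:E]big_mkcond.
  by congr EFin; apply: eq_bigr => x _; case: (x i); rewrite ?mulr1 ?mulr0.
have s2 (i j : 'I_N) : i != j -> \sum_x law x * ((x i)%:R * (x j)%:R) = q ^+ 2.
  move=> ij; apply: EFin_inj; rewrite -(qE2 (ltn_ord i) (ltn_ord j) ij) -sum_law_event2 [X in _ = X%:E]big_mkcond.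
  by congr EFin; apply: eq_bigr => x _; case: (x i); case: (x j); rewrite ?(mulr1, mulr0).
have cov (i j : 'I_N) : \sum_x law x * (((x i)%:R - q) * ((x j)%:R - q)) =
    if i == j then q * (1 - q) else 0.
  have -> : \sum_x law x * (((x i)%:R - q) * ((x j)%:R - q)) =
    \sum_x law x * ((x i)%:R * (x j)%:R) - q * (\sum_x law x * (x j)%:R)
    - q * (\sum_x law x * (x i)%:R) + q ^+ 2 * (\sum_x law x).
    rewrite !mulr_sumr -!sumrB -big_split /=; apply: eq_bigr => x _; ring.
  rewrite !s1 sum_law; case: eqVneq => [<-|ij]; last by rewrite s2//; ring.
  have -> : \sum_x law x * ((x i)%:R * (x i)%:R) = q.
    by rewrite -[RHS](s1 i); apply: eq_bigr => x _; case: (x i); rewrite ?(mulr1, mulr0).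
  ring.
have -> : \sum_x law x * S x ^+ 2 =
    \sum_(i < N) \sum_(j < N) b i * b j * \sum_x law x * (((x i)%:R - q) * ((x j)%:R - q)).
  under [RHS]eq_bigr do (under eq_bigr do rewrite mulr_sumr; rewrite exchange_big).
  rewrite [RHS]exchange_big; apply: eq_bigr => x _ /=.
  rewrite expr2 /S big_distrl /= mulr_sumr; apply: eq_bigr => i _.
  by rewrite big_distrr /= mulr_sumr; apply: eq_bigr => j _; ring.
apply: ler_sum => i _; rewrite (bigD1 i)//= [X in _ + X]big1 ?addr0 => [|j ji].
  rewrite cov eqxx -expr2 ler_piMr ?sqr_ge0//; nra.
by rewrite cov eq_sym (negbTE ji) mulr0.
Qed.

Lemma law_chebyshev (t : R) : 0 < t ->
  (P [set w | (t <= `|\sum_(i < N) b i * ((w \in E i)%:R - q)|)%R] <=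
   ((\sum_(i < N) b i ^+ 2) / t ^+ 2)%:E)%E.
Proof.
move=> t0.
have -> : [set w | t <= `|\sum_(i < N) b i * ((w \in E i)%:R - q)|] =
   [set w | (fun x => t <= `|S x|) (pattern N E w)].
  have SE w : S (pattern N E w) = \sum_(i < N) b i * ((w \in E i)%:R - q).
    by apply: eq_bigr => i _; rewrite ffunE.
  by apply/seteqP; split=> w /=; rewrite SE.
rewrite (prob_pattern (fun x => t <= `|S x|)) lee_fin ler_pdivlMr ?exprn_gt0//.
apply: le_trans law_variance; rewrite mulr_suml.
rewrite big_mkcond; apply: ler_sum => x _; case: ifPn => [tS|_].
  rewrite ler_wpM2l ?law_ge0// -[leRHS]real_normK ?num_real//.
  by rewrite lerXn2r ?nnegrE ?(ltW t0).
by rewrite mulr_ge0 ?law_ge0 ?sqr_ge0.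
Qed.

End Chebyshev.
End Law.

Section Bernoulli.
Variables (p : R) (A : nat -> set Omega).
Hypotheses (mA : forall n, measurable (A n)) (pA : forall n, P (A n) = p%:E).
Hypothesis iA : mutually_independent P A.

Definition incl_excl (s t : seq nat) : set Omega :=
  [set w | (forall i, i \in s -> A i w) /\ (forall i, i \in t -> ~ A i w)].

Lemma measurable_incl_excl s t : measurable (incl_excl s t).
Proof.
have -> : incl_excl s t = (\bigcap_(i in [set` s]) A i) `&` (\bigcap_(i in [set` t]) ~` A i).
  by apply/seteqP; split=> w [h1 h2]; split.
apply: measurableI; apply: fin_bigcap_measurable => // i _; exact: measurableC.
Qed.

(** Independence is given for intersections of the A i only; complements are introduced one at a
    time, as differences of two such events. *)
Lemma prob_incl_excl s t : uniq (s ++ t) ->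
  P (incl_excl s t) = (p ^+ size s * (1 - p) ^+ size t)%:E.
Proof.
elim: t s => [|i t IH] s.
  rewrite cats0 => us; have -> : incl_excl s [::] = \bigcap_(i in [set` s]) A i.
    by apply/seteqP; split=> w; [case | split].
  rewrite (iA us) expr0 mulr1; under eq_bigr do rewrite pA.
  by elim: s {us} => [|a s IHs]; rewrite ?big_nil// big_cons IHs /= exprS EFinM.
move=> u; have u1 : uniq (s ++ t).
  by move: u; rewrite -cat_rcons cat_uniq rcons_uniq cat_uniq => /and3P[/andP[_ ->] nh ->]; rewrite andbT /=; apply: contra nh => /hasP[x xt xs]; apply/hasP; exists x; rewrite // mem_rcons inE xs orbT.
have u2 : uniq ((i :: s) ++ t) by move: u; rewrite -cat1s uniq_catCA.
have -> : incl_excl s (i :: t) = incl_excl s t `\` incl_excl (i :: s) t.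
  apply/seteqP; split=> w.
    move=> [h1 h2]; split; first by split=> // j jt; apply: h2; rewrite inE jt orbT.
    by move=> [h3 _]; apply: (h2 i); rewrite ?mem_head//; apply: h3; rewrite mem_head.
  move=> [[h1 h2] h3]; split=> // j; rewrite inE => /predU1P[->|/h2//] Ai.
  by apply: h3; split=> // l; rewrite inE => /predU1P[->|/h1].
have -> : P (incl_excl s t `\` incl_excl (i :: s) t) =
    (P (incl_excl s t) - P (incl_excl s t `&` incl_excl (i :: s) t))%E.
  apply: measureD; try exact: measurable_incl_excl.
  by rewrite (le_lt_trans (probability_le1 _ _)) ?ltry//; exact: measurable_incl_excl.
rewrite (_ : _ `&` _ = incl_excl (i :: s) t) ?IH//.
  by rewrite -EFinB; congr EFin; rewrite /= !exprS; ring.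
apply/seteqP; split=> w; first by case.
by move=> [h1 h2]; split=> //; split=> // j js; apply: h1; rewrite inE js orbT.
Qed.

(** The point is that the law depends only on the number of included indices, hence is invariant
    under permutations of them. *)
Lemma law_bernoulli N (x : {ffun 'I_N -> bool}) :
  law A x = p ^+ #|[pred i | x i]| * (1 - p) ^+ #|[pred i | ~~ x i]|.
Proof.
apply: EFin_inj; rewrite -lawE//.
pose s := map val (enum [pred i | x i]); pose t := map val (enum [pred i | ~~ x i]).
have -> : [set w | pattern N A w = x] = incl_excl s t.
  apply/seteqP; split=> [w /= wx|w [h1 h2]].
    split=> j /mapP[i + ->]; rewrite mem_enum inE -wx ffunE; first by rewrite in_setE.
    by move/negP=> nA Aw; apply: nA; rewrite in_setE.
  apply/ffunP => i; rewrite ffunE; apply/idP/idP.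
    rewrite in_setE => Ai; apply: contraT => nx; exfalso.
    by apply: (h2 i) => //; apply/mapP; exists i; rewrite ?mem_enum.
  by move=> xi; rewrite in_setE; apply: h1; apply/mapP; exists i; rewrite ?mem_enum.
rewrite prob_incl_excl ?size_map -?cardE//.
rewrite cat_uniq !map_inj_uniq ?enum_uniq ?andbT//=; try exact: val_inj.
apply/hasPn => j /mapP[i + ->]; rewrite mem_enum inE => nx.
by apply/negP => /mapP[k + /val_inj E]; rewrite mem_enum inE -E (negbTE nx).
Qed.

Lemma prob_and i j : i != j -> P (A i `&` A j) = (p ^+ 2)%:E.
Proof.
move=> ij; have <- : incl_excl [:: i; j] [::] = A i `&` A j.
  apply/seteqP; split=> w; first by move=> [h _]; split; apply: h; rewrite !inE eqxx ?orbT.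
  by move=> [h1 h2]; split=> // k; rewrite !inE => /orP[] /eqP->.
by rewrite prob_incl_excl/= ?mulr1// inE ij.
Qed.

(** Exactly one of i and j is included: the case in which exchanging them changes the sample. *)
Definition split_event (i j : nat) : set Omega := incl_excl [:: i] [:: j] `|` incl_excl [:: j] [:: i].

Lemma measurable_split i j : measurable (split_event i j).
Proof. by apply: measurableU; exact: measurable_incl_excl. Qed.

Lemma in_split_event i j w : (w \in split_event i j) = ((w \in A i) != (w \in A j)).
Proof.
apply/idP/idP.
  rewrite in_setE => -[] [h1 h2];
  have := h1 _ (mem_head _ _); have := h2 _ (mem_head _ _) => nA /mem_set ->;
  by rewrite ?[in X in X != _]memNset ?[in X in _ != X]memNset.
rewrite in_setE; case: (boolP (w \in A i)); case: (boolP (w \in A j)) => // hj hi _.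
  left; split=> k; rewrite inE => /eqP-> ; first exact/set_mem.
  by move/mem_set; apply/negP.
right; split=> k; rewrite inE => /eqP-> ; first exact/set_mem.
by move/mem_set; apply/negP.
Qed.

Lemma prob_split i j : i != j -> P (split_event i j) = (2 * p * (1 - p))%:E.
Proof.
move=> ij; have -> : P (split_event i j) =
    (P (incl_excl [:: i] [:: j]) + P (incl_excl [:: j] [:: i]))%E.
  apply: measureU; try exact: measurable_incl_excl.
  apply/seteqP; split=> // w [[h1 _] [_ h2]].
  by apply: (h2 i); rewrite ?mem_head//; apply: h1; rewrite mem_head.
have u1 : uniq ([:: i] ++ [:: j]) by rewrite /= inE ij.
have u2 : uniq ([:: j] ++ [:: i]) by rewrite /= inE eq_sym ij.
by rewrite (prob_incl_excl u1) (prob_incl_excl u2) -EFinD; congr EFin; rewrite /=; ring.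
Qed.

Lemma prob_split2 i j k l : uniq [:: i; j; k; l] ->
  P (split_event i j `&` split_event k l) = ((2 * p * (1 - p)) ^+ 2)%:E.
Proof.
move=> u.
have E a b a' b' : incl_excl [:: a] [:: b] `&` incl_excl [:: a'] [:: b'] =
    incl_excl [:: a; a'] [:: b; b'].
  apply/seteqP; split=> w.
    move=> [[h1 h2] [h3 h4]]; split=> m; rewrite !inE => /orP[] /eqP->.
    + by apply: h1; rewrite mem_head.
    + by apply: h3; rewrite mem_head.
    + by apply: h2; rewrite mem_head.
    + by apply: h4; rewrite mem_head.
  move=> [h1 h2]; split; split=> m; rewrite inE => /eqP->; try apply: h1; try apply: h2;
  by rewrite !inE eqxx ?orbT.
have pE a b a' b' : perm_eq [:: a; a'; b; b'] [:: i; j; k; l] ->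
    P (incl_excl [:: a; a'] [:: b; b']) = (p ^+ 2 * (1 - p) ^+ 2)%:E.
  by move=> pm; rewrite prob_incl_excl// (perm_uniq pm).
rewrite /split_event setIUl !setIUr !E.
have disj a b c e m : (m \in a) && (m \in e) || (m \in c) && (m \in b) ->
    incl_excl a b `&` incl_excl c e = set0.
  move=> h; apply/seteqP; split=> // w [[h1 h2] [h3 h4]].
  by case/orP: h => /andP[m1 m2]; [exact: h4 m2 (h1 m m1) | exact: h2 m2 (h3 m m1)].
have PU (X Y : set Omega) : measurable X -> measurable Y -> X `&` Y = set0 ->
    P (X `|` Y) = (P X + P Y)%E by move=> *; exact: measureU.
rewrite PU; last 3 first.
- by apply: measurableU; exact: measurable_incl_excl.
- by apply: measurableU; exact: measurable_incl_excl.
- rewrite setIUl !setIUr !(disj _ _ _ _ i) ?setU0// !inE eqxx ?orbT//.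
rewrite !PU; try exact: measurable_incl_excl; last 2 first.
- by rewrite (disj _ _ _ _ k)// !inE eqxx ?orbT.
- by rewrite (disj _ _ _ _ k)// !inE eqxx ?orbT.
have pmE s : perm_eq s [:: i; j; k; l] -> perm_eq s [:: i; j; k; l] by [].
rewrite !pE -?EFinD; first by congr EFin; ring.
all: apply/permP => a /=; lia.
Qed.

End Bernoulli.
End FiniteLaws.

(** * Small ball probabilities for sums over the first k included terms *)

Section SmallBall.
Context {R : realType}.

Section Cube.
Variables (N k M : nat) (X : nat -> R) (g : R) (pi pj : 'I_M -> 'I_N).
Hypotheses (pi_inj : injective pi) (pj_inj : injective pj).
Hypotheses (pij : forall l l', pi l != pj l').
Hypotheses (pik : forall l, (pi l < k)%N) (pjk : forall l, (pj l < k)%N).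
Implicit Types (x : {ffun 'I_N -> bool}) (S : {set 'I_M}).

Definition below x (n : nat) : nat := \sum_(i < N | (i < n)%N) x i.

(** The first k included indices are recognised by counting the inclusions before them, so that the
    sum is a function of the finite pattern x. *)
Definition first_sum x : R := \sum_(n < N) (x n && (below x n < k)%N)%:R * X n.

Definition swap S (n : 'I_N) : 'I_N :=
  if [pick l in S | pi l == n] is Some l then pj l
  else if [pick l in S | pj l == n] is Some l then pi l else n.

Lemma swap_pi S l : swap S (pi l) = if l \in S then pj l else pi l.
Proof.
rewrite /swap; case: pickP => [l' /andP[l'S /eqP/pi_inj E]|nS].
  by rewrite -E l'S.
have -> : l \in S = false by have := nS l; rewrite eqxx andbT.
by case: pickP => // l' /andP[_ /eqP E]; have := pij l l'; rewrite E eqxx.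
Qed.

Lemma swap_pj S l : swap S (pj l) = if l \in S then pi l else pj l.
Proof.
rewrite /swap; case: pickP => [l' /andP[_ E]|_]; first by have := pij l' l; rewrite E.
case: pickP => [l' /andP[l'S /eqP/pj_inj E]|nS]; first by rewrite -E l'S.
by have -> : l \in S = false by have := nS l; rewrite eqxx andbT.
Qed.

Lemma swap_other S n : (forall l, l \in S -> pi l != n) -> (forall l, l \in S -> pj l != n) ->
  swap S n = n.
Proof.
move=> hi hj; rewrite /swap; case: pickP => [l /andP[lS E]|_]; first by have := hi l lS; rewrite E.
by case: pickP => // l /andP[lS E]; have := hj l lS; rewrite E.
Qed.

Variant swap_spec S n : Type :=
  | SwapI l of l \in S & n = pi l
  | SwapJ l of l \in S & n = pj l
  | SwapN of swap S n = n & (forall l, l \in S -> pi l != n) & (forall l, l \in S -> pj l != n).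

Lemma swapP S n : swap_spec S n.
Proof.
case: (pickP [pred l in S | pi l == n]) => [l /= /andP[lS /eqP E]|hi].
  exact: (SwapI lS (esym E)).
case: (pickP [pred l in S | pj l == n]) => [l /= /andP[lS /eqP E]|hj].
  exact: (SwapJ lS (esym E)).
have hi' l : l \in S -> pi l != n by move=> lS; have := hi l; rewrite /= lS /= => ->.
have hj' l : l \in S -> pj l != n by move=> lS; have := hj l; rewrite /= lS /= => ->.
by apply: SwapN => //; apply: swap_other.
Qed.

Lemma swapK S : involutive (swap S).
Proof.
move=> n; case: (swapP S n) => [l lS ->|l lS ->|sn _ _]; last by rewrite !sn.
  by rewrite swap_pi lS swap_pj lS.
by rewrite swap_pj lS swap_pi lS.
Qed.

Lemma swap_lt S n m : (k <= m)%N -> (swap S n < m)%N = (n < m)%N.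
Proof.
move=> km; have lt l : (pi l < m)%N /\ (pj l < m)%N.
  by split; apply: leq_trans km.
case: (swapP S n) => [l lS ->|l lS ->|-> //].
  by rewrite swap_pi lS !(lt l).1 (lt l).2.
by rewrite swap_pj lS !(lt l).1 (lt l).2.
Qed.

Definition swapped S x : {ffun 'I_N -> bool} := [ffun n => x (swap S n)].

Lemma swappedK S : involutive (swapped S).
Proof. by move=> x; apply/ffunP => n; rewrite !ffunE swapK. Qed.

Lemma below_swapped S x n : (k <= n)%N -> below (swapped S x) n = below x n.
Proof.
move=> kn; rewrite /below (reindex_inj (inv_inj (swapK S))) /=.
by apply: eq_big => [i|i _]; rewrite ?swap_lt// ffunE swapK.
Qed.

(** Fewer than k indices precede n < k, so such an n, once included, is always among the first k. *)
Lemma below_lt x n : (n < N)%N -> (n < k)%N -> (below x n < k)%N.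
Proof.
move=> nN nk; apply: leq_ltn_trans nk.
apply: leq_trans (_ : \sum_(i < N | (i < n)%N) 1 <= _)%N.
  by apply: leq_sum => i _; exact: leq_b1.
by rewrite -(big_ord_widen N (fun=> 1%N) (ltnW nN)) sum1_card card_ord.
Qed.

Lemma first_sum_swapped S x : first_sum (swapped S x) = first_sum x +
  \sum_(l in S) ((x (pi l))%:R - (x (pj l))%:R) * (X (pj l) - X (pi l)).
Proof.
(* The sum is cut at k: below k the counting condition is automatic, and from k on a swap changes
   neither the inclusions nor the counts. *)
have E y : first_sum y = \sum_(n < N | (n < k)%N) (y n)%:R * X n +
    \sum_(n < N | ~~ (n < k)%N) (y n && (below y n < k)%N)%:R * X n.
  rewrite /first_sum (bigID (fun n : 'I_N => (n < k)%N)) /=; congr (_ + _).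
  by apply: eq_bigr => n nk; rewrite below_lt// andbT.
rewrite !E addrAC; congr (_ + _); last first.
  apply: eq_bigr => n; rewrite -leqNgt => kn; rewrite below_swapped// ffunE.
  suff -> : swap S n = n by [].
  apply: swap_other => l _; apply: contraTneq kn => <-; rewrite -ltnNge.
    exact: pik.
  exact: pjk.
rewrite (reindex_inj (inv_inj (swapK S))) /=.
rewrite (eq_bigl _ _ (fun n => swap_lt S n (leqnn k))).
under eq_bigr do rewrite ffunE swapK.
apply/eqP; rewrite addrC -subr_eq -sumrB; apply/eqP.
pose f (n : 'I_N) := (x n)%:R * X (swap S n) - (x n)%:R * X n.
have -> : \sum_(n < N | (n < k)%N) ((x n)%:R * X (swap S n) - (x n)%:R * X n) =
    \sum_(n in pi @: S) f n + \sum_(n in pj @: S) f n.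
  rewrite big_mkcond [X in _ = X + _]big_mkcond [X in _ = _ + X]big_mkcond -big_split /=.
  have notI l : (pj l \in pi @: S) = false.
    by apply/imsetP => -[l' _ /eqP]; rewrite eq_sym (negbTE (pij _ _)).
  have notJ l : (pi l \in pj @: S) = false.
    by apply/imsetP => -[l' _ /eqP]; rewrite (negbTE (pij _ _)).
  apply: eq_bigr => n _; case: (swapP S n) => [l lS ->|l lS ->|sn hi hj].
  - by rewrite pik notJ imset_f// addr0.
  - by rewrite pjk notI [_ \in pj @: S]imset_f// add0r.
  - have -> : (n \in pi @: S) = false.
      by apply/imsetP => -[l lS E']; have := hi l lS; rewrite E' eqxx.
    have -> : (n \in pj @: S) = false.
      by apply/imsetP => -[l lS E']; have := hj l lS; rewrite E' eqxx.
    by rewrite sn subrr if_same addr0.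
rewrite !big_imset /=.
- rewrite -big_split /=; apply: eq_bigr => l lS.
  by rewrite /f swap_pi swap_pj lS; ring.
- by move=> ? ? _ _; exact: pj_inj.
- by move=> ? ? _ _; exact: pi_inj.
Qed.

Hypotheses (g0 : 0 < g) (gX : forall l, g <= `|X (pj l) - X (pi l)|).

(* Swapping the two indices of a pair l < M, both below k, does not change
   which of the indices n >= k are among the first k included ones; it changes
   the sum by a fixed amount of modulus at least g. Given the pairs on which x
   is not constant, card_small_sums applies to the swaps. *)
Lemma small_ball_cube (c : {ffun 'I_N -> bool} -> R) (Q : nat) (e : R) :
  (forall x, 0 <= c x) -> \sum_x c x = 1 -> (forall S x, c (swapped S x) = c x) ->
  (forall q h, (Q <= q)%N -> 'C(q, h)%:R <= e * 2 ^+ q) ->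
  \sum_(x | `|first_sum x| < g / 2) c x <=
  e + \sum_(x : {ffun 'I_N -> bool} | (#|[pred l | x (pi l) != x (pj l)]| < Q)%N) c x.
Proof.
move=> c0 c1 cS Qe.
pose B := [pred x | `|first_sum x| < g / 2].
pose hits x := [pred S : {set 'I_M} | B (swapped S x)].
have M2 : 0 < 2 ^+ M :> R by rewrite exprn_gt0.
have cardM : #|{: {set 'I_M}}| = (2 ^ M)%N.
  by rewrite -cardsT -powersetT card_powerset cardsT card_ord.
have e0 : 0 <= e.
  by have := Qe Q 0%N (leqnn Q); rewrite bin0 => /(le_trans ler01); rewrite pmulr_lge0// exprn_gt0.
(* Since [c] is invariant under all 2^M swaps, the mass of B is the mean over x of the proportion of
   swaps that bring x into B. *)
have -> : \sum_(x | B x) c x = \sum_x c x * (#|hits x|%:R / 2 ^+ M).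
  have E S : \sum_(x | B x) c x = \sum_(x | B (swapped S x)) c x.
    by rewrite (reindex_inj (inv_inj (swappedK S))); under eq_bigr do rewrite cS.
  have : \sum_(S : {set 'I_M}) \sum_(x | B x) c x = \sum_x c x * #|hits x|%:R.
    rewrite (eq_bigr _ (fun S _ => E S)) (exchange_big_dep xpredT)//=.
    apply: eq_bigr => x _; rewrite -sum1_card natr_sum mulr_sumr.
    by apply: eq_bigr => S _; rewrite mulr1.
  rewrite sumr_const cardM -[LHS]mulr_natr natrX => H.
  transitivity ((\sum_x c x * #|hits x|%:R) / 2 ^+ M); first by rewrite -H mulfK// gt_eqF.
  by rewrite mulr_suml; apply: eq_bigr => x _; rewrite mulrA.
have eE : e = \sum_x c x * e by rewrite -mulr_suml c1 mul1r.
rewrite [X in _ <= _ + X]big_mkcond [X in _ <= X + _]eE -big_split /=.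
apply: ler_sum => x _.
have hM : #|hits x|%:R <= 2 ^+ M :> R by rewrite -natrX ler_nat -cardM max_card.
case: ltnP => [_|Qx].
  rewrite (le_trans (_ : _ <= c x * 1)) ?ler_wpM2l// ?ler_pdivrMr ?mul1r//.
  by rewrite mulr1 lerDr mulr_ge0.
rewrite addr0 ler_wpM2l// ler_pdivrMr//.
pose W := [set l | x (pi l) != x (pj l)]%SET.
have cW : #|W| = #|[pred l | x (pi l) != x (pj l)]| by apply: eq_card => l; rewrite !inE.
pose v l : R := ((x (pi l))%:R - (x (pj l))%:R) * (X (pj l) - X (pi l)).
have Wv l : l \in W -> g <= `|v l|.
  rewrite inE => hl; rewrite normrM (_ : `|_ - _| = 1) ?mul1r//.
  by move: hl; case: (x (pi l)); case: (x (pj l)) => //= _; rewrite ?subr0 ?sub0r ?normrN normr1.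
apply: le_trans (card_small_sums (v := v) (W := W) (first_sum x) g0 Wv _); last first.
  by move=> h; rewrite cW; exact: Qe.
rewrite ler_nat; apply: subset_leq_card; apply/fintype.subsetP => S.
by rewrite !inE first_sum_swapped.
Qed.

End Cube.

Section Probability.
Context {d : measure_display} {Omega : measurableType d}.
Variable P : probability Omega R.
Variables (p : R) (A : nat -> set Omega).
Hypotheses (p01 : 0 < p < 1).
Hypotheses (mA : forall n, measurable (A n)) (pA : forall n, P (A n) = p%:E).
Hypothesis iA : mutually_independent P A.

Definition included_below (w : Omega) (n : nat) : nat := \sum_(i < n) (w \in A i).

Definition included_sum (N k : nat) (X : nat -> R) (w : Omega) : R :=
  \sum_(n < N) ((w \in A n) && (included_below w n < k)%N)%:R * X n.

Lemma below_pattern N w n : (n <= N)%N -> below (pattern N A w) n = included_below w n.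
Proof.
move=> nN; rewrite /included_below (big_ord_widen N (fun i => nat_of_bool (w \in A i)) nN).
by apply: eq_bigr => i _; rewrite ffunE.
Qed.

Lemma first_sum_pattern N k X w : first_sum k X (pattern N A w) = included_sum N k X w.
Proof.
by apply: eq_bigr => n _; rewrite ffunE below_pattern// ltnW.
Qed.

Lemma law_swapped N M (pi pj : 'I_M -> 'I_N) S x :
  injective pi -> injective pj -> (forall l l', pi l != pj l') ->
  law P A (swapped pi pj S x) = law P A x.
Proof.
move=> hi hj hij; rewrite !(law_bernoulli mA pA iA).
have E (f : pred bool) : #|[pred i | f (swapped pi pj S x i)]| = #|[pred i | f (x i)]|.
  rewrite -!sum1_card [RHS](reindex_inj (inv_inj (swapK hi hj hij S))) /=.
  by apply: eq_bigl => i; rewrite !inE ffunE.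
by rewrite (E id) (E negb).
Qed.

(** M0 is independent of k, N, X, g and of the pairs, so the number of pairs, and with it the radius
    of the ball, can be fixed before k grows. *)
Lemma small_ball (e : R) : 0 < e -> exists M0, forall M N k (X : nat -> R) g (pi pj : nat -> nat),
  (M0 <= M)%N -> (k <= N)%N -> 0 < g ->
  {in gtn M &, injective pi} -> {in gtn M &, injective pj} ->
  (forall l l', (l < M)%N -> (l' < M)%N -> pi l != pj l') ->
  (forall l, (l < M)%N -> (pi l < k)%N /\ (pj l < k)%N) ->
  (forall l, (l < M)%N -> g <= `|X (pj l) - X (pi l)|) ->
  (P [set w | (`|included_sum N k X w| < g / 2)%R] <= e%:E)%E.
Proof.
move=> e0; have e20 : 0 < e / 2 by rewrite divr_gt0.
have [Q HQ] := bin_small_frac e20.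
have [p0 p1] := andP p01.
pose t := 2 * p * (1 - p); have t0 : 0 < t by rewrite !mulr_gt0// subr_gt0.
have t1 : t <= 1 by rewrite /t; nra.
(* t is the probability that a pair is split. The second bound gives Q <= t M / 2, half the mean
   number of split pairs; the third makes the Chebyshev bound 4 / (t^2 M) at most e / 2. *)
exists (maxn 1 (maxn (Num.truncn (2 * Q%:R / t)).+1 (Num.truncn (8 / (t ^+ 2 * e))).+1)).
move=> M N k X g pi pj; rewrite !geq_max => /and3P[M1 MQ Me] kN g0 hi hj hij hk hX.
have piN (l : 'I_M) : (pi l < N)%N by apply: leq_trans kN; exact: (hk l (ltn_ord l)).1.
have pjN (l : 'I_M) : (pj l < N)%N by apply: leq_trans kN; exact: (hk l (ltn_ord l)).2.
pose pI l := Ordinal (piN l); pose pJ l := Ordinal (pjN l).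
have pI_inj : injective pI.
  by move=> l l' /(congr1 val) /= /hi E; apply: ord_inj; apply: E; rewrite inE /= ltn_ord.
have pJ_inj : injective pJ.
  by move=> l l' /(congr1 val) /= /hj E; apply: ord_inj; apply: E; rewrite inE /= ltn_ord.
have pIJ l l' : pI l != pJ l' by rewrite -val_eqE /= hij.
have := @small_ball_cube N k M X g pI pJ pI_inj pJ_inj pIJ
  (fun l => (hk l (ltn_ord l)).1) (fun l => (hk l (ltn_ord l)).2) g0
  (fun l => hX l (ltn_ord l)) (law P A) Q (e / 2) (law_ge0 P A) (sum_law P N mA)
  (fun S x => law_swapped _ _ pI_inj pJ_inj pIJ) HQ.
rewrite -lee_fin -(prob_pattern P mA (fun x => `|first_sum k X x| < g / 2)).
have -> : [set w | `|first_sum k X (pattern N A w)| < g / 2] =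
    [set w | `|included_sum N k X w| < g / 2].
  by apply/seteqP; split=> w /=; rewrite first_sum_pattern.
move=> /le_trans; apply.
rewrite EFinD -(prob_pattern P mA (fun x => (#|[pred l | x (pI l) != x (pJ l)]| < Q)%N)).
rewrite [leRHS](_ : e%:E = (e / 2)%:E + (e / 2)%:E)%E; last by rewrite -EFinD; congr EFin; lra.
rewrite leeD2l//.
pose E (l : nat) := split_event A (pi l) (pj l).
have mE l : measurable (E l) by exact: measurable_split.
have qE l : (l < M)%N -> P (E l) = t%:E by move=> lM; rewrite (prob_split mA pA iA)// hij.
have qE2 i j : (i < M)%N -> (j < M)%N -> i != j -> P (E i `&` E j) = (t ^+ 2)%:E.
  move=> iM jM ij; rewrite (prob_split2 mA pA iA)//= !inE !negb_or !hij//= andbT.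
  rewrite (inj_in_eq hi) ?inE// ij (inj_in_eq hj) ?inE// ij.
  by rewrite eq_sym hij.
have M0R : 0 < M%:R :> R by rewrite ltr0n.
have t01 : 0 <= t <= 1 by rewrite (ltW t0).
have tM : 0 < t * M%:R / 2 by rewrite divr_gt0// (mulr_gt0 t0 M0R).
have t2e : 0 < t ^+ 2 * e by rewrite (mulr_gt0 (exprn_gt0 _ t0) e0).
have H := law_chebyshev mE (fun=> 1) t01 qE qE2 tM.
apply: le_trans (_ : P [set w | (t * M%:R / 2 <=
   `|\sum_(i < M) (fun=> 1) i * ((w \in E i)%:R - t)|)%R] <= _)%E.
  apply: le_measure; rewrite ?inE.
  - exact: (measurable_pattern mA [set x | (#|[pred l | x (pI l) != x (pJ l)]| < Q)%N]).
  - exact: (measurable_deviation M mE (fun=> 1) t).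
  move=> w /= qQ.
  have -> : \sum_(i < M) 1 * ((w \in E i)%:R - t) =
      #|[pred l | pattern N A w (pI l) != pattern N A w (pJ l)]|%:R - t * M%:R.
    under eq_bigr do rewrite mul1r.
    rewrite sumrB sumr_const card_ord -[t *+ M]mulr_natr -sum1_card natr_sum.
    rewrite [X in _ = X - _]big_mkcond; congr (_ - _).
    by apply: eq_bigr => l _; rewrite in_split_event inE !ffunE /=; case: (_ != _).
  have : (#|[pred l | pattern N A w (pI l) != pattern N A w (pJ l)]|%:R : R) <= Q%:R.
    by rewrite ler_nat ltnW.
  have : 2 * Q%:R / t < M%:R.
    by apply: lt_le_trans (truncnS_gt _) _; rewrite ler_nat.
  rewrite ltr_pdivrMr// => h1 h2.
  by rewrite ler_normr; apply/orP; right; lra.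
apply: (le_trans H); rewrite lee_fin.
under eq_bigr do rewrite expr1n.
rewrite sumr_const card_ord.
have : 8 / (t ^+ 2 * e) < M%:R.
  by apply: lt_le_trans (truncnS_gt _) _; rewrite ler_nat.
rewrite ltr_pdivrMr// => h.
rewrite ler_pdivrMr ?exprn_gt0// expr_div_n exprMn.
have -> : e / 2 * (t ^+ 2 * M%:R ^+ 2 / 2 ^+ 2) = M%:R * (M%:R * (t ^+ 2 * e)) / 8 :> R.
  by field.
by rewrite ler_pdivlMr// ler_pM2l// ltW.
Qed.

End Probability.
End SmallBall.

(** * Approximation by logarithmic potentials *)

Section Approximation.
Context {R : realType}.
Implicit Types (x y c : R[i]) (r t : R).

Lemma ln_max_lipschitz (a b r : R) : 0 < r -> 
  `|ln (Num.max a r) - ln (Num.max b r)| <= `|a - b| / r.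
Proof.
move=> r0; wlog ab : a b / a <= b.
  move=> H; have [/H//|/ltW /H] := leP a b.
  by rewrite distrC [in leRHS]distrC.
have Ar : r <= Num.max a r by rewrite le_max lexx orbT.
have A0 : 0 < Num.max a r by exact: lt_le_trans Ar.
have AB : Num.max a r <= Num.max b r by rewrite ge_max !le_max ab lexx orbT.
have B0 : 0 < Num.max b r by exact: lt_le_trans AB.
rewrite distrC ger0_norm ?subr_ge0 ?ler_ln ?posrE// distrC ger0_norm ?subr_ge0//.
rewrite -ln_div ?posrE//.
have -> : Num.max b r / Num.max a r = 1 + (Num.max b r - Num.max a r) / Num.max a r.
  by field; rewrite gt_eqF.
have q0 : 0 <= (Num.max b r - Num.max a r) / Num.max a r by rewrite divr_ge0 ?subr_ge0 ?(ltW A0).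
apply: le_trans (le_ln1Dx _) _; first by rewrite (lt_le_trans _ q0)// ltrN10.
apply: ler_pM; rewrite ?subr_ge0 ?invr_ge0 ?(ltW A0)// ?lef_pV2 ?posrE//.
by have [ar|ra] := leP a r; have [br|rb] := leP b r; lra.
Qed.

Lemma logmax_lipschitz c r x y : 0 < r -> `|logmax c r x - logmax c r y| <= normc (x - y) / r.
Proof.
move=> r0; apply: le_trans (ln_max_lipschitz _ _ r0) _.
rewrite ler_pM2r ?invr_gt0// ler_norml lerNl opprB.
apply/andP; split.
  by rewrite [normc (x - y)]normc_distC (_ : y - x = (y - c) - (x - c)) ?normcB_ge//; ring.
by rewrite (_ : x - y = (x - c) - (y - c)) ?normcB_ge//; ring.
Qed.

Lemma logmax_lipschitz_center c c' r x : 0 < r ->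
  `|logmax c r x - logmax c' r x| <= normc (c - c') / r.
Proof.
move=> r0; have -> : logmax c' r x = logmax c r (x + (c - c')).
  by rewrite /logmax; congr (ln (Num.max (normc _) _)); ring.
apply: le_trans (logmax_lipschitz _ _ _ r0) _.
by rewrite opprD addrA subrr sub0r normcN.
Qed.

(* annulus r is a Lipschitz bump, whose translates along a fine lattice add up
   to an almost constant function (lattice_sum_const); weighting the translates
   by values of f approximates f. *)
Definition annulus r y : R := ln (Num.max (normc y) (2 * r)) - ln (Num.max (normc y) r).

Lemma annulusE c r x : annulus r (x - c) = logmax c (2 * r) x - logmax c r x.
Proof. by []. Qed.

Lemma annulus_ge0 r y : 0 < r -> 0 <= annulus r y.
Proof.
move=> r0; rewrite subr_ge0 ler_ln ?posrE ?lt_max ?r0 ?mulr_gt0 ?orbT//.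
by rewrite ge_max !le_max lexx /= ler_peMl ?ler1n ?orbT// ltW.
Qed.

Lemma annulus_out r y : 0 < r -> 2 * r <= normc y -> annulus r y = 0.
Proof.
move=> r0 ry; rewrite /annulus (max_idPl ry) (max_idPl _) ?subrr//.
by apply: le_trans ry; rewrite ler_peMl ?ler1n// ltW.
Qed.

Lemma annulus_in r y : 0 < r -> normc y <= r -> annulus r y = ln 2.
Proof.
move=> r0 yr; rewrite /annulus (max_idPr yr) (max_idPr _); last first.
  by apply: (le_trans yr); rewrite ler_peMl ?ler1n// ltW.
by rewrite -ln_div ?posrE ?mulr_gt0// mulfK// gt_eqF.
Qed.

Lemma annulus_lipschitz r x y : 0 < r -> `|annulus r x - annulus r y| <= 2 * normc (x - y) / r.
Proof.
move=> r0; have := logmax_lipschitz 0 x y r0.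
have r20 : 0 < 2 * r by rewrite mulr_gt0.
have := logmax_lipschitz 0 x y r20; rewrite -[x]subr0 -[y]subr0 /annulus /logmax !subr0.
set a := ln _; set b := ln _; set a' := ln _; set b' := ln _ => h1 h2.
have h3 : normc (x - y) / (2 * r) <= normc (x - y) / r.
  by rewrite ler_wpM2l ?normc_ge0// lef_pV2 ?posrE// ler_peMl ?ler1n// ltW.
have -> : a - a' - (b - b') = (a - b) - (a' - b') by ring.
by apply: le_trans (ler_normB _ _) _; rewrite -mulrA mulrDl mul1r lerD// (le_trans h1).
Qed.

(** A unit shift drops one term at one end of the finite lattice and adds one at the other; both
    vanish because h is supported in [-m, m]. *)
Lemma sum_shift (h : R -> R) (m : R) (L : nat) (n : nat) (X : R) :
  (forall u, m <= `|u| -> h u = 0) -> 0 <= m -> m <= X -> X + n%:R + m + 1 <= L%:R ->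
  \sum_(i < L) h (X + n%:R - i%:R) = \sum_(i < L) h (X - i%:R).
Proof.
move=> h0 m0 mX; elim: n => [|n IH]; first by rewrite addr0.
rewrite -natr1 => XL; rewrite -IH; last by lra.
case: L XL {IH} => [|L] XL; first by rewrite !big_ord0.
rewrite big_ord_recl [RHS]big_ord_recr /= h0 ?add0r; last first.
  by rewrite subr0 ger0_norm; have := ler0n R n; lra.
rewrite (h0 (_ - L%:R)) ?addr0; last first.
  by rewrite -normrN ger0_norm; move: XL; rewrite -natr1; lra.
by apply: eq_bigr => i _; congr h; rewrite /bump /= add1n -[i.+1%:R]natr1; lra.
Qed.

Lemma sum_ord_lt (L K : nat) : (\sum_(i < L | (i < K)%N) 1 = minn L K)%N.
Proof.
elim: L => [|L IH]; first by rewrite big_ord0 min0n.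
by rewrite big_mkcond big_ord_recr /= -big_mkcond IH; case: ifP; lia.
Qed.

Section Lattice.
Variables (r : R) (m' : nat).
Hypotheses (r0 : 0 < r) (m'0 : (0 < m')%N).
(** With mesh t = 2 r / m the bump vanishes m steps away from its centre, while m' = m / 4 steps in
    each direction stay inside the disc of radius r, where it equals ln 2. *)
Let m := (4 * m')%N.
Let t := 2 * r / m%:R.
Let g (a b : R) : R := annulus r (complex.Complex (t * a) (t * b)).

Let m0 : 0 < m%:R :> R. Proof. by rewrite ltr0n muln_gt0. Qed.
Let t0 : 0 < t. Proof. by rewrite divr_gt0 ?mulr_gt0. Qed.
Let tm : t * m%:R = 2 * r. Proof. by rewrite divfK// gt_eqF. Qed.

Definition lattice_sum (L : nat) (X Y : R) : R :=
  \sum_(i < L) \sum_(j < L) g (X - i%:R) (Y - j%:R).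

Let g_outl a b : m%:R <= `|a| -> g a b = 0.
Proof.
move=> ma; apply: annulus_out => //; rewrite -tm; apply: le_trans (normc_Re _).
by rewrite /= (normrM t) (gtr0_norm t0) (ler_pM2l t0).
Qed.

Let g_outr a b : m%:R <= `|b| -> g a b = 0.
Proof.
move=> mb; apply: annulus_out => //; rewrite -tm; apply: le_trans (normc_Im _).
by rewrite /= (normrM t) (gtr0_norm t0) (ler_pM2l t0).
Qed.

Let g_in a b : `|a| <= m'%:R -> `|b| <= m'%:R -> g a b = ln 2.
Proof.
move=> am bm; apply: annulus_in => //; apply: le_trans (normc_le_ReIm _) _.
rewrite /= !(normrM t) (gtr0_norm t0) -mulrDr.
have hr : r = t * (2 * m'%:R).
  by rewrite /t /m natrM; field; rewrite pnatr_eq0 -lt0n m'0.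
by rewrite [leRHS]hr (ler_pM2l t0); lra.
Qed.

Let g_lip a b a' b' : `|a - a'| <= 1 -> `|b - b'| <= 1 -> `|g a b - g a' b'| <= 8 / m%:R.
Proof.
move=> aa bb; apply: le_trans (annulus_lipschitz _ _ r0) _.
have : normc (complex.Complex (t * a) (t * b) - complex.Complex (t * a') (t * b')) <= 2 * t.
  apply: le_trans (normc_le_ReIm _) _; rewrite /= -!mulrN -!mulrDr !(normrM t) (gtr0_norm t0) -mulrDr.
  by rewrite [leRHS]mulrC (ler_pM2l t0); lra.
move=> h; rewrite ler_pdivrMr//; apply: (@le_trans _ _ (2 * (2 * t))); first by rewrite ler_pM2l.
by rewrite /t le_eqVlt; apply/orP; left; apply/eqP; field; rewrite gt_eqF.
Qed.

Lemma lattice_sum_shift L (n n' : nat) (X Y : R) : m%:R <= X -> m%:R <= Y ->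
  X + n%:R + m%:R + 1 <= L%:R -> Y + n'%:R + m%:R + 1 <= L%:R ->
  lattice_sum L (X + n%:R) (Y + n'%:R) = lattice_sum L X Y.
Proof.
move=> mX mY XL YL.
rewrite /lattice_sum.
rewrite (@sum_shift (fun a => \sum_(j < L) g a (Y + n'%:R - j%:R)) m%:R)//; last first.
  by move=> u mu; rewrite big1// => j _; exact: g_outl.
apply: eq_bigr => i _.
by rewrite (@sum_shift (fun b => g (X - i%:R) b) m%:R)// => u mu; exact: g_outr.
Qed.

Let kappa L := lattice_sum L m%:R m%:R.

Lemma lattice_sum_ge L : (2 * m <= L)%N -> (2 * m'%:R) ^+ 2 * ln 2 <= kappa L.
Proof.
move=> mL.
pose I (i : nat) := (3 * m' <= i < 5 * m')%N.
have cI : \sum_(i < L | I i) 1 = 2 * m'%:R :> R.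
  rewrite -(big_mkord I (fun=> 1)) /I.
  rewrite -(big_nat_widen 0 (5 * m') L (fun i => 3 * m' <= i)%N (fun=> 1 : R)); last first.
    by rewrite /m in mL; lia.
  rewrite -(big_nat_widenl (3 * m') 0 (5 * m') xpredT (fun=> 1 : R))//.
  rewrite big_const_nat iter_addr addr0 -natrM; congr (_%:R); lia.
have -> : (2 * m'%:R) ^+ 2 * ln 2 = \sum_(i < L | I i) \sum_(j < L | I j) ln 2 :> R.
  have E : \sum_(j < L | I j) ln 2 = 2 * m'%:R * ln 2 :> R.
    by rewrite -cI mulr_suml; apply: eq_bigr => j _; rewrite mul1r.
  rewrite E expr2 -[LHS]mulrA -{1}cI mulr_suml; apply: eq_bigr => i _.
  by rewrite mul1r.
rewrite /kappa /lattice_sum big_mkcond; apply: ler_sum => i _; case: ifP => Ii; last first.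
  by apply: sumr_ge0 => j _; exact: annulus_ge0.
rewrite big_mkcond; apply: ler_sum => j _; case: ifP => Ij; last exact: annulus_ge0.
have near (n : nat) : I n -> `|m%:R - n%:R| <= m'%:R :> R.
  move=> /andP[h1 h2]; rewrite ler_norml.
  have : (3 * m')%:R <= n%:R :> R by rewrite ler_nat.
  have : n%:R <= (5 * m')%:R :> R by rewrite ler_nat ltnW.
  rewrite /m !natrM => {}h1 {}h2; apply/andP; split; lra.
by rewrite g_in// near.
Qed.

(** At most (2 m + 1)^2 terms are nonzero at either position, and each changes by at most 8 / m over
    less than one mesh step in each direction. *)
Lemma lattice_sum_near L (u v : R) : 0 <= u <= 1 -> 0 <= v <= 1 ->
  `|lattice_sum L (m%:R + u) (m%:R + v) - kappa L| <= (2 * m%:R + 1) ^+ 2 * (8 / m%:R).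
Proof.
move=> /andP[u0 u1] /andP[v0 v1].
pose K := (2 * m).+1; pose e : R := 8 / m%:R.
have e0 : 0 <= e by rewrite divr_ge0.
have cI : \sum_(i < L | (i < K)%N) 1 <= 2 * m%:R + 1 :> R.
  have -> : \sum_(i < L | (i < K)%N) 1 = (\sum_(i < L | (i < K)%N) 1)%N%:R :> R.
    by rewrite natr_sum.
  have -> : 2 * m%:R + 1 = K%:R :> R by rewrite /K -[(2 * m).+1%:R]natr1 natrM.
  by rewrite ler_nat sum_ord_lt geq_minr.
have out (n : nat) (w : R) : (K <= n)%N -> 0 <= w <= 1 -> m%:R <= `|m%:R + w - n%:R| :> R.
  move=> Kn /andP[w0 w1]; have : K%:R <= n%:R :> R by rewrite ler_nat.
  by rewrite /K -[(2 * m).+1%:R]natr1 natrM => h; have := m0; rewrite distrC => ?; rewrite ger0_norm; lra.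
have out0 (n : nat) : (K <= n)%N -> m%:R <= `|m%:R - n%:R| :> R.
  by move=> Kn; have := out n 0 Kn; rewrite addr0; apply; rewrite lexx ler01.
rewrite /kappa /lattice_sum -sumrB; apply: le_trans (ler_norm_sum _ _ _) _.
apply: (@le_trans _ _ (\sum_(i < L | (i < K)%N) \sum_(j < L | (j < K)%N) e)); last first.
  have E : \sum_(j < L | (j < K)%N) e <= (2 * m%:R + 1) * e :> R.
    have -> : \sum_(j < L | (j < K)%N) e = (\sum_(j < L | (j < K)%N) 1) * e.
      by rewrite mulr_suml; apply: eq_bigr => j _; rewrite mul1r.
    by rewrite ler_wpM2r.
  apply: le_trans (ler_sum _ (fun i _ => E)) _.
  have -> : \sum_(i < L | (i < K)%N) (2 * m%:R + 1) * e =
      (\sum_(j < L | (j < K)%N) 1) * ((2 * m%:R + 1) * e).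
    by rewrite mulr_suml; apply: eq_bigr => j _; rewrite mul1r.
  by rewrite expr2 -[leRHS]mulrA ler_wpM2r// mulr_ge0// addr_ge0// mulr_ge0.
rewrite [leRHS]big_mkcond; apply: ler_sum => i _ /=.
rewrite -sumrB; apply: le_trans (ler_norm_sum _ _ _) _; case: ltnP => Ki; last first.
  rewrite big1// => j _; rewrite !g_outl ?subrr ?normr0//; first exact: out0.
  by apply: out => //; rewrite u0.
rewrite [leRHS]big_mkcond; apply: ler_sum => j _ /=; case: ltnP => Kj; last first.
  rewrite !g_outr ?subrr ?normr0//; first exact: out0.
  by apply: out => //; rewrite v0.
by apply: g_lip; rewrite ler_norml; apply/andP; split; lra.
Qed.

(** The sum is of order m^2 and oscillates by order m only. Precisely, [kappa L] is at least 2 m'^2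
    = m^2 / 8, and (2 m + 1)^2 * 8 / m <= 72 m = (576 / m) * (m^2 / 8). *)
Lemma lattice_sum_const L (X Y : R) : (2 * m <= L)%N -> m%:R <= X -> m%:R <= Y ->
  X + m%:R + 1 <= L%:R -> Y + m%:R + 1 <= L%:R ->
  0 < kappa L /\ `|lattice_sum L X Y - kappa L| <= 576 / m%:R * kappa L.
Proof.
move=> mL mX mY XL YL.
have ln2 : 2^-1 <= ln 2 :> R.
  have := @le_ln1Dx R (- 2^-1); rewrite (_ : 1 - 2^-1 = 2^-1 :> R); last by field.
  by rewrite lnV ?posrE// => /(_ _); lra.
have k1 := lattice_sum_ge mL.
have mE : m%:R = 4 * m'%:R :> R by rewrite /m natrM.
have m'R : 1 <= m'%:R :> R by rewrite ler1n.
have k2 : 2 * m'%:R ^+ 2 <= kappa L.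
  apply: le_trans k1; rewrite exprMn; have := sqr_ge0 (m'%:R : R); nra.
have k0 : 0 < kappa L by apply: lt_le_trans k2; rewrite mulr_gt0 ?exprn_gt0// (lt_le_trans ltr01).
split=> //.
have spl (Z : R) : m%:R <= Z -> exists (n : nat) (u : R), [/\ 0 <= u <= 1, Z = m%:R + u + n%:R & n%:R <= Z - m%:R].
  move=> mZ; exists (Num.truncn (Z - m%:R)), (Z - m%:R - (Num.truncn (Z - m%:R))%:R).
  have h0 : 0 <= Z - m%:R by rewrite subr_ge0.
  have := truncn_le (Z - m%:R); rewrite h0 => h1.
  have := truncnS_gt (Z - m%:R); rewrite -natr1 => h2.
  by split => //; [apply/andP; split; lra | lra].
have [n [u [u01 XE nX]]] := spl X mX; have [n' [v [v01 YE nY]]] := spl Y mY.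
have [u0 u1] := andP u01; have [v0 v1] := andP v01.
have XL' : m%:R + u + n%:R + m%:R + 1 <= L%:R by rewrite -XE.
have YL' : m%:R + v + n'%:R + m%:R + 1 <= L%:R by rewrite -YE.
rewrite {1}XE {1}YE lattice_sum_shift ?lerDl//.
apply: le_trans (lattice_sum_near L u01 v01) _.
have -> : 576 / m%:R * kappa L = 72 * kappa L * (8 / m%:R) by lra.
rewrite ler_pM2r ?divr_gt0//.
by rewrite mE; nra.
Qed.

End Lattice.

(** The approximant puts weight f(c_i) / kap on the bump at the lattice point c_i, and each bump is
    a difference of two [logmax]. Half of e pays for the variation of f over a bump, half for the
    lattice sum not being constant. *)
Lemma logmax_approx (f : R[i] -> R) (B Mf : R) :
  (forall x, B < normc x -> f x = 0) -> (forall x, `|f x| <= Mf) ->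
  (forall e : R, 0 < e -> exists2 d : R, 0 < d &
    forall x y, normc (x - y) < d -> `|f x - f y| < e) ->
  forall e : R, 0 < e -> exists s : seq (R * R[i] * R),
    (forall q, q \in s -> 0 < q.2) /\
    forall x, `|f x - \sum_(q <- s) q.1.1 * logmax q.1.2 q.2 x| <= e.
Proof.
move=> f0 fM fu e e0.
have alg (a b s k : R) : k != 0 -> a - b = (a * s - k * b + a * (k - s)) / k.
  by move=> k0; field.
wlog B0 : B f0 / 0 <= B.
  move=> H; apply: (H (Num.max B 0)); last by rewrite le_max lexx orbT.
  by move=> x; rewrite gt_max => /andP[/f0].
have M0 : 0 <= Mf by apply: le_trans (fM 0).
have e4 : 0 < e / 4 by rewrite divr_gt0.
have [d d0 fd] := fu _ e4.
pose r := d / 4; have r0 : 0 < r by rewrite divr_gt0.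
(* The relative oscillation 576 / m is 144 / m'; the two summands make it at most 1 and at most e /
   (2 Mf). *)
pose m' := (Num.truncn (144 + 288 * Mf / e)).+1.
have m'R : 144 + 288 * Mf / e < m'%:R := truncnS_gt _.
have m'0 : (0 < m')%N by [].
pose m := (4 * m')%N; pose t := 2 * r / m%:R.
have mR0 : 0 < m%:R :> R by rewrite ltr0n.
have t0 : 0 < t by rewrite divr_gt0// mulr_gt0.
(* The lattice starts m steps before the square of half-side B + 2 r, and [L] leaves the
   corresponding margin at the other end. *)
pose o := - (B + 2 * r) - m%:R * t.
pose L := ((Num.truncn (2 * (B + 2 * r) / t)).+1 + 2 * m + 1)%N.
have LR : 2 * (B + 2 * r) / t + 2 * m%:R + 1 <= L%:R.
  by rewrite /L !natrD natrM; have := truncnS_gt (2 * (B + 2 * r) / t); lra.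
have mL : (2 * m <= L)%N by rewrite /L -addnA addnCA leq_addr.
pose c (i : 'I_L * 'I_L) : R[i] := complex.Complex (o + t * i.1%:R) (o + t * i.2%:R).
pose kap := lattice_sum r m' L m%:R m%:R.
pose d' := 576 / m%:R : R.
have mE : m%:R = 4 * m'%:R :> R by rewrite natrM.
have m'R0 : 0 < m'%:R :> R by rewrite ltr0n.
have d'E : d' = 144 / m'%:R by rewrite /d' mE; field; rewrite gt_eqF.
have Me0 : 0 <= 288 * Mf / e by rewrite (divr_ge0 (mulr_ge0 (ler0n _ _) M0) (ltW e0)).
have d'1 : d' <= 1 by rewrite d'E ler_pdivrMr// mul1r ltW// (le_lt_trans _ m'R)// lerDl.
have d'M : Mf * d' <= e / 2.
  rewrite d'E mulrA ler_pdivrMr//.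
  have : 288 * Mf / e <= m'%:R by rewrite ltW// (le_lt_trans _ m'R)// lerDr.
  by rewrite ler_pdivrMr//; move: (m'%:R : R) => q; clear; lra.
pose S x := lattice_sum r m' L ((complex.Re x - o) / t) ((complex.Im x - o) / t).
have SE x : S x = \sum_(i : 'I_L * 'I_L) annulus r (x - c i).
  rewrite /S /lattice_sum pair_big /=; apply: eq_bigr => -[i j] _.
  congr (annulus r _); rewrite -/m -/t /c.
  case: x => x1 x2; apply/eqP; rewrite eq_complex /=; apply/andP; split; apply/eqP;
  by field; rewrite gt_eqF.
have SK x : normc x <= B + 2 * r -> 0 < kap /\ `|S x - kap| <= d' * kap.
  move=> xB.
  have co (u : R) : `|u| <= B + 2 * r -> m%:R <= (u - o) / t /\ (u - o) / t + m%:R + 1 <= L%:R.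
    rewrite ler_norml => /andP[u1 u2].
    have E : (u - o) / t = (u + (B + 2 * r)) / t + m%:R.
      by rewrite /o; field; rewrite gt_eqF.
    rewrite E; have h1 : 0 <= (u + (B + 2 * r)) / t by rewrite divr_ge0 ?(ltW t0)//; move: u1; clear; lra.
    have h2 : (u + (B + 2 * r)) / t <= 2 * (B + 2 * r) / t.
      by rewrite ler_pM2r ?invr_gt0//; move: u2; clear; lra.
    by split; [move: h1|move: h2 LR]; clear; lra.
  have [X1 X2] := co _ (le_trans (normc_Re x) xB).
  have [Y1 Y2] := co _ (le_trans (normc_Im x) xB).
  exact: lattice_sum_const.
have kap0 : 0 < kap by have := SK 0; rewrite normc0 => /(_ _) []; rewrite ?addr_ge0// mulr_ge0// ltW.
pose F x := \sum_(i : 'I_L * 'I_L) f (c i) / kap * annulus r (x - c i).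
exists ([seq (f (c i) / kap, c i, 2 * r) | i <- enum {: 'I_L * 'I_L}] ++
        [seq (- (f (c i) / kap), c i, r) | i <- enum {: 'I_L * 'I_L}]); split.
  move=> q; rewrite mem_cat => /orP[] /mapP[i _ ->] //=; exact: mulr_gt0.
move=> x; rewrite big_cat !big_map -!enumT !big_enum /= -big_split /=.
have -> : \sum_(i : 'I_L * 'I_L) (f (c i) / kap * logmax (c i) (2 * r) x +
    - (f (c i) / kap) * logmax (c i) r x) = F x.
  by apply: eq_bigr => i _; rewrite annulusE; ring.
have [xB|Bx] := leP (normc x) (B + 2 * r); last first.
  rewrite f0; last by apply: le_lt_trans Bx; rewrite lerDl mulr_ge0// ltW.
  rewrite sub0r normrN /F big1 ?normr0 ?(ltW e0)// => i _.
  have [far|near] := leP (2 * r) (normc (x - c i)).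
    by rewrite annulus_out// mulr0.
  rewrite f0 ?mul0r//; have := normcB_ge x (c i); lra.
have [_ Sk] := SK x xB.
have S0 : 0 <= S x by rewrite SE; apply: sumr_ge0 => i _; exact: annulus_ge0.
have S2 : S x <= 2 * kap.
  move: Sk; rewrite ler_norml => /andP[_].
  have : d' * kap <= 1 * kap by rewrite ler_wpM2r// ltW.
  by lra.
have E : f x - F x = (\sum_(i : 'I_L * 'I_L) (f x - f (c i)) * annulus r (x - c i)
    + f x * (kap - S x)) / kap.
  have -> : \sum_(i : 'I_L * 'I_L) (f x - f (c i)) * annulus r (x - c i) =
      f x * S x - kap * F x.
    rewrite SE /F !mulr_sumr -sumrB; apply: eq_bigr => i _.
    by rewrite mulrA mulrCA divff ?gt_eqF// mulr1 mulrBl.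
  by apply: alg; rewrite gt_eqF.
rewrite E normrM normfV (gtr0_norm kap0) ler_pdivrMr//.
apply: le_trans (ler_normD _ _) _.
have h1 : `|\sum_(i : 'I_L * 'I_L) (f x - f (c i)) * annulus r (x - c i)| <= e / 4 * S x.
  rewrite SE mulr_sumr; apply: le_trans (ler_norm_sum _ _ _) _; apply: ler_sum => i _.
  rewrite normrM (ger0_norm (annulus_ge0 _ r0)).
  have [far|near] := leP (2 * r) (normc (x - c i)).
    by rewrite annulus_out// !mulr0.
  apply: ler_wpM2r; first exact: annulus_ge0.
  by apply/ltW/fd; apply: lt_trans near _; rewrite /r; lra.
have h2 : `|f x * (kap - S x)| <= Mf * (d' * kap).
  by rewrite normrM; apply: ler_pM => //; rewrite distrC.
have h3 : Mf * (d' * kap) <= e / 2 * kap by rewrite mulrA ler_wpM2r// ltW.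
have h4 : e / 4 * S x <= e / 4 * (2 * kap) by rewrite ler_wpM2l// ltW.
lra.
Qed.

End Approximation.

(** * Test functions *)

Section ComplexTopology.
Context {R : realType}.
Implicit Types (f : R[i] -> R) (x y : R[i]).

Lemma nbhs_normcP x (U : set R[i]) :
  nbhs x U <-> exists2 d : R, 0 < d & forall y, normc (x - y) < d -> U y.
Proof.
split=> [/nbhs_ballP[e /= e0 eU]|[d d0 dU]].
  have [e1 e1E] : exists e1, e = real_complex R e1.
    by apply/complex_realP/gtr0_real.
  exists e1; first by rewrite -ltcR -e1E.
  move=> y yx; apply: eU; change (`|x - y| < e); by rewrite normcE e1E ltcR.
apply/nbhs_ballP; exists (real_complex R d) => /=; first by rewrite ltcR.
by move=> y; change (`|x - y| < real_complex R d -> U y); rewrite normcE ltcR; exact: dU.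
Qed.

Lemma continuous_normcP f : continuous f <->
  forall x (e : R), 0 < e -> exists2 d : R, 0 < d &
    forall y, normc (x - y) < d -> `|f x - f y| < e.
Proof.
split=> [fc x e e0|fc x].
  by have /cvgrPdist_lt/(_ e e0)/nbhs_normcP := fc x.
have FF : Filter (nbhs (x : R[i])) := nbhs_filter x.
apply/(@cvgrPdist_lt _ _ _ (nbhs (x : R[i])) FF) => e e0.
apply/nbhs_normcP; exact: fc.
Qed.

Lemma normc_continuous : continuous (@normc R).
Proof.
apply/continuous_normcP => x e e0; exists e => // y; apply: le_lt_trans.
rewrite ler_norml; apply/andP; split; last exact: normcB_ge.
by rewrite lerNl opprB normc_distC normcB_ge.
Qed.

Lemma compact_normc_bounded (K : set R[i]) : compact K -> exists B : R, forall x, K x -> normc x <= B.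
Proof.
move=> cK; have : compact (@normc R @` K).
  by apply: continuous_compact => //; apply: continuous_subspaceT; exact: normc_continuous.
move/compact_bounded => [B [_ HB]]; exists (B + 1) => x Kx.
have := HB (B + 1); rewrite ltrDl => /(_ ltr01 (normc x)) /=; rewrite ger0_norm ?normc_ge0//.
by apply; exists x.
Qed.

Lemma continuous_measurable f : continuous f -> measurable_fun setT f.
Proof.
move=> fc; apply: (measurability (@RGenOInfty.G R)); first exact: RGenOInfty.measurableE.
move=> _ [_ [a ->] <-]; rewrite setTI; apply: sub_sigma_algebra.
by apply: open_comp => // x _; exact: fc.
Qed.

Section TestFunctions.
Variable f : R[i] -> R.
Hypothesis tf : test_function f.

Lemma test_continuous : continuous f.
Proof. by have := tf.1 0%N => -[]. Qed.

Lemma test_measurable : measurable_fun setT f.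
Proof. exact: continuous_measurable test_continuous. Qed.

Lemma test_bounded_support : exists B : R, forall x, B < normc x -> f x = 0.
Proof.
have [B HB] := compact_normc_bounded tf.2; exists B => x; apply: contraTeq => fx.
by rewrite -leNgt; apply: HB; exact: subset_closure.
Qed.

Lemma test_bounded : exists M : R, forall x, `|f x| <= M.
Proof.
have : compact (f @` closure [set w | f w != 0]).
  apply: continuous_compact tf.2; apply: continuous_subspaceT; exact: test_continuous.
move/compact_bounded => [B [_ HB]]; exists (Num.max 0 (B + 1)) => x.
have [->|fx] := eqVneq (f x) 0; first by rewrite normr0 le_max lexx.
rewrite le_max; apply/orP; right; apply: (HB (B + 1)); first by rewrite ltrDl.
by exists x => //; exact: subset_closure.
Qed.

(** By contradiction: bad pairs at distance below 1 / (n + 1) can be ordered so that the first point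
    lies in the compact support, and these points cluster there. *)
Lemma test_unif_continuous (e : R) : 0 < e -> exists2 d : R, 0 < d &
  forall x y, normc (x - y) < d -> `|f x - f y| < e.
Proof.
move=> e0; apply: contrapT => nd.
have H (n : nat) : exists q : R[i] * R[i], [/\ normc (q.1 - q.2) < n.+1%:R^-1,
    e <= `|f q.1 - f q.2| & closure [set w | f w != 0] q.1].
  apply: contrapT => nH; apply: nd; exists n.+1%:R^-1 => [|x y xy].
    by rewrite invr_gt0.
  rewrite ltNge; apply/negP => exy.
  have [fx|fx] := eqVneq (f x) 0; last first.
    by apply: nH; exists (x, y); split=> //; exact: subset_closure.
  have fy : f y != 0.
    by apply: contraTneq e0 => fy; move: exy; rewrite fx fy subrr normr0 leNgt.
  apply: nH; exists (y, x); split; rewrite //= ?[normc (y - x)]normc_distC// 1?distrC//.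
  exact: subset_closure.
have [q qP] := choice H.
have FP : ProperFilter ((fst \o q) @ \oo) by exact: fmap_proper_filter.
have [p [Kp clp]] : closure [set w | f w != 0] `&` cluster ((fst \o q) @ \oo) !=set0.
  by apply: (tf.2 _ FP); exists 0%N => // n _ /=; have [] := qP n.
have /continuous_normcP/(_ p (e / 2))[|d d0 dP] := test_continuous; first by rewrite divr_gt0.
have [N Nd] : exists N, forall n, (N <= n)%N -> n.+1%:R^-1 < d / 2 :> R.
  exists (Num.truncn (2 / d)) => n Nn.
  have := truncnS_gt (2 / d); rewrite -invf_div => /lt_le_trans => h.
  rewrite -[ltRHS]invrK ltf_pV2 ?posrE ?invr_gt0 ?divr_gt0//; apply: h.
  by rewrite ler_nat ltnS invf_div.
have [w [/= [n Nn qn] pw]] : [set (fst \o q) n | n in [set n | (N <= n)%N]] `&`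
    [set w | normc (p - w) < d / 2] !=set0.
  apply: clp; first by exists N => // n /= Nn; exists n.
  by apply/nbhs_normcP; exists (d / 2); rewrite ?divr_gt0.
have [h1 h2 _] := qP n.
have p1 : normc (p - (q n).1) < d / 2 by rewrite [(q n).1]qn.
have : `|f (q n).1 - f (q n).2| < e.
  have a1 : `|f p - f (q n).1| < e / 2 by apply: dP; apply: lt_trans p1 _; lra.
  have a2 : `|f p - f (q n).2| < e / 2.
    apply: dP; apply: le_lt_trans (normc_triangle (q n).1 _ _) _.
    by have := lt_trans h1 (Nd n Nn); move: p1; clear; lra.
  have -> : f (q n).1 - f (q n).2 = (f p - f (q n).2) - (f p - f (q n).1) by ring.
  by apply: le_lt_trans (ler_normB _ _) _; lra.
by rewrite ltNge h2.
Qed.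

End TestFunctions.
End ComplexTopology.

(** * Smooth functions of one variable and a smooth compactly supported bump *)

Section SmoothBumps.
Context {R : realType}.
Implicit Types (phi psi : R -> R) (q : {poly R}) (t u : R).

(* Inserting a polynomial factor makes this family of functions closed under
   differentiation. *)
Definition flat q u : R := if 0 < u then q.[u^-1] * expR (- u^-1) else 0.

(** With v = 1 / u, exp (-v) <= (n + 2)! / v^(n + 2) beats the polynomial and leaves u^2 to spare,
    enough for differentiability at 0. *)
Lemma flat_bound q : exists2 C : R, 0 <= C & forall u, `|u| <= 1 -> `|flat q u| <= C * u ^+ 2.
Proof.
pose n := size q; pose C0 := \sum_(i < n) `|q`_i|.
have C00 : 0 <= C0 by apply: sumr_ge0.
exists (C0 * (n.+2)`!%:R) => [|u u1]; first by rewrite mulr_ge0.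
rewrite /flat; case: ltP => [u0|_]; last first.
  by rewrite normr0; apply: mulr_ge0; [exact: mulr_ge0 | exact: sqr_ge0].
rewrite gtr0_norm// in u1.
have v1 : 1 <= u^-1 by rewrite -invr1 lef_pV2 ?posrE.
set v := u^-1 in v1 *; have v0 : 0 < v by rewrite invr_gt0.
have qv : `|q.[v]| <= C0 * v ^+ n.
  rewrite horner_coef mulr_suml; apply: le_trans (ler_norm_sum _ _ _) _.
  apply: ler_sum => i _; rewrite normrM ler_wpM2l// normrX gtr0_norm//.
  by rewrite ler_weXn2l// ltnW.
have ev : expR (- v) <= (n.+2)`!%:R / v ^+ n.+2.
  rewrite expRN -[leRHS]invf_div lef_pV2 ?posrE ?expR_gt0 ?divr_gt0 ?exprn_gt0 ?ltr0n ?fact_gt0//.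
  by apply: (le_trans _ (expR_ge1Dxn n.+1 (ltW v0))); rewrite lerDr.
rewrite normrM (gtr0_norm (expR_gt0 _)).
apply: (le_trans (ler_pM _ _ qv ev)); rewrite ?expR_ge0//.
have -> : u = v^-1 by rewrite invrK.
rewrite le_eqVlt; apply/orP; left; apply/eqP; rewrite -addn2 exprD; field.
by rewrite !gt_eqF ?exprn_gt0.
Qed.

Definition flat_deriv q : {poly R} := 'X^2 * (q - q^`()).

Lemma is_derive_flat q u : is_derive u 1 (flat q) (flat (flat_deriv q) u).
Proof.
have [u0|u0|->] := ltgtP u 0.
- have -> : flat (flat_deriv q) u = 0 by rewrite /flat ltNge ltW.
  have D0 : is_derive u 1 (cst 0 : R -> R) 0 by exact: is_derive_cst.
  apply: near_eq_is_derive D0.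
  near=> x; rewrite /flat ltNge ltW//=; near: x; exact: lt_nbhsl.
- have -> : flat (flat_deriv q) u =
     q.[u^-1] * (expR (- u^-1) * (u ^- 2)) + expR (- u^-1) * (q^`().[u^-1] * (- u ^- 2)).
    rewrite /flat u0 /flat_deriv !hornerE /= exprVn; ring.
  have dV : is_derive u 1 (fun x => x^-1 : R) (- u ^- 2).
    have := @is_deriveV R id u 1 1 (lt0r_neq0 u0) (is_derive_id u 1).
    by rewrite /= scaler1 => h; exact: h.
  have dN : is_derive u 1 (fun x => - x^-1 : R) (u ^- 2).
    by have := @is_deriveN _ _ _ _ _ _ _ dV; rewrite opprK.
  have d1 := is_derive1_comp (is_derive_poly q u^-1) dV.
  have d2 := @is_derive1_comp R expR (fun x => - x^-1) _ _ _ (is_derive_expR (- u^-1)) dN.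
  have d3 := is_deriveM d1 d2.
  apply: (near_eq_is_derive _ d3).
  near=> x; rewrite /flat; have -> // : 0 < x by near: x; exact: lt_nbhsr.
have -> : flat (flat_deriv q) 0 = 0 by rewrite /flat ltxx.
have [C C0 HC] := flat_bound q.
have f0 : flat q 0 = 0 by rewrite /flat ltxx.
(* At 0 the difference quotient is flat q z / z, which tends to 0 by the quadratic bound. *)
apply/is_derive1_caratheodory; exists (fun z => flat q z / z); split.
- move=> z; rewrite f0 !subr0; have [->|z0] := eqVneq z 0; first by rewrite f0 mulr0.
  by rewrite divfK.
- apply/cvgrPdist_le => e e0; rewrite f0 mul0r; apply/nbhs_ballP.
  exists (Num.min 1 (e / (C + 1))) => /=; first by rewrite lt_min ltr01 divr_gt0// ltr_wpDl.
  move=> z; rewrite /ball /= !sub0r !normrN lt_min => /andP[/ltW z1 /ltW z2].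
  have [->|z0] := eqVneq z 0; first by rewrite f0 mul0r normr0 ltW.
  rewrite normrM normfV ler_pdivrMr ?normr_gt0//.
  apply: (le_trans (HC z z1)); rewrite -[z ^+ 2]real_normK ?num_real// expr2 mulrA.
  rewrite ler_wpM2r//; move: z2; rewrite ler_pdivlMr ?ltr_wpDl//.
  by have := normr_ge0 z; nra.
- by rewrite f0 mul0r.
Unshelve. all: by end_near.
Qed.

Fixpoint smooth (n : nat) phi : Prop := continuous phi /\
  if n is n'.+1 then (forall t, derivable phi t 1) /\ smooth n' (derive1 phi) else True.

Lemma smooth_deriv n phi psi : continuous phi -> (forall t, is_derive t 1 phi (psi t)) ->
  smooth n psi -> smooth n.+1 phi.
Proof.
move=> cphi dphi spsi; split=> //; split=> [t|]; first by have [] := dphi t.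
suff -> : (derive1 phi) = psi by [].
by apply/funext => t; rewrite derive1E; have [] := dphi t.
Qed.

Lemma smoothP n phi : smooth n.+1 phi ->
  (forall t, is_derive t 1 phi ((derive1 phi) t)) /\ smooth n (derive1 phi).
Proof.
by move=> [_ [dphi sphi]]; split=> // t; rewrite derive1E; apply: DeriveDef.
Qed.

Lemma smoothW n phi : smooth n.+1 phi -> smooth n phi.
Proof.
elim: n phi => [|n IH] phi; first by case.
by move=> [cphi [dphi sphi]]; split=> //; split=> //; exact: IH.
Qed.

Lemma smooth_cst n (a : R) : smooth n (cst a).
Proof.
elim: n a => [|n IH] a; first by split=> // t; exact: cvg_cst.
by apply: (@smooth_deriv _ _ (cst 0)) => // t; exact: cvg_cst.
Qed.

Lemma smoothD n phi psi : smooth n phi -> smooth n psi -> smooth n (fun t => phi t + psi t).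
Proof.
elim: n phi psi => [|n IH] phi psi sphi spsi.
  by split=> // t; apply: cvgD; [exact: sphi.1 | exact: spsi.1].
have [dphi sphi'] := smoothP sphi; have [dpsi spsi'] := smoothP spsi.
apply: (smooth_deriv _ _ (IH _ _ sphi' spsi')) => t.
  by apply: cvgD; [exact: sphi.1 | exact: spsi.1].
Qed.

Lemma smoothM n phi psi : smooth n phi -> smooth n psi -> smooth n (fun t => phi t * psi t).
Proof.
elim: n phi psi => [|n IH] phi psi sphi spsi.
  by split=> // t; apply: cvgM; [exact: sphi.1 | exact: spsi.1].
have [dphi sphi'] := smoothP sphi; have [dpsi spsi'] := smoothP spsi.
have s1 := IH _ _ (smoothW sphi) spsi'; have s2 := IH _ _ (smoothW spsi) sphi'.
apply: (smooth_deriv _ _ (smoothD s1 s2)) => t.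
  by apply: cvgM; [exact: sphi.1 | exact: spsi.1].
Qed.

Lemma smooth_affine n phi (a b : R) : smooth n phi -> smooth n (fun t => phi (a * t + b)).
Proof.
have ca : continuous (fun t : R => a * t + b).
  by move=> t; apply: cvgD; [apply: cvgM; [exact: cvg_cst | exact: cvg_id] | exact: cvg_cst].
have cc psi : continuous psi -> continuous (fun t => psi (a * t + b)).
  by move=> cpsi t; apply: (@continuous_comp _ _ _ (fun t => a * t + b)); [exact: ca|exact: cpsi].
elim: n phi => [|n IH] phi sphi; first by split=> //; exact/cc/sphi.1.
have [dphi sphi'] := smoothP sphi.
apply: (smooth_deriv (cc _ sphi.1) _ (smoothM (IH _ sphi') (smooth_cst n a))) => t.
have da : is_derive t 1 (fun t : R => a * t + b) a.
  have := is_deriveD (is_deriveZ a (is_derive_id t (1 : R))) (is_derive_cst b t 1).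
  by rewrite /GRing.scale /= mulr1 addr0.
have dc := @is_derive1_comp R phi (fun t => a * t + b) t _ a (dphi (a * t + b)) da.
exact: dc.
Qed.

Lemma flat_continuous q : continuous (flat q).
Proof.
move=> u; apply: differentiable_continuous; apply/derivable1_diffP.
by have [] := is_derive_flat q u.
Qed.

Lemma smooth_flat n q : smooth n (flat q).
Proof.
elim: n q => [|n IH] q; first by split=> //; exact: flat_continuous.
by apply: (smooth_deriv _ _ (IH (flat_deriv q))); [exact: flat_continuous | exact: is_derive_flat].
Qed.

End SmoothBumps.

Section BumpFunction.
Context {R : realType}.
Implicit Types (phi psi : R -> R) (f : R[i] -> R) (w : R[i]).

Definition tensor phi psi w : R := phi (complex.Re w) * psi (complex.Im w).

Lemma tensor_continuous phi psi : continuous phi -> continuous psi -> continuous (tensor phi psi).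
Proof.
have part (g : R[i] -> R) : (forall x, `|g x| <= normc x) -> {morph g : x y / x - y} -> continuous g.
  move=> gle gB; apply/continuous_normcP => x e e0; exists e => // y.
  by rewrite -gB; apply: le_lt_trans.
have cRe := part _ normc_Re (fun x y => raddfB (@complex.Re R : {additive _ -> _}) x y).
have cIm := part _ normc_Im (fun x y => raddfB (@complex.Im R : {additive _ -> _}) x y).
move=> cphi cpsi w.
have c1 : phi (complex.Re x) @[x --> w] --> phi (complex.Re w).
  by apply: (@continuous_comp _ _ _ (@complex.Re R)); [exact: cRe|exact: cphi].
have c2 : psi (complex.Im x) @[x --> w] --> psi (complex.Im w).
  by apply: (@continuous_comp _ _ _ (@complex.Im R)); [exact: cIm|exact: cpsi].
exact: (cvgM c1 c2).
Qed.

Lemma Ck_tensor n phi psi : smooth n phi -> smooth n psi -> Ck n (tensor phi psi).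
Proof.
elim: n phi psi => [|n IH] phi psi sphi spsi.
  by split=> //; exact: tensor_continuous sphi.1 spsi.1.
have [dphi sphi'] := smoothP sphi; have [dpsi spsi'] := smoothP spsi.
have dR w : is_derive (complex.Re w) 1 (fun t => tensor phi psi (Complex t (complex.Im w)))
    (derive1 phi (complex.Re w) * psi (complex.Im w)).
  rewrite /tensor /=.
  have := is_deriveM (dphi (complex.Re w)) (is_derive_cst (psi (complex.Im w)) (complex.Re w) 1).
  by rewrite scaler0 add0r [_ *: _]mulrC.
have dI w : is_derive (complex.Im w) 1 (fun t => tensor phi psi (Complex (complex.Re w) t))
    (phi (complex.Re w) * derive1 psi (complex.Im w)).
  rewrite /tensor /=.
  have := is_deriveM (is_derive_cst (phi (complex.Re w)) (complex.Im w) 1) (dpsi (complex.Im w)).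
  by rewrite scaler0 addr0.
split; first exact: tensor_continuous sphi.1 spsi.1.
split=> [w|w||]; [by have [] := dR w | by have [] := dI w | |].
  have -> : dRe (tensor phi psi) = tensor (derive1 phi) psi.
    by apply/funext => w; rewrite /dRe derive1E; have [] := dR w.
  exact: IH (smoothW spsi).
have -> : dIm (tensor phi psi) = tensor phi (derive1 psi).
  by apply/funext => w; rewrite /dIm derive1E; have [] := dI w.
exact: IH (smoothW sphi) _.
Qed.

Lemma compact_box (B : R) :
  compact [set w : R[i] | `|complex.Re w| <= B /\ `|complex.Im w| <= B].
Proof.
have cseg : compact (`[- B, B]%classic `*` `[- B, B]%classic : set (R * R)).
  by apply: compact_setX; exact: segment_compact.
have cc : continuous (fun q : R * R => Complex q.1 q.2 : R[i]).
  move=> q U /nbhs_normcP[d d0 dU]; apply/nbhs_ballP; exists (d / 2); first by rewrite /= divr_gt0.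
  move=> t [h1 h2]; apply: dU; apply: le_lt_trans (normc_le_ReIm _) _.
  by move: h1 h2; rewrite /ball /=; lra.
have := continuous_compact (continuous_subspaceT cc) cseg.
congr compact; apply/seteqP; split=> [w [q [/= + +] <-] /=|w [/= h1 h2]].
  by rewrite !in_itv /= -!ler_norml.
exists (complex.Re w, complex.Im w); last by case: (w).
by split; rewrite /= in_itv /= -ler_norml.
Qed.

Definition cutoff (B t : R) : R := flat 1 (-1 * t + B) * flat 1 (1 * t + B).
Definition bump (B : R) : R[i] -> R := tensor (cutoff B) (cutoff B).

Lemma flat1_ge0 (u : R) : 0 <= flat 1 u.
Proof. by rewrite /flat; case: ltP => // _; rewrite hornerC mul1r expR_ge0. Qed.

Lemma cutoff_ge0 (B t : R) : 0 <= cutoff B t.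
Proof. by rewrite mulr_ge0 ?flat1_ge0. Qed.

Lemma cutoff_gt0 (B t : R) : `|t| < B -> 0 < cutoff B t.
Proof.
rewrite ltr_norml => /andP[h1 h2]; rewrite /cutoff /flat.
have -> : 0 < -1 * t + B by move: h2; lra.
have -> : 0 < 1 * t + B by move: h1; lra.
by rewrite !hornerC !mul1r -expRD expR_gt0.
Qed.

Lemma cutoff_neq0 (B t : R) : cutoff B t != 0 -> `|t| <= B.
Proof.
rewrite /cutoff /flat; case: ltP => [h1|]; last by rewrite mul0r eqxx.
case: ltP => [h2|]; last by rewrite mulr0 eqxx.
by move=> _; rewrite ler_norml; apply/andP; split; move: h1 h2; lra.
Qed.

Lemma smooth_cutoff n (B : R) : smooth n (cutoff B).
Proof. by apply: smoothM; apply: smooth_affine; exact: smooth_flat. Qed.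

Lemma bump_ge0 (B : R) w : 0 <= bump B w.
Proof. by rewrite mulr_ge0 ?cutoff_ge0. Qed.

Lemma bump_gt0 (B : R) w : normc w < B -> 0 < bump B w.
Proof.
move=> wB; rewrite mulr_gt0 ?cutoff_gt0//; apply: le_lt_trans wB.
  exact: normc_Re.
exact: normc_Im.
Qed.

Lemma test_function_bump (B : R) : test_function (bump B).
Proof.
split=> [n|]; first by apply: Ck_tensor; exact: smooth_cutoff.
apply: subclosed_compact (@compact_box B) _; first exact: closed_closure.
have part (g : R[i] -> R) w : (forall x, `|g x| <= normc x) -> {morph g : x y / x - y} ->
    closure [set w | bump B w != 0] w -> (forall x, bump B x != 0 -> `|g x| <= B) -> `|g w| <= B.
  move=> gle gB clw gbump; rewrite leNgt; apply/negP => Bw.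
  have [|x [/= xB wx]] := clw [set x | normc (w - x) < `|g w| - B].
    by apply/nbhs_normcP; exists (`|g w| - B); rewrite // subr_gt0.
  have := gle (w - x); rewrite gB; have := gbump x xB; have := lerB_dist (g w) (g x).
  by move: wx; clear; lra.
have sB w : bump B w != 0 -> `|complex.Re w| <= B /\ `|complex.Im w| <= B.
  by rewrite mulf_eq0 negb_or => /andP[/cutoff_neq0 h1 /cutoff_neq0 h2].
move=> w clw; split.
  apply: (part _ w normc_Re _ clw) => [x y|x /sB[]//].
  exact: (raddfB (@complex.Re R : {additive _ -> _})).
apply: (part _ w normc_Im _ clw) => [x y|x /sB[]//].
exact: (raddfB (@complex.Im R : {additive _ -> _})).
Qed.

Lemma test_integrable (mu : probability R[i] R) f : test_function f ->
  mu.-integrable setT (EFin \o f).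
Proof.
move=> tf; apply: measurable_bounded_integrable => //.
- by rewrite (le_lt_trans (probability_le1 _ _)) ?ltry.
- exact: test_measurable.
have [M fM] := test_bounded tf.
by exists M; split=> [|C MC x _]; rewrite ?num_real//= (le_trans (fM x))// ltW.
Qed.

(** The sets where the bumps are positive exhaust the plane; if every integral vanished they would
    all be null, against mu having mass 1. *)
Lemma bump_integral_gt0 (mu : probability R[i] R) :
  exists B : R, 0 < (\int[mu]_w bump B w)%R.
Proof.
apply: contrapT => nB.
have B0 n : mu.-negligible [set w | bump n%:R w != 0].
  have tb := test_function_bump n%:R.
  have I0 : (\int[mu]_w (bump n%:R w)%:E = 0)%E.
    have fin := integrable_fin_num measurableT (test_integrable mu tb).
    rewrite -(fineK fin); congr EFin; apply/eqP; rewrite eq_le; apply/andP; split.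
      by rewrite leNgt; apply/negP => h; apply: nB; exists n%:R.
    by apply: Rintegral_ge0 => w _; exact: bump_ge0.
  have : (\int[mu]_(w in setT) `|(EFin \o bump n%:R) w| = 0)%E.
    rewrite -[RHS]I0; apply: eq_integral => w _ /=; by rewrite ger0_norm ?bump_ge0.
  have mE := measurable_int mu (test_integrable mu tb).
  move/(ae_eq_integral_abs mu measurableT mE); apply: negligibleS => w /= bw /(_ I) /= [b0].
  by rewrite b0 eqxx in bw.
have : mu.-negligible setT.
  have -> : [set: R[i]] = \bigcup_n [set w | bump n%:R w != 0].
    apply/seteqP; split=> // w _; exists (Num.truncn (normc w)).+1 => //=.
    by rewrite gt_eqF// bump_gt0// truncnS_gt.
  exact: negligible_bigcup.
move/(negligibleP mu measurableT) => mu0; have := probability_setT mu.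
by rewrite mu0 => /eqP; rewrite eq_sym onee_eq0.
Qed.

End BumpFunction.

(** * Empirical measures and sampling *)

Section UniformMeasure.
Context {R : realType}.
Implicit Types (f : R[i] -> R) (s zs : seq R[i]).

Lemma ge0_integral_uniform_on s (F : R[i] -> \bar R) : (0 < size s)%N ->
  measurable_fun [set: R[i]] F -> (forall x, (0 <= F x)%E) ->
  (\int[uniform_on s]_w F w = ((size s)%:R^-1)%:E * \sum_(i < size s) F s`_i)%E.
Proof.
move=> s0 mF F0.
have k0 : 0 <= (size s)%:R^-1 :> R by rewrite invr_ge0.
pose m := msum (fun i => \d_(s`_i) : measure R[i] R) (size s).
transitivity (\int[mscale (NngNum k0) m]_w F w)%E.
  apply: eq_measure_integral => U mU _.
  rewrite /uniform_on /= /mnormalize /=.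
  have mT : msum (fun i => \d_(s`_i) : measure R[i] R) (size s) [set: R[i]] = (size s)%:R%:E.
    rewrite /msum (eq_bigr (fun=> 1%E)) => [|i _]; last exact: diracT.
    by rewrite sumEFin sumr_const card_ord.
  rewrite mT /= /mscale /= /m muleC.
  by rewrite eqe pnatr_eq0 gtn_eqF.
rewrite ge0_integral_mscale//=; congr (_ * _)%E.
rewrite ge0_integral_measure_sum//; apply: eq_bigr => i _.
by rewrite integral_dirac// diracT mul1e.
Qed.

Lemma integral_uniform_on s f : (0 < size s)%N -> measurable_fun [set: R[i]] f ->
  (\int[uniform_on s]_w f w)%R = (size s)%:R^-1 * \sum_(x <- s) f x.
Proof.
move=> s0 mf; rewrite /Rintegral integralE.
have mE : measurable_fun [set: R[i]] (EFin \o f) by exact: measurableT_comp.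
rewrite !ge0_integral_uniform_on//.
- have E (g : R[i] -> R) : (\sum_(i < size s) (g s`_i)%:E)%E = (\sum_(x <- s) g x)%:E.
    by rewrite (big_nth 0) big_mkord sumEFin.
  under eq_bigr do rewrite funeposE /= -EFin_max.
  under [X in (_ - _ * X)%E]eq_bigr do rewrite funenegE /= -EFin_max.
  rewrite (E (fun x => Num.max (f x) 0)) (E (fun x => Num.max (- f x) 0)) -!EFinM -EFinB /=.
  rewrite -mulrBr -sumrB; congr (_ * _); apply: eq_bigr => x _.
  by rewrite /Num.max; case: ltP => h1; case: ltP => h2; lra.
- exact: measurable_funeneg.
- exact: measurable_funepos.
Qed.

Definition sample {Omega : Type} (z : nat -> R[i]) (A : nat -> set Omega) (w : Omega) (k : nat) :
  seq R[i] := mkseq (fun j => z (included_index A w j)) k.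

Lemma size_sample {Omega : Type} (z : nat -> R[i]) (A : nat -> set Omega) w k :
  size (sample z A w k) = k.
Proof. by rewrite size_mkseq. Qed.

Lemma random_polyE {Omega : Type} (z : nat -> R[i]) (A : nat -> set Omega) w k :
  random_poly z A k w = poly_of (sample z A w k).
Proof. by rewrite /random_poly /poly_of /sample big_map -[in RHS](subn0 k) big_mkord. Qed.

Lemma integral_zeros f zs : measurable_fun [set: R[i]] f -> (0 < size zs)%N ->
  (\int[zero_measure (poly_of zs)]_w f w)%R = (size zs)%:R^-1 * \sum_(x <- zs) f x.
Proof.
move=> mf s0; have pm := zeros_poly_of zs.
by rewrite /zero_measure integral_uniform_on ?(perm_size pm)// (perm_big _ pm).
Qed.

Lemma integral_critical f zs : measurable_fun [set: R[i]] f -> (1 < size zs)%N ->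
  (\int[zero_measure (poly_of zs)^`()]_w f w)%R =
  (size zs).-1%:R^-1 * \sum_(x <- zeros (poly_of zs)^`()) f x.
Proof.
move=> mf s1; have sz := size_zeros_deriv (ltnW s1).
by rewrite /zero_measure integral_uniform_on ?sz// -ltnS prednK// ltnW.
Qed.

Section Distributed.
Variables (mu : probability R[i] R) (z : nat -> R[i]).
Hypothesis muz : distributed mu z.

Lemma distributed_average f (e : R) : test_function f -> 0 < e ->
  exists n0, forall n, (n0 <= n)%N -> (0 < n)%N ->
    `|\sum_(i < n) f (z i) - n%:R * (\int[mu]_w f w)%R| <= e * n%:R.
Proof.
move=> tf e0; have /cvgrPdist_le/(_ e e0)[n0 _ H] := muz tf.
exists n0 => n n0n np; have := H n n0n.
rewrite integral_uniform_on ?size_mkseq//; last exact: test_measurable.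
rewrite /mkseq big_map -[X in iota 0 X]subn0 big_mkord distrC.
have n0R : 0 < n%:R :> R by rewrite ltr0n.
rewrite -(ler_pM2r n0R) -[X in _ * X <= _](gtr0_norm n0R) -normrM mulrBl.
by rewrite mulrAC mulVf ?gt_eqF// mul1r [n%:R * (\int[mu]_w f w)%R]mulrC.
Qed.

(** If z eventually left the support of a bump of positive integral J, only boundedly many terms
    would contribute and the averages would tend to 0 instead of J. *)
Lemma distributed_recurrent : exists B : R, forall n0, exists2 n, (n0 <= n)%N & normc (z n) <= B.
Proof.
have [B0 I0] := bump_integral_gt0 mu; have tb := test_function_bump B0.
have [B HB] := test_bounded_support tb; have [M HM] := test_bounded tb.
exists B; apply: contrapT => /existsNP[n1 nH].
have out n : (n1 <= n)%N -> bump B0 (z n) = 0.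
  by move=> n1n; apply: HB; rewrite ltNge; apply/negP => h; apply: nH; exists n.
set J := (\int[mu]_w bump B0 w)%R in I0.
have J2 : 0 < J / 2 by rewrite divr_gt0.
have [n0 Hn] := distributed_average tb J2.
pose n := maxn (maxn n0 n1) (Num.truncn (n1%:R * M * 2 / J)).+1.
have nn0 : (n0 <= n)%N by rewrite /n !leq_max leqnn.
have nn1 : (n1 <= n)%N by rewrite /n !leq_max leqnn orbT.
have np : (0 < n)%N by rewrite /n leq_max orbT.
have nM : n1%:R * M * 2 / J < n%:R.
  by apply: lt_le_trans (truncnS_gt _) _; rewrite ler_nat leq_max leqnn orbT.
have S : `|\sum_(i < n) bump B0 (z i)| <= n1%:R * M.
  rewrite -(big_mkord xpredT (fun i => bump B0 (z i))) (big_cat_nat (n := n1))//=.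
  rewrite [X in _ + X]big_nat_cond [X in _ + X]big1 ?addr0; last first.
    by move=> i /andP[/andP[h _] _]; exact: out.
  apply: le_trans (ler_norm_sum _ _ _) _; apply: le_trans (ler_sum _ (fun i _ => HM (z i))) _.
  by rewrite sumr_const_nat subn0 mulr_natl.
have := Hn n nn0 np; rewrite -/J; move: nM; rewrite ltr_pdivrMr// => nM.
have nR : 0 < n%:R :> R by rewrite ltr0n.
rewrite distrC => /(le_trans (lerB_dist _ _)); rewrite gtr0_norm ?mulr_gt0//.
by move: S nM; clear; nra.
Qed.

Lemma distributed_cluster : exists x : R[i], forall (r : R) n0, 0 < r ->
  exists2 n, (n0 <= n)%N & normc (z n - x) < r.
Proof.
have [B HB] := distributed_recurrent.
have /choice[u uP] (n0 : nat) : exists n, (n0 <= n)%N /\ normc (z n) <= B.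
  by have [n n0n nB] := HB n0; exists n.
have FP : ProperFilter ((z \o u) @ \oo) by exact: fmap_proper_filter.
have [x [_ clx]] : [set w : R[i] | `|complex.Re w| <= B /\ `|complex.Im w| <= B]
    `&` cluster ((z \o u) @ \oo) !=set0.
  apply: (@compact_box _ B _ FP); exists 0%N => // n _ /=.
  split; apply: le_trans (uP n).2; [exact: normc_Re | exact: normc_Im].
exists x => r n0 r0.
have [w [/= [n n0n zn] xw]] : [set (z \o u) n | n in [set n | (n0 <= n)%N]] `&`
    [set w | normc (x - w) < r] !=set0.
  apply: clx; first by exists n0 => // n /= n0n; exists n.
  by apply/nbhs_normcP; exists r.
exists (u n); first exact: leq_trans (uP n).1.
by rewrite normc_distC zn.
Qed.

End Distributed.
End UniformMeasure.

(** * Counting the included indices and enumerating them *)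

Section IncludedIndices.
Context {R : realType} {d : measure_display} {Omega : measurableType d}.
Implicit Types (A : nat -> set Omega) (w : Omega).

Lemma included_belowS A w n : included_below A w n.+1 = (included_below A w n + (w \in A n))%N.
Proof. by rewrite /included_below big_ord_recr. Qed.

Lemma included_below_mono A w n n' : (n <= n')%N -> (included_below A w n <= included_below A w n')%N.
Proof.
move=> /subnK<-; elim: (n' - n)%N => // m IH.
by rewrite addSn included_belowS (leq_trans IH)// leq_addr.
Qed.

Lemma included_index_below A w n : w \in A n -> included_index A w (included_below A w n) = n.
Proof.
move=> wAn; rewrite /included_index; set S := [set _ | _].
have [] : S (xget 0%N S) by apply: (@xgetPex _ 0%N S); exists n; split=> //; exact/set_mem.
move: (xget _ _) => n' /mem_set wAn' E.
have lt m m' : w \in A m -> (m < m')%N -> (included_below A w m < included_below A w m')%N.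
  move=> wAm mm'; apply: leq_trans (included_below_mono A w mm').
  by rewrite included_belowS wAm addn1.
change (included_below A w n' = included_below A w n) in E.
have [h|h|//] := ltngtP n' n; first by have := lt _ _ wAn' h; rewrite E ltnn.
by have := lt _ _ wAn h; rewrite E ltnn.
Qed.

(** Bridge between the two descriptions of the sample, by counting and by [included_index]. The
    [minn] covers outcomes with fewer than k inclusions below N. *)
Lemma sum_first_included (V : nmodType) A w k N (F : nat -> V) :
  \sum_(n < N | (w \in A n) && (included_below A w n < k)%N) F n =
  \sum_(j < minn (included_below A w N) k) F (included_index A w j).
Proof.
elim: N => [|N IH]; first by rewrite /included_below !big_ord0 min0n big_ord0.
rewrite big_mkcond big_ord_recr /= -big_mkcond /= IH included_belowS.
have [wA|_] /= := boolP (w \in A N); last by rewrite addn0 addr0.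
case: ltnP => h; last by rewrite addr0 addn1 !(minn_idPr _) // ltnW.
by rewrite addn1 !(minn_idPl _) ?(ltnW h)// big_ord_recr /= included_index_below.
Qed.

Lemma sum_included A w N (F : nat -> R) :
  \sum_(n < N) (w \in A n)%:R * F n = \sum_(j < included_below A w N) F (included_index A w j).
Proof.
have := sum_first_included A w N.+1 N F.
have le : (included_below A w N < N.+1)%N.
  rewrite ltnS /included_below -[leqRHS]card_ord -sum1_card.
  by apply: leq_sum => i _; exact: leq_b1.
rewrite (minn_idPl (ltnW le)) => <-; rewrite [RHS]big_mkcond; apply: eq_bigr => n _.
rewrite (leq_ltn_trans (included_below_mono A w (ltnW (ltn_ord n))) le) andbT.
by case: (w \in A n); rewrite ?mul1r ?mul0r.
Qed.

Lemma included_below_natr A w N : (included_below A w N)%:R = \sum_(n < N) (w \in A n)%:R :> R.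
Proof. by rewrite natr_sum. Qed.

Lemma sum_ord_dist (F : nat -> R) (M : R) (a b : nat) : (forall j, `|F j| <= M) ->
  `|\sum_(j < a) F j - \sum_(j < b) F j| <= M * `|a%:R - b%:R|.
Proof.
move=> FM; wlog ab : a b / (a <= b)%N.
  move=> H; have /orP[|ba] := leq_total a b; first exact: H.
  by rewrite distrC [X in _ * X]distrC; exact: H.
rewrite -!(big_mkord xpredT F) (big_cat_nat _ ab)//= opprD addNKr normrN.
apply: le_trans (ler_norm_sum _ _ _) _; apply: le_trans (ler_sum _ (fun i _ => FM i)) _.
by rewrite sumr_const_nat distrC -natrB// ger0_norm// mulr_natr.
Qed.

Definition deviation A (p : R) (b : nat -> R) N w : R :=
  \sum_(i < N) b i * ((w \in A i)%:R - p).

(** The number of inclusions below N is close to p N, hence to k. The mismatch costs M e N, the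
    fluctuation of the included sum e N, the average of F another e N; the 2 M comes from rounding k
    / p. *)
Lemma sample_sum A w (p : R) (F : nat -> R) (M I e : R) k : 0 < p < 1 ->
  (forall n, `|F n| <= M) -> `|I| <= M ->
  let N := Num.truncn (k%:R / p) in
  `|deviation A p (fun=> 1) N w| <= e * N%:R ->
  `|deviation A p F N w| <= e * N%:R ->
  `|\sum_(i < N) F i - N%:R * I| <= e * N%:R ->
  `|\sum_(j < k) F (included_index A w j) - k%:R * I| <= e * N%:R * (M + 2) + 2 * M.
Proof.
move=> /andP[p0 p1] FM IM N d1 dF dI.
have M0 : 0 <= M := le_trans (normr_ge0 _) IM.
have [Nk kN] : p * N%:R <= k%:R /\ k%:R < p * N%:R + p.
  have /andP[h1 h2] := truncn_itv (divr_ge0 (ler0n R k) (ltW p0)).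
  move: h1 h2; rewrite -/N ler_pdivlMr// ltr_pdivrMr// -natr1; nra.
have := sum_ord_dist k (included_below A w N) (fun j => FM (included_index A w j)).
rewrite -sum_included.
have E1 : deviation A p (fun=> 1) N w = (included_below A w N)%:R - p * N%:R.
  rewrite /deviation; under eq_bigr do rewrite mul1r.
  by rewrite sumrB sumr_const card_ord included_below_natr mulr_natr.
have E2 : deviation A p F N w = \sum_(n < N) (w \in A n)%:R * F n - p * \sum_(n < N) F n.
  rewrite /deviation mulr_sumr -sumrB; apply: eq_bigr => i _; ring.
rewrite E1 in d1; rewrite E2 in dF.
set S1 := \sum_(j < k) _; set S2 := \sum_(n < N) _ * _ in dF *; set S3 := \sum_(n < N) F n in dF dI *.
move: (included_below _ _ _)%:R d1 => c d1 h1.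
have h2 : M * `|k%:R - c| <= M * (e * N%:R + p).
  rewrite ler_wpM2l//; move: d1; rewrite !ler_norml => /andP[a1 a2].
  by apply/andP; split; move: a1 a2 Nk kN; clear; lra.
have h3 : `|p * (S3 - N%:R * I)| <= e * N%:R.
  rewrite normrM gtr0_norm//; apply: le_trans dI; rewrite ler_piMl//; exact: ltW.
have h4 : `|(p * N%:R - k%:R) * I| <= M.
  rewrite normrM -[leRHS]mul1r ler_pM// ler_norml; move: Nk kN p1; clear; lra.
have -> : S1 - k%:R * I = (S1 - S2) + (S2 - p * S3) + p * (S3 - N%:R * I) + (p * N%:R - k%:R) * I by ring.
have h5 : M * p <= M by rewrite ler_piMr// ltW.
have := ler_normD (S1 - S2 + (S2 - p * S3) + p * (S3 - N%:R * I)) ((p * N%:R - k%:R) * I).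
have := ler_normD (S1 - S2 + (S2 - p * S3)) (p * (S3 - N%:R * I)).
have := ler_normD (S1 - S2) (S2 - p * S3).
by move: h1 h2 h3 h4 h5 dF; clear; lra.
Qed.

End IncludedIndices.

(** * Events of probability tending to 1, and laws of large numbers *)

Section Likely.
Context {R : realType} {d : measure_display} {Omega : measurableType d}.
Variable P : probability Omega R.
Implicit Types (S T : nat -> set Omega).

(* The exceptional event B makes sense of P (S k) --> 1 when S k is not known
   to be measurable. *)
Definition likely S : Prop := forall e : R, 0 < e -> exists k0, forall k, (k0 <= k)%N ->
  exists B, [/\ measurable B, (P B <= e%:E)%E & ~` B `<=` S k].

Lemma likelyS S T k0 : (forall k, (k0 <= k)%N -> S k `<=` T k) -> likely S -> likely T.
Proof.
move=> ST lS e e0; have [k1 Hk] := lS e e0; exists (maxn k0 k1) => k.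
rewrite geq_max => /andP[h0 h1]; have [B [mB PB BS]] := Hk k h1.
by exists B; split=> // w /BS; exact: ST.
Qed.

Lemma likelyT S k0 : (forall k, (k0 <= k)%N -> S k = setT) -> likely S.
Proof.
move=> ST e e0; exists k0 => k h; exists set0; split=> //; first by rewrite measure0 lee_fin ltW.
by rewrite ST.
Qed.

Lemma likelyI S T : likely S -> likely T -> likely (fun k => S k `&` T k).
Proof.
move=> lS lT e e0; have e2 : 0 < e / 2 by rewrite divr_gt0.
have [k1 H1] := lS _ e2; have [k2 H2] := lT _ e2; exists (maxn k1 k2) => k.
rewrite geq_max => /andP[h1 h2].
have [B [mB PB BS]] := H1 k h1; have [C [mC PC CT]] := H2 k h2.
exists (B `|` C); split; first exact: measurableU.
  rewrite (le_trans (measureU2 _ _ _))// [leRHS](_ : _ = (e / 2)%:E + (e / 2)%:E)%E ?leeD//.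
  by rewrite -EFinD; congr EFin; lra.
by move=> w; rewrite setCU => -[/BS ? /CT ?]; split.
Qed.

Lemma likely_seq (I : eqType) (s : seq I) (S : I -> nat -> set Omega) :
  (forall i, i \in s -> likely (S i)) -> likely (fun k => [set w | forall i, i \in s -> S i k w]).
Proof.
elim: s => [_|i s IH H]; first by apply: (@likelyT _ 0%N) => k _; apply/seteqP; split.
have h1 := H i (mem_head _ _).
have h2 : likely (fun k => [set w | forall i, i \in s -> S i k w]).
  by apply: IH => j js; apply: H; rewrite inE js orbT.
apply: (@likelyS _ _ 0%N _ (likelyI h1 h2)) => k _ w [/= a1 a2] j.
by rewrite inE => /predU1P[->|/a2].
Qed.

Section LargeNumbers.
Variables (p : R) (A : nat -> set Omega).
Hypotheses (p01 : 0 < p < 1).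
Hypotheses (mA : forall n, measurable (A n)) (pA : forall n, P (A n) = p%:E).
Hypothesis iA : mutually_independent P A.

Lemma measurable_deviation_ge (b : nat -> R) N t :
  measurable [set w | (t <= `|deviation A p b N w|)%R].
Proof. exact: (measurable_deviation N mA b p t). Qed.

Lemma deviation_chebyshev (b : nat -> R) (M e : R) N : 0 < e -> (0 < N)%N ->
  (forall i, `|b i| <= M) ->
  (P [set w | (e * N%:R <= `|deviation A p b N w|)%R] <= (M ^+ 2 / e ^+ 2 / N%:R)%:E)%E.
Proof.
move=> e0 N0 bM; have NR : 0 < N%:R :> R by rewrite ltr0n.
have q01 : 0 <= p <= 1 by case/andP: p01 => /ltW-> /ltW->.
have := law_chebyshev mA b q01 (fun i _ => pA i) (fun i j _ _ => prob_and mA pA iA (i:=i) (j:=j))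
  (mulr_gt0 e0 NR).
move=> /(_ N)/le_trans; apply; rewrite lee_fin.
have : \sum_(i < N) b i ^+ 2 <= N%:R * M ^+ 2.
  apply: le_trans (_ : \sum_(i < N) M ^+ 2 <= _); last by rewrite sumr_const card_ord mulr_natl.
  apply: ler_sum => i _; rewrite -real_normK ?num_real// lerXn2r ?nnegrE//.
  exact: le_trans (bM i).
rewrite ler_pdivrMr ?exprn_gt0 ?mulr_gt0// => /le_trans; apply.
by rewrite le_eqVlt; apply/orP; left; apply/eqP; field; rewrite !gt_eqF.
Qed.

Lemma likely_deviation (b : nat -> R) (M e : R) (N : nat -> nat) : 0 < e ->
  (forall i, `|b i| <= M) -> (forall m, exists k0, forall k, (k0 <= k)%N -> (m <= N k)%N) ->
  likely (fun k => [set w | `|deviation A p b (N k) w| <= e * (N k)%:R]).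
Proof.
move=> e0 bM Noo c c0.
have [k0 Hk] := Noo (Num.truncn (M ^+ 2 / e ^+ 2 / c)).+1; exists k0 => k /Hk h.
have N0 : (0 < N k)%N by exact: leq_ltn_trans h.
exists [set w | e * (N k)%:R <= `|deviation A p b (N k) w|]; split.
- exact: measurable_deviation_ge.
- apply: le_trans (deviation_chebyshev e0 N0 bM) _; rewrite lee_fin ler_pdivrMr ?ltr0n//.
  rewrite [c * _]mulrC -ler_pdivrMr//; apply: ltW; apply: lt_le_trans (truncnS_gt _) _.
  by rewrite ler_nat.
- by move=> w /= /negP; rewrite -ltNge => /ltW.
Qed.

(** Along the squares the Chebyshev bounds are O(1 / m^2), so second moments suffice for
    Borel-Cantelli. *)
Lemma ae_deviation_sq (b : nat -> R) (M e : R) : 0 < e -> (forall i, `|b i| <= M) ->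
  {ae P, forall w, exists m0, forall m, (m0 <= m)%N ->
    `|deviation A p b (m.+1 ^ 2) w| < e * (m.+1 ^ 2)%:R}.
Proof.
move=> e0 bM.
pose F m := [set w | e * (m.+1 ^ 2)%:R <= `|deviation A p b (m.+1 ^ 2) w|].
have mF m : measurable (F m) by exact: measurable_deviation_ge.
pose C := M ^+ 2 / e ^+ 2.
have C0 : 0 <= C by rewrite divr_ge0 ?sqr_ge0.
have PF m : (P (F m) <= (C / (m.+1 ^ 2)%:R)%:E)%E.
  by apply: deviation_chebyshev => //; rewrite expn_gt0.
have part m : (\sum_(0 <= i < m) P (F i) <= (C * (3 - 2 / m.+1%:R))%:E)%E.
  elim: m => [|m IH]; first by rewrite big_geq// lee_fin divr1 mulr_ge0//; lra.
  rewrite big_nat_recr//=; apply: le_trans (leeD IH (PF m)) _.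
  rewrite -EFinD lee_fin -mulrDr ler_wpM2l// natrX -[m.+2%:R]natr1.
  have : 1 <= m.+1%:R :> R by rewrite ler1n.
  move: (m.+1%:R : R) => x x1; have x0 : 0 < x by lra.
  have E : 3 - 2 / (x + 1) - (3 - 2 / x + x ^- 2) = (x - 1) * (x + 1)^-1 * x ^- 2.
    by field; rewrite !gt_eqF//; lra.
  by rewrite -subr_ge0 E !mulr_ge0 ?invr_ge0 ?sqr_ge0//; lra.
have sF : (\sum_(0 <= n <oo) P (F n) < +oo)%E.
  apply: (@le_lt_trans _ _ (C * 3)%:E); last exact: ltry.
  apply: lime_le; first by apply: is_cvg_nneseries => n _ _; exact: measure_ge0.
  apply: nearW => m; apply: le_trans (part m) _; rewrite lee_fin ler_wpM2l//.
  by rewrite gerBl divr_ge0.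
have L0 := lim_sup_set_cvg0 mF sF.
exists (lim_sup_set F); split=> //; first by apply: bigcap_measurable => // n _; apply: bigcup_measurable.
move=> w /= nw m0 _; apply: contrapT => h; apply: nw; exists m0 => m m0m.
rewrite ltNge; apply/negP => Fm; apply: h; exists m => //.
Qed.

Lemma deviation_dist (b : nat -> R) (M : R) N N' w : (N <= N')%N -> (forall i, `|b i| <= M) ->
  `|deviation A p b N' w - deviation A p b N w| <= M * (N' - N)%:R.
Proof.
move=> NN bM; rewrite /deviation.
pose G i := b i * ((w \in A i)%:R - p).
rewrite -!(big_mkord xpredT G) (big_cat_nat _ NN)//= addrAC subrr add0r.
apply: le_trans (ler_norm_sum _ _ _) _.
apply: le_trans (_ : \sum_(N <= i < N') M <= _); last by rewrite sumr_const_nat mulr_natr.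
apply: ler_sum => i _; rewrite normrM -[leRHS]mulr1 ler_pM//.
case/andP: p01 => p0 p1; case: (w \in A i) => /=; rewrite ler_norml; lra.
Qed.

Lemma ae_deviation (b : nat -> R) (M : R) : (forall i, `|b i| <= M) ->
  {ae P, forall w, forall e : R, 0 < e -> exists n0, forall n, (n0 <= n)%N ->
    `|deviation A p b n w| <= e * n%:R}.
Proof.
move=> bM; have M0 : 0 <= M := le_trans (normr_ge0 _) (bM 0%N).
have : {ae P, forall w, forall q : nat, exists m0, forall m, (m0 <= m)%N ->
    `|deviation A p b (m.+1 ^ 2) w| < q.+1%:R^-1 * (m.+1 ^ 2)%:R}.
  by apply: ae_foralln => q; apply: (ae_deviation_sq _ bM); rewrite invr_gt0.
apply: filterS => w H e e0.
have e2 : 0 < e / 2 by rewrite divr_gt0.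
have [q qe] : exists q : nat, q.+1%:R^-1 <= e / 2.
  exists (Num.truncn (e / 2)^-1); rewrite -[leRHS]invrK lef_pV2 ?posrE ?invr_gt0//.
  exact/ltW/truncnS_gt.
have [m0 Hm] := H q.
(* From (s + 1)^2 to the next square the deviation moves by at most 2 M (s + 1), which is at most e
   (s + 1)^2 / 3 once 6 M / e <= s + 1. *)
pose r := (Num.truncn (6 * M / e)).+1.
exists (maxn m0.+1 r ^ 2)%N => n hn.
have [s /andP[s1 s2]] : exists s, (s.+1 ^ 2 <= n < s.+2 ^ 2)%N.
  have : (0 < n)%N by apply: leq_trans hn; rewrite expn_gt0 leq_max.
  elim: n {hn} => // -[_ _|n IH _]; first by exists 0%N.
  have [//|s /andP[h1 h2]] := IH; case: (ltnP n.+2 (s.+2 ^ 2)) => h.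
    by exists s; rewrite h ltnW.
  by exists s.+1; rewrite h /= (leq_ltn_trans h2)// ltn_exp2r.
have sm : (maxn m0.+1 r <= s.+1)%N.
  by rewrite -ltnS -(ltn_exp2r _ _ (isT : 0 < 2)%N); apply: leq_ltn_trans s2.
move: sm; rewrite geq_max => /andP[sm0 sr].
have d1 := Hm s sm0; have d2 := deviation_dist w s1 bM.
have sR : 6 * M / e <= s.+1%:R.
  by apply: le_trans (ltW (truncnS_gt _)) _; rewrite ler_nat.
rewrite ler_pdivrMr// in sR.
have x0 : 0 < s.+1%:R :> R by rewrite ltr0n.
have sN : (n - s.+1 ^ 2)%:R <= 2 * s.+1%:R :> R.
  have E : (s.+2 ^ 2 = s.+1 ^ 2 + (2 * s.+1).+1)%N by rewrite -!mulnn; ring.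
  by rewrite -natrM ler_nat leq_subLR -ltnS -addnS -E.
have nx : s.+1%:R ^+ 2 <= n%:R :> R by rewrite -natrX ler_nat.
rewrite -[deviation _ _ _ n w](subrK (deviation A p b (s.+1 ^ 2) w)).
apply: le_trans (ler_normD _ _) _.
rewrite natrX in d1.
have : q.+1%:R^-1 * s.+1%:R ^+ 2 <= e / 2 * n%:R by rewrite ler_pM ?sqr_ge0.
have : M * (n - s.+1 ^ 2)%:R <= M * (2 * s.+1%:R) by rewrite ler_wpM2l.
have : s.+1%:R * (6 * M) <= s.+1%:R * (s.+1%:R * e) by rewrite ler_wpM2l// ltW.
have : e * s.+1%:R ^+ 2 <= e * n%:R by rewrite ler_wpM2l// ltW.
have : 0 <= e * n%:R by rewrite mulr_ge0// ltW.
move: d1 d2; clear; rewrite expr2; move: (_ ^-1) => v; lra.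
Qed.

End LargeNumbers.
End Likely.

(** * Averages of test functions over the sample *)

Section Averages.
Context {R : realType} {d : measure_display} {Omega : measurableType d}.
Variable P : probability Omega R.
Variables (p : R) (A : nat -> set Omega).
Hypotheses (p01 : 0 < p < 1).
Hypotheses (mA : forall n, measurable (A n)) (pA : forall n, P (A n) = p%:E).
Hypothesis iA : mutually_independent P A.

(** About as many indices as are needed, on average, for k inclusions. *)
Definition horizon (k : nat) : nat := Num.truncn (k%:R / p).

Lemma truncn_div_unbounded m : exists k0, forall k, (k0 <= k)%N -> (m <= horizon k)%N.
Proof.
have [p0 p1] := andP p01; exists m => k mk; apply: leq_trans mk _.
by rewrite truncn_ge_nat ?divr_ge0 ?(ltW p0)// ler_pdivlMr// ler_piMr// ltW.
Qed.

Lemma sample_sum_le (F : nat -> R) (M I e : R) k w : 0 < e -> (forall n, `|F n| <= M) -> `|I| <= M ->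
  let e' := e * p / (2 * (M + 2)) in
  `|deviation A p (fun=> 1) (horizon k) w| <= e' * (horizon k)%:R ->
  `|deviation A p F (horizon k) w| <= e' * (horizon k)%:R ->
  `|\sum_(i < horizon k) F i - (horizon k)%:R * I| <= e' * (horizon k)%:R ->
  4 * M / e <= k%:R ->
  `|\sum_(j < k) F (included_index A w j) - k%:R * I| <= e * k%:R.
Proof.
move=> e0 FM IM e' d1 dF dI kM; have [p0 p1] := andP p01.
have M0 : 0 <= M := le_trans (normr_ge0 _) IM.
apply: le_trans (sample_sum p01 FM IM d1 dF dI) _.
have M2 : 0 < M + 2 by rewrite ltr_wpDl.
have Nk : (horizon k)%:R * p <= k%:R.
  have /andP[h _] := truncn_itv (divr_ge0 (ler0n R k) (ltW p0)).
  by rewrite -ler_pdivlMr.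
rewrite ler_pdivrMr// in kM.
have -> : e' * (horizon k)%:R * (M + 2) = e * ((horizon k)%:R * p) / 2 by rewrite /e'; field; rewrite gt_eqF.
have : e * ((horizon k)%:R * p) <= e * k%:R by rewrite ler_wpM2l// ltW.
by move: kM; lra.
Qed.

Lemma likely_average (F : nat -> R) (M I e : R) : 0 < e -> (forall n, `|F n| <= M) -> `|I| <= M ->
  (forall e : R, 0 < e -> exists n0, forall n, (n0 <= n)%N -> `|\sum_(i < n) F i - n%:R * I| <= e * n%:R) ->
  likely P (fun k => [set w | `|\sum_(j < k) F (included_index A w j) - k%:R * I| <= e * k%:R]).
Proof.
move=> e0 FM IM avg; have [p0 p1] := andP p01.
have M0 : 0 <= M := le_trans (normr_ge0 _) IM.
pose e' := e * p / (2 * (M + 2)).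
have e'0 : 0 < e' by rewrite divr_gt0 ?mulr_gt0// ltr_wpDl.
have [n0 Hn] := avg _ e'0; have [k0 Hk] := truncn_div_unbounded n0.
pose k1 := (Num.truncn (4 * M / e)).+1.
have b1 : forall i : nat, `|(fun=> 1 : R) i| <= 1 by move=> i; rewrite normr1.
have l1 := likely_deviation p01 mA pA iA e'0 b1 truncn_div_unbounded.
have l2 := likely_deviation p01 mA pA iA e'0 FM truncn_div_unbounded.
apply: (likelyS (k0 := maxn k0 k1) _ (likelyI l1 l2)) => k.
rewrite geq_max => /andP[h0 h1] w [d1 d2].
apply: (sample_sum_le e0 FM IM) => //; first exact: Hn (Hk _ h0).
by apply: ltW; apply: lt_le_trans (truncnS_gt _) _; rewrite ler_nat.
Qed.

Section Cells.
Variables (m L : nat).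
Let v : R := m.+1%:R^-1.
Implicit Types (x : R[i]) (t : R).

Definition cell_index t : nat := Num.truncn (m.+1%:R * (t + L%:R)).
(** [Num.truncn] sends negative numbers to 0, hence the explicit lower bounds on both
    coordinates. *)
Definition in_cell (i j : nat) x : bool :=
  [&& - L%:R <= complex.Re x, - L%:R <= complex.Im x,
      cell_index (complex.Re x) == i & cell_index (complex.Im x) == j].
Definition cell_corner (i j : nat) : R[i] := Complex (i%:R * v - L%:R) (j%:R * v - L%:R).
(** The one extra row and column in [K] are for points with a coordinate equal to L. *)
Definition step (f : R[i] -> R) x : R :=
  let K := (2 * L * m.+1).+1 in
  \sum_(i < K) \sum_(j < K) f (cell_corner i j) * (in_cell i j x)%:R.

Lemma cell_index_near t : - L%:R <= t -> `|t - ((cell_index t)%:R * v - L%:R)| <= v.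
Proof.
move=> Lt; have v0 : 0 < m.+1%:R :> R by rewrite ltr0n.
have t0 : 0 <= m.+1%:R * (t + L%:R) by rewrite mulr_ge0//; lra.
have /andP[h1 h2] := truncn_itv t0; rewrite -/(cell_index t) in h1 h2.
have vv : m.+1%:R * v = 1 by rewrite mulfV// gt_eqF.
have V0 : 0 < v by rewrite invr_gt0.
have E : (m.+1%:R * (t + L%:R)) * v = t + L%:R by rewrite mulrAC vv mul1r.
have : (cell_index t)%:R * v <= t + L%:R by rewrite -E ler_wpM2r// ltW.
have : t + L%:R < (cell_index t).+1%:R * v by rewrite -E ltr_pM2r.
rewrite -natr1 mulrDl mul1r ler_norml => a1 a2; apply/andP; split; lra.
Qed.

Lemma cell_index_lt t : t <= L%:R -> (cell_index t < (2 * L * m.+1).+1)%N.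
Proof.
move=> tL; rewrite ltnS truncn_le_nat; apply: le_lt_trans (_ : (2 * L * m.+1)%:R < _).
  by rewrite !natrM mulrC ler_wpM2r//; lra.
by rewrite ltr_nat.
Qed.

Lemma step_near f (B e : R) : (forall x, B < normc x -> f x = 0) -> B <= L%:R ->
  (forall x y, normc (x - y) <= 2 * v -> `|f x - f y| <= e) ->
  forall x, `|f x - step f x| <= e.
Proof.
move=> fB BL fe x; have e0 : 0 <= e.
  by apply: le_trans (fe 0 0 _); rewrite ?normr_ge0// subrr normc0 mulr_ge0// invr_ge0.
pose i0 := cell_index (complex.Re x); pose j0 := cell_index (complex.Im x).
pose K := (2 * L * m.+1).+1.
have -> : step f x = if [&& - L%:R <= complex.Re x, - L%:R <= complex.Im x, (i0 < K)%N & (j0 < K)%N]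
    then f (cell_corner i0 j0) else 0.
  rewrite /step -/K; case: ifPn => [/and4P[h1 h2 h3 h4]|h].
    rewrite (bigD1 (Ordinal h3))//= (bigD1 (Ordinal h4))//= /in_cell h1 h2 !eqxx mulr1.
    rewrite [X in _ + X + _]big1 ?[X in _ + X]big1 ?addr0// => [i /negbTE ii|j /negbTE ij].
      apply: big1 => j _; suff -> : (cell_index (complex.Re x) == i) = false by rewrite mulr0.
      by rewrite eq_sym; exact: ii.
    suff -> : (cell_index (complex.Im x) == j) = false by rewrite mulr0.
    by rewrite eq_sym; exact: ij.
  rewrite big1// => i _; apply: big1 => j _; rewrite /in_cell.
  case: and4P => [[h1 h2 /eqP h3 /eqP h4]|_]; last by rewrite mulr0.
  by move: h; rewrite h1 h2 /i0 h3 /j0 h4 !ltn_ord.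
case: ifPn => [/and4P[h1 h2 _ _]|h].
  apply: fe; apply: le_trans (normc_le_ReIm _) _.
  rewrite [leRHS]mulrDl mul1r.
  apply: (le_trans _ (lerD (cell_index_near h1) (cell_index_near h2))).
  by rewrite (raddfB (@complex.Re R : {additive _ -> _})) (raddfB (@complex.Im R : {additive _ -> _})).
rewrite subr0 fB ?normr0//; apply: le_lt_trans BL _; rewrite ltNge; apply/negP => xL.
move/negP: h; apply.
have := le_trans (normc_Re x) xL; have := le_trans (normc_Im x) xL.
rewrite !ler_norml => /andP[-> h1] /andP[-> h2] /=.
by rewrite !cell_index_lt.
Qed.

End Cells.

(** The exceptional null set is fixed here, for countably many cells, before any test function is
    chosen; one null set thus serves all of them. *)
Lemma ae_cell_deviation (z : nat -> R[i]) : {ae P, forall w, forall m L i j (e : R), 0 < e ->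
  exists n0, forall n, (n0 <= n)%N ->
    `|deviation A p (fun l => (in_cell m L i j (z l))%:R) n w| <= e * n%:R}.
Proof.
do 4! apply: ae_foralln => ?.
apply: (@ae_deviation _ _ _ P p A p01 mA pA iA _ 1) => l.
by case: (in_cell _ _ _ _ _); rewrite ?normr1 ?normr0.
Qed.

(** The strong law for b at the single outcome w. It survives linear combinations and uniform
    limits, which carries it from cells to test functions at the same w. *)
Definition slow (b : nat -> R) w : Prop := forall e : R, 0 < e ->
  exists n0, forall n, (n0 <= n)%N -> `|deviation A p b n w| <= e * n%:R.

Lemma slowD b b' w : slow b w -> slow b' w -> slow (fun i => b i + b' i) w.
Proof.
move=> sb sb' e e0; have e2 : 0 < e / 2 by rewrite divr_gt0.
have [n0 H] := sb _ e2; have [n1 H1] := sb' _ e2; exists (maxn n0 n1) => n.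
rewrite geq_max => /andP[/H h /H1 h1].
have -> : deviation A p (fun i => b i + b' i) n w = deviation A p b n w + deviation A p b' n w.
  by rewrite -big_split; apply: eq_bigr => i _; rewrite mulrDl.
by apply: le_trans (ler_normD _ _) _; move: h h1; lra.
Qed.

Lemma slowZ c b w : slow b w -> slow (fun i => c * b i) w.
Proof.
move=> sb e e0; have c0 : 0 < `|c| + 1 by rewrite ltr_wpDl.
have [n0 H] := sb _ (divr_gt0 e0 c0); exists n0 => n /H h.
have -> : deviation A p (fun i => c * b i) n w = c * deviation A p b n w.
  by rewrite mulr_sumr; apply: eq_bigr => i _; rewrite mulrA.
rewrite normrM; apply: le_trans (_ : (`|c| + 1) * `|deviation A p b n w| <= _).
  by rewrite ler_wpM2r// lerDl.
by rewrite -ler_pdivlMl// mulrA [_^-1 * _]mulrC.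
Qed.

Lemma slow_sum n (b : 'I_n -> nat -> R) w : (forall i, slow (b i) w) ->
  slow (fun l => \sum_(i < n) b i l) w.
Proof.
move=> sb; elim: n b sb => [|n IH] b sb.
  move=> e e0; exists 0%N => m _; rewrite /deviation big1 ?normr0 => [|i _].
    by rewrite mulr_ge0// ltW.
  by rewrite big_ord0 mul0r.
under eq_fun do rewrite big_ord_recl.
by apply: slowD => //; apply: IH => i.
Qed.

Lemma slow_approx (b : nat -> R) w : (forall e : R, 0 < e -> exists2 b', slow b' w &
  forall i, `|b i - b' i| <= e) -> slow b w.
Proof.
move=> H e e0; have e2 : 0 < e / 2 by rewrite divr_gt0.
have [b' sb' bb'] := H _ e2; have [n0 Hn] := sb' _ e2; exists n0 => n /Hn h.
have := deviation_dist A p01 w (leq0n n) bb'.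
rewrite {2}/deviation big_ord0 subr0 subn0 => h'.
have -> : deviation A p b n w = deviation A p b' n w + deviation A p (fun i => b i - b' i) n w.
  by rewrite -big_split; apply: eq_bigr => i _ /=; ring.
by apply: le_trans (ler_normD _ _) _; move: h h'; lra.
Qed.

Lemma ae_sample_average (mu : probability R[i] R) (z : nat -> R[i]) : distributed mu z ->
  {ae P, forall w, forall f, test_function f -> forall e : R, 0 < e ->
    exists k0, forall k, (k0 <= k)%N ->
    `|\sum_(j < k) f (z (included_index A w j)) - k%:R * (\int[mu]_x f x)%R| <= e * k%:R}.
Proof.
move=> muz; have [p0 p1] := andP p01.
have b1 : forall i : nat, `|(fun=> 1 : R) i| <= 1 by move=> i; rewrite normr1.
have := ae_deviation p01 mA pA iA b1; apply: filterS2 (ae_cell_deviation z).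
move=> w Hcell H1 f tf e e0.
have [B HB] := test_bounded_support tf; have [Mf HM] := test_bounded tf.
have sf : slow (f \o z) w.
  apply: slow_approx => c c0.
  have [dd dd0 Hd] := test_unif_continuous tf c0.
  pose m := Num.truncn (2 / dd); pose L := (Num.truncn B).+1.
  have md : 2 * m.+1%:R^-1 < dd.
    by rewrite ltr_pdivrMr ?ltr0n// mulrC -ltr_pdivrMr// truncnS_gt.
  exists (step m L f \o z); last first.
    move=> i /=; apply: (step_near HB); first exact/ltW/truncnS_gt.
    by move=> x y xy; apply/ltW/Hd; apply: le_lt_trans md.
  by apply: slow_sum => i; apply: slow_sum => j; apply: slowZ; exact: Hcell.
pose M := Num.max Mf `|(\int[mu]_x f x)%R|.
have FM n : `|(f \o z) n| <= M by rewrite /M le_max HM.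
have IM : `|(\int[mu]_x f x)%R| <= M by rewrite /M le_max lexx orbT.
have M0 : 0 <= M := le_trans (normr_ge0 _) IM.
pose e' := e * p / (2 * (M + 2)).
have e'0 : 0 < e' by rewrite divr_gt0 ?mulr_gt0// ltr_wpDl.
have [n1 h1] := H1 _ e'0; have [n2 h2] := sf _ e'0.
have [n3 h3] := distributed_average muz tf e'0.
have [k0 Hk] := truncn_div_unbounded (maxn (maxn n1 n2) (maxn n3 1)).
exists (maxn k0 (Num.truncn (4 * M / e)).+1) => k.
rewrite geq_max => /andP[/Hk + k1]; rewrite !geq_max => /andP[/andP[hn1 hn2] /andP[hn3 hn0]].
apply: (sample_sum_le (F := f \o z) e0 FM IM); [exact: h1|exact: h2|exact: h3|].
by apply: ltW; apply: lt_le_trans (truncnS_gt _) _; rewrite ler_nat.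
Qed.

End Averages.

(** * Lower bounds for the logarithmic derivative *)

Lemma infinitely_often_enum (Q : nat -> Prop) : (forall n0, exists2 n, (n0 <= n)%N & Q n) ->
  exists u : nat -> nat, injective u /\ forall l, Q (u l).
Proof.
move=> H; have /choice[f fP] (n0 : nat) : exists n, (n0 <= n)%N /\ Q n.
  by have [n h1 h2] := H n0; exists n.
pose u l := iter l (fun n => f n.+1) (f 0%N).
have uS l : (u l < u l.+1)%N by exact: (fP _).1.
exists u; split; last by case=> [|l]; exact: (fP _).2.
have mono a b : (a < b)%N -> (u a < u b)%N by exact: (homo_ltn ltn_trans uS).
by move=> a b E; have [/mono|/mono|//] := ltngtP a b; rewrite E ltnn.
Qed.

(** The gap is |y - x| / (|a - y| |a - x|). It is bounded below uniformly in y, however distant,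
    because |y - x| and |a - y| grow together. *)
Lemma inverse_gap (R : realType) (a x y c : R[i]) (r D : R) : 0 < r -> normc (a - c) <= D ->
  a != x -> normc (x - c) <= r / 4 -> r <= normc (y - c) ->
  r / 2 / (D + r) ^+ 2 <= normc ((a - y)^-1 - (a - x)^-1).
Proof.
move=> r0 aD ax xc yc; have D0 : 0 <= D := le_trans (normc_ge0 _) aD.
have Dr : 0 < D + r by lra.
have ax0 : 0 < normc (a - x) by rewrite normc_gt0 subr_eq0.
have axD : normc (a - x) <= D + r.
  by apply: le_trans (normc_triangle c _ _) _; rewrite [normc (c - x)]normc_distC; lra.
have iax : (D + r)^-1 <= normc (a - x)^-1 by rewrite normcV lef_pV2 ?posrE.
(* If a = y, the inverse of 0 is 0 and the gap is 1 / |a - x|. *)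
have [ay|ay] := eqVneq a y.
  rewrite ay subrr invr0 sub0r normcN -ay; apply: le_trans iax.
  rewrite expr2 invfM mulrA ler_piMl ?invr_ge0 ?(ltW Dr)// ler_pdivrMr//; lra.
have ay0 : 0 < normc (a - y) by rewrite normc_gt0 subr_eq0.
have -> : (a - y)^-1 - (a - x)^-1 = (y - x) * (a - y)^-1 * (a - x)^-1.
  by field; rewrite !subr_eq0 ax ay.
rewrite !normcM expr2 invfM mulrA ler_pM ?invr_ge0 ?(ltW Dr)//.
  by rewrite divr_ge0 ?(ltW Dr)//; lra.
rewrite normcV ler_pdivrMr// mulrAC ler_pdivlMr//.
have : normc (a - y) <= D + normc (y - c).
  by apply: le_trans (normc_triangle c _ _) _; rewrite [normc (c - y)]normc_distC; lra.
have : normc (y - c) <= normc (y - x) + normc (x - c) by exact: normc_triangle.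
move: (normc (y - c)) (normc (y - x)) (normc (a - y)) (normc (x - c)) yc xc => T t s u yc xc h1 h2.
have h3 : r / 2 * s <= r / 2 * (D + T) by rewrite ler_wpM2l//; lra.
have h4 : 3 / 4 * T * (D + r) <= t * (D + r) by rewrite ler_wpM2r ?(ltW Dr)//; lra.
have h5 : r * D <= T * D by rewrite ler_wpM2r.
have : 0 <= T * D by rewrite mulr_ge0//; lra.
have : 0 <= T * r by rewrite mulr_ge0//; lra.
by move: h3 h4 h5; clear; lra.
Qed.

Section LogDerivative.
Context {R : realType} {d : measure_display} {Omega : measurableType d}.
Variable P : probability Omega R.
Variables (p : R) (A : nat -> set Omega) (z : nat -> R[i]).
Hypotheses (p01 : 0 < p < 1).
Hypotheses (mA : forall n, measurable (A n)) (pA : forall n, P (A n) = p%:E).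
Hypothesis iA : mutually_independent P A.

(** Selecting terms by counting below N keeps this a function of [pattern]; it is the logarithmic
    derivative of the sample once k inclusions occur below N. *)
Definition first_logder N k (a : R[i]) w : R[i] :=
  \sum_(n < N | (w \in A n) && (included_below A w n < k)%N) (a - z n)^-1.

Lemma first_logderE N k a w : (k <= included_below A w N)%N ->
  first_logder N k a w = logder (sample z A w k) a.
Proof.
move=> kN; rewrite /first_logder (sum_first_included A w k N (fun n => (a - z n)^-1)) (minn_idPr kN).
by rewrite /logder /sample big_map -[X in iota 0 X]subn0 big_mkord.
Qed.

Definition pattern_logder N k (a : R[i]) (x : {ffun 'I_N -> bool}) : R[i] :=
  \sum_(n < N | x n && (below x n < k)%N) (a - z n)^-1.

Lemma pattern_logderE N k a w : pattern_logder k a (pattern N A w) = first_logder N k a w.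
Proof. by apply: eq_bigl => n; rewrite ffunE below_pattern// ltnW. Qed.

Lemma measurable_first_logder N k a (t : R) :
  measurable [set w | normc (first_logder N k a w) < t].
Proof.
have -> : [set w | normc (first_logder N k a w) < t] =
    [set w | [set x | normc (pattern_logder k a x) < t] (pattern N A w)].
  by apply/seteqP; split=> w /=; rewrite pattern_logderE.
exact: measurable_pattern.
Qed.

Lemma Re_first_logder N k a w : complex.Re (first_logder N k a w) =
  included_sum A N k (fun n => complex.Re (a - z n)^-1) w.
Proof.
rewrite /first_logder (raddf_sum (@complex.Re R : {additive _ -> _})) big_mkcond.
by apply: eq_bigr => n _; case: (_ && _); rewrite ?mul1r ?mul0r.
Qed.

Lemma Im_first_logder N k a w : complex.Im (first_logder N k a w) =
  included_sum A N k (fun n => complex.Im (a - z n)^-1) w.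
Proof.
rewrite /first_logder (raddf_sum (@complex.Im R : {additive _ -> _})) big_mkcond.
by apply: eq_bigr => n _; case: (_ && _); rewrite ?mul1r ?mul0r.
Qed.

(** Terms near c are paired with terms far from c. The radius dd depends on neither a nor k, so ln
    dd is negligible against k. *)
Lemma logder_likely_gap (c : R[i]) (Da h r : R) : 0 < h -> 0 < r ->
  (forall (r : R) n0, 0 < r -> exists2 n, (n0 <= n)%N & normc (z n - c) < r) ->
  (forall n0, exists2 n, (n0 <= n)%N & r <= normc (z n - c)) ->
  forall e : R, 0 < e -> exists2 dd : R, 0 < dd <= 1 & exists k0, forall k N a, (k0 <= k <= N)%N ->
    normc (a - c) <= Da -> h <= normc (a - c) ->
    (P [set w | (normc (first_logder N k a w) < dd)%R] <= e%:E)%E.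
Proof.
move=> h0 r0 nearc farc e e0.
(* h / 2 keeps a, at distance at least h from c, off the near points; r / 4 is the condition of
   [inverse_gap]. *)
have r1 : 0 < Num.min (h / 2) (r / 4) by rewrite lt_min !divr_gt0.
have [ui [ui_inj uiP]] := infinitely_often_enum (fun n0 => nearc _ n0 r1).
have [uj [uj_inj ujP]] := infinitely_often_enum farc.
have uij l l' : ui l != uj l'.
  apply/eqP => E; have := uiP l; rewrite E lt_min => /andP[_]; have := ujP l'; lra.
have [M HM] := small_ball p01 mA pA iA e0.
pose D := Num.max 0 Da.
have D0 : 0 <= D by rewrite /D le_max lexx.
have DaD : Da <= D by rewrite /D le_max lexx orbT.
pose g := r / 2 / (D + r) ^+ 2.
have Dr : 0 < D + r by lra.
have g0 : 0 < g by rewrite divr_gt0 ?exprn_gt0// divr_gt0.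
exists (Num.min 1 (g / 4)); first by rewrite lt_min ltr01 divr_gt0//= ge_min lexx.
exists (\max_(l < 2 * M) maxn (ui l).+1 (uj l).+1)%N => k N a /andP[k0k kN] aD ha.
have lk l : (l < 2 * M)%N -> (ui l < k)%N /\ (uj l < k)%N.
  move=> lM; have := leq_trans (leq_bigmax (Ordinal lM)) k0k.
  by rewrite geq_max => /andP[].
pose X n : R[i] := (a - z n)^-1.
have gapX l : g <= normc (X (uj l) - X (ui l)).
  have := uiP l; rewrite lt_min => /andP[u1 /ltW u2].
  apply: (@inverse_gap R a (z (ui l)) (z (uj l)) c) => //.
  - exact: le_trans aD DaD.
  - by apply: contraTneq ha => ->; rewrite -ltNge; lra.
pose Tr := [pred l | g / 2 <= `|complex.Re (X (uj l)) - complex.Re (X (ui l))|].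
pose Ti := [pred l | g / 2 <= `|complex.Im (X (uj l)) - complex.Im (X (ui l))|].
have TrTi l : ~~ Tr l -> Ti l.
  rewrite /= -ltNge => h1; have := gapX l => /le_trans/(_ (normc_le_ReIm _)).
  rewrite (raddfB (@complex.Re R : {additive _ -> _})) (raddfB (@complex.Im R : {additive _ -> _})).
  by move: h1; lra.
(* Each of the 2 M pairs is g / 2 apart in its real or in its imaginary part, so M of them agree on
   the coordinate, and [small_ball] applies to that real-valued sum. *)
have main (T : pred nat) (Y : nat -> R) (S : Omega -> R) : (M <= count T (iota 0 (2 * M)))%N ->
    (forall l, T l -> g / 2 <= `|Y (uj l) - Y (ui l)|) ->
    (forall w, included_sum A N k Y w = S w) ->
    (forall w, `|S w| <= normc (first_logder N k a w)) ->
    (P [set w | (normc (first_logder N k a w) < Num.min 1 (g / 4))%R] <= e%:E)%E.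
  move=> MT TY YS Sle; pose s := seq.filter T (iota 0 (2 * M)).
  have sM : (M <= size s)%N by rewrite size_filter.
  have sP l : (l < M)%N -> nth 0%N s l \in s by move=> lM; rewrite mem_nth// (leq_trans lM).
  have s_inj : {in gtn M &, injective (nth 0%N s)}.
    move=> l l'; rewrite !inE => lM lM' /eqP; rewrite nth_uniq ?(leq_trans lM) ?(leq_trans lM')//.
      by move/eqP.
    by rewrite filter_uniq// iota_uniq.
  have sT l : (l < M)%N -> T (nth 0%N s l) /\ (nth 0%N s l < 2 * M)%N.
    by move=> /sP; rewrite mem_filter mem_iota add0n => /andP[].
  have g2 : 0 < g / 2 by rewrite divr_gt0.
  have := HM M N k Y (g / 2) (ui \o nth 0%N s) (uj \o nth 0%N s) (leqnn M) kN g2.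
  move=> /(_ (fun l l' hl hl' E => s_inj _ _ hl hl' (ui_inj _ _ E))).
  move=> /(_ (fun l l' hl hl' E => s_inj _ _ hl hl' (uj_inj _ _ E))).
  move=> /(_ (fun l l' _ _ => uij _ _)) /(_ (fun l lM => lk _ (sT l lM).2)).
  move=> /(_ (fun l lM => TY _ (sT l lM).1)); apply: le_trans; apply: le_measure.
  - by rewrite inE; exact: measurable_first_logder.
  - rewrite inE; have -> : [set w | `|included_sum A N k Y w| < g / 2 / 2] =
        [set w | [set x | `|first_sum k Y x| < g / 2 / 2] (pattern N A w)].
      by apply/seteqP; split=> w /=; rewrite first_sum_pattern.
    exact: measurable_pattern.
  - move=> w /=; rewrite lt_min => /andP[_ h1]; rewrite YS.
    apply: le_lt_trans (Sle w) _; lra.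
have [h1|h1] := leqP M (count Tr (iota 0 (2 * M))).
  apply: (main _ (fun n => complex.Re (X n)) (fun w => complex.Re (first_logder N k a w)) h1) => //.
    by move=> w; rewrite Re_first_logder.
  by move=> w; exact: normc_Re.
have h2 : (M <= count Ti (iota 0 (2 * M)))%N.
  have : (count (predC Tr) (iota 0 (2 * M)) <= count Ti (iota 0 (2 * M)))%N.
    by apply: sub_count => l; exact: TrTi.
  by have := count_predC Tr (iota 0 (2 * M)); rewrite size_iota; move: h1; clear; lia.
apply: (main _ (fun n => complex.Im (X n)) (fun w => complex.Im (first_logder N k a w)) h2) => //.
  by move=> w; rewrite Im_first_logder.
by move=> w; exact: normc_Im.
Qed.

End LogDerivative.

Section Convergent.
Context {R : realType} {d : measure_display} {Omega : measurableType d}.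
Variables (A : nat -> set Omega) (z : nat -> R[i]).

Lemma inverse_near (a x c : R[i]) : a != c -> normc (x - c) <= normc (a - c) / 4 ->
  normc ((a - x)^-1 - (a - c)^-1) <= (normc (a - c))^-1 / 3.
Proof.
move=> ac xc; have ac0 : 0 < normc (a - c) by rewrite normc_gt0 subr_eq0.
have h : 3 / 4 * normc (a - c) <= normc (a - x).
  by have := normc_triangle x a c; move: xc; lra.
have ax0 : 0 < normc (a - x) by lra.
have ax : a != x by rewrite -subr_eq0 -normc_gt0.
have -> : (a - x)^-1 - (a - c)^-1 = (x - c) * (a - x)^-1 * (a - c)^-1.
  by field; rewrite !subr_eq0 ac ax.
rewrite !normcM !normcV [leRHS]mulrC ler_pM2r ?invr_gt0// ler_pdivrMr//; lra.
Qed.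

(** From n0 on, each term is within a third of 1 / (a - c) of that number, so at least k - n0 terms
    add up with no more than a third lost. The first n0 indices contribute at most C. *)
Lemma first_logder_near (c a : R[i]) (Da h C : R) n0 N k w : 0 < h ->
  (forall n, (n0 <= n)%N -> normc (z n - c) < h / 4) ->
  h <= normc (a - c) <= Da ->
  \sum_(n < n0) (normc (a - z n))^-1 <= C ->
  (n0 <= k)%N -> (k <= included_below A w N)%N ->
  2 / 3 * (k - n0)%:R / Da - C <= normc (first_logder A z N k a w).
Proof.
move=> h0 zc /andP[ha aD] SC n0k kN.
have ac0 : 0 < normc (a - c) by exact: lt_le_trans ha.
have ac : a != c by rewrite -subr_eq0 -normc_gt0.
have NN : (n0 <= N)%N.
  apply: leq_trans n0k (leq_trans kN _); rewrite /included_below -[leqRHS]card_ord -sum1_card.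
  by apply: leq_sum => i _; exact: leq_b1.
pose cond (n : 'I_N) := (w \in A n) && (included_below A w n < k)%N.
pose cnt := (\sum_(n < N | cond n && ~~ (n < n0)%N) 1)%N.
have cntk : (k - n0 <= cnt)%N.
  have Ek : (\sum_(n < N | cond n) 1)%N = k.
    have := @sum_first_included _ _ nat A w k N (fun=> 1%N).
    by rewrite [X in _ = X -> _]sum1_card card_ord (minn_idPr kN).
  have : (\sum_(n < N | cond n && (n < n0)%N) 1 <= n0)%N.
    rewrite -[leqRHS]card_ord -sum1_card (big_ord_widen N (fun=> 1%N) NN).
    rewrite big_mkcond [leqRHS]big_mkcond; apply: leq_sum => i _.
    by case: (cond i) => //=; case: ifP.
  by move: Ek; rewrite (bigID (fun n : 'I_N => (n < n0)%N)) /= -/cnt; lia.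
rewrite /first_logder (bigID (fun n : 'I_N => (n < n0)%N)) /=.
set S1 := \sum_(n < N | _) _; set S2 := \sum_(n < N | _) _.
have S1C : normc S1 <= C.
  apply: le_trans SC; apply: le_trans (normc_sum _ _ _) _.
  rewrite (big_ord_widen N (fun n => (normc (a - z n))^-1) NN).
  rewrite big_mkcond [leRHS]big_mkcond; apply: ler_sum => n _.
  rewrite normcV; case: (n < n0)%N; rewrite ?andbT ?andbF//.
  by case: (_ && _); rewrite ?invr_ge0 ?normc_ge0.
have S2v : normc (S2 - (a - c)^-1 * cnt%:R) <= cnt%:R * ((normc (a - c))^-1 / 3).
  have -> : S2 - (a - c)^-1 * cnt%:R =
      \sum_(n < N | cond n && ~~ (n < n0)%N) ((a - z n)^-1 - (a - c)^-1).
    by rewrite sumrB /S2 /cnt natr_sum mulr_sumr; congr (_ - _); apply: eq_bigr => i _; rewrite mulr1.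
  apply: le_trans (normc_sum _ _ _) _; rewrite /cnt natr_sum mulr_suml.
  apply: ler_sum => n /andP[_]; rewrite -leqNgt mul1r => n0n; apply: inverse_near => //.
  by apply: ltW; apply: lt_le_trans (zc n n0n) _; rewrite ler_wpM2r.
have cR : (k - n0)%:R <= cnt%:R :> R by rewrite ler_nat.
have iD : Da^-1 <= (normc (a - c))^-1 by rewrite lef_pV2 ?posrE// (lt_le_trans ac0).
have key : 2 / 3 * (cnt%:R * (normc (a - c))^-1) <= normc S2.
  have := normcB_ge ((a - c)^-1 * cnt%:R) ((a - c)^-1 * cnt%:R - S2).
  rewrite subKr [normc (_ * _ - S2)]normc_distC normcM normcV normc_nat.
  by move: S2v; clear; lra.
have := normcB_ge S2 (- S1); rewrite opprK normcN addrC => h2; apply: le_trans h2.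
rewrite lerB//; apply: le_trans key.
by rewrite -mulrA ler_wpM2l// ler_pM// invr_ge0 (le_trans (ltW ac0)).
Qed.

End Convergent.

Section LogDerivativeBound.
Context {R : realType} {d : measure_display} {Omega : measurableType d}.
Variable P : probability Omega R.
Variables (p : R) (A : nat -> set Omega) (z : nat -> R[i]) (c : R[i]).
Hypotheses (p01 : 0 < p < 1).
Hypotheses (mA : forall n, measurable (A n)) (pA : forall n, P (A n) = p%:E).
Hypothesis iA : mutually_independent P A.
Hypothesis clc : forall (r : R) n0, 0 < r -> exists2 n, (n0 <= n)%N & normc (z n - c) < r.

(** The first condition restricts to outcomes on which N indices contain the whole sample. *)
Definition logder_small N k a (t : R) : set Omega :=
  [set w | (k <= included_below A w N)%N && (normc (first_logder A z N k a w) < t)].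

Definition pattern_small N k a (t : R) (x : {ffun 'I_N -> bool}) : bool :=
  (k <= below x N)%N && (normc (pattern_logder z k a x) < t).

Lemma pattern_smallE N k a t w :
  pattern_small k a t (pattern N A w) = (w \in logder_small N k a t).
Proof. by rewrite /pattern_small pattern_logderE below_pattern// /logder_small mem_setE. Qed.

Lemma measurable_logder_small N k a t : measurable (logder_small N k a t).
Proof.
have -> : logder_small N k a t = [set w | [set x | pattern_small k a t x] (pattern N A w)].
  by apply/seteqP; split=> w /=; rewrite pattern_smallE in_setE.
exact: measurable_pattern.
Qed.

(** The quantifier order matters: n0 comes before C, e and a, so that the grid shift can also be
    made to control the n0 terms for which a is not known to be far from z n. *)
Lemma logder_likely (Da h : R) : 0 < h -> exists n0, forall C e : R, 0 < e ->
  exists2 dd : R, 0 < dd <= 1 & exists k0, forall k N a, (k0 <= k <= N)%N ->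
    h <= normc (a - c) <= Da -> \sum_(n < n0) (normc (a - z n))^-1 <= C ->
    (P (logder_small N k a dd) <= e%:E)%E.
Proof.
move=> h0; case: (pselect (exists2 r : R, 0 < r & forall n0, exists2 n, (n0 <= n)%N & r <= normc (z n - c))).
  move=> [r r0 farc]; exists 0%N => C e e0.
  have [dd dd01 [k0 H]] := logder_likely_gap p01 mA pA iA Da h0 r0 clc farc e0.
  exists dd => //; exists k0 => k N a kN /andP[ha aD] _.
  apply: le_trans (H k N a kN aD ha); apply: le_measure; rewrite ?inE.
  - exact: measurable_logder_small.
  - exact: measurable_first_logder.
  - by move=> w /andP[].
move=> nfar; have [n0 Hn] : exists n0, forall n, (n0 <= n)%N -> normc (z n - c) < h / 4.
  apply: contrapT => /forallNP nn; apply: nfar; exists (h / 4); first by rewrite divr_gt0.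
  move=> n0; apply: contrapT => nf; apply: (nn n0) => n n0n; rewrite ltNge; apply/negP => hn.
  by apply: nf; exists n.
exists n0 => C e e0; exists 1; first by rewrite ltr01 lexx.
exists (n0 + (Num.truncn ((C + 1) * Da * 3 / 2)).+1)%N => k N a /andP[k0k kN] had SC.
suff -> : logder_small N k a 1 = set0 by rewrite measure0 lee_fin ltW.
apply/seteqP; split=> // w /andP[kw]; rewrite ltNge => /negP; apply.
have n0k : (n0 <= k)%N by apply: leq_trans k0k; rewrite leq_addr.
apply: le_trans (first_logder_near h0 Hn had SC n0k kw).
have Da0 : 0 < Da by case/andP: had => h1 h2; lra.
have : (C + 1) * Da * 3 / 2 <= (k - n0)%:R.
  by apply: le_trans (ltW (truncnS_gt _)) _; rewrite ler_nat leq_subRL.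
rewrite lerBrDr addrC ler_pdivlMr//; lra.
Qed.

End LogDerivativeBound.

(** * Choosing the shifted circle for a given sample *)

Section GridCircle.
Context {R : realType}.
Variables (m : nat) (w : R[i]) (c x0 : R[i]) (r h : R) (K : nat).
Hypotheses (m0 : (0 < m)%N) (pw : m.-primitive_root w) (r0 : 0 < r) (h0 : 0 < h) (K0 : (0 < K)%N).
Implicit Types (zs ys : seq R[i]) (g : 'I_K * 'I_K).

Definition circle_gap c' r' zs : R :=
  \sum_(y <- zeros (poly_of zs)^`()) logmax c' r' y - \sum_(y <- zs) logmax c' r' y.

Definition grid_point g i : R[i] := circle_point (c + shift h g) r w i.

Lemma normc_shift_le g : normc (shift h g) <= 2 * h.
Proof.
apply: le_trans (normc_le_ReIm _) _; rewrite mulrDl mul1r lerD//=.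
  rewrite ger0_norm ?mulr_ge0 ?divr_ge0 ?(ltW h0)// mulrAC ler_pdivrMr ?ltr0n//.
  by rewrite ler_wpM2l ?(ltW h0)// ler_nat ltnW.
rewrite ger0_norm ?mulr_ge0 ?divr_ge0 ?(ltW h0)// mulrAC ler_pdivrMr ?ltr0n//.
by rewrite ler_wpM2l ?(ltW h0)// ler_nat ltnW.
Qed.

Lemma circle_gap_center c1 c2 zs (t : R) : (0 < size zs)%N -> normc (c1 - c2) <= t ->
  `|circle_gap c1 r zs - circle_gap c2 r zs| <= (size zs)%:R * (2 * t / r).
Proof.
move=> s0 ct; have t0 : 0 <= t := le_trans (normc_ge0 _) ct.
have lip y : `|logmax c1 r y - logmax c2 r y| <= t / r.
  by apply: le_trans (logmax_lipschitz_center _ _ _ r0) _; rewrite ler_pM2r ?invr_gt0.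
have S ys : `|\sum_(y <- ys) logmax c1 r y - \sum_(y <- ys) logmax c2 r y| <= (size ys)%:R * (t / r).
  rewrite -sumrB; apply: le_trans (ler_norm_sum _ _ _) _.
  apply: le_trans (ler_sum _ (fun y _ => lip y)) _.
  by rewrite big_const_seq count_predT iter_addr_0 mulr_natl.
have S1 := S (zeros (poly_of zs)^`()); have S2 := S zs; rewrite size_zeros_deriv// in S1.
have : (size zs).-1%:R * (t / r) <= (size zs)%:R * (t / r).
  by rewrite ler_wpM2r ?divr_ge0 ?(ltW r0)// ler_nat leq_pred.
rewrite /circle_gap => S3.
have E (a b a' b' : R) : a - b - (a' - b') = (a - a') - (b - b') by ring.
rewrite E; apply: le_trans (ler_normB _ _) _.
by move: S1 S2 S3; lra.
Qed.

(** Distances from the m points of a shifted circle to ys become distances from the shift to these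
    translates, so one call of [shift_select] handles all m points. *)
Definition translates ys : seq R[i] := [seq y - c - real_complex R r * w ^+ (i : nat) | y <- ys, i : 'I_m <- enum 'I_m].

Lemma size_translates ys : size (translates ys) = (size ys * m)%N.
Proof. by rewrite /translates size_allpairs size_enum_ord. Qed.

Lemma grid_point_translate g i y : shift h g - (y - c - real_complex R r * w ^+ i) = grid_point g i - y.
Proof. by rewrite /grid_point /circle_point; ring. Qed.

Lemma sum_translates g ys :
  \sum_(b <- translates ys) (normc (shift h g - b))^-1 =
  \sum_(i < m) \sum_(y <- ys) (normc (grid_point g i - y))^-1.
Proof.
rewrite /translates big_allpairs_dep exchange_big /=.
rewrite big_enum /=; apply: eq_bigr => i _; apply: eq_bigr => y _.
by rewrite grid_point_translate.
Qed.

Lemma far_translates g ys (i : 'I_m) y : all (fun b => far h b g) (translates ys) -> y \in ys ->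
  h / K%:R <= normc (grid_point g i - y).
Proof.
move=> /allP H yys; rewrite -grid_point_translate; apply: far_dist => //; apply: H.
by apply/allpairsP; exists (y, i); rewrite /= mem_enum.
Qed.

(** Three lists are given to [shift_select]: the translates of zs bound [absder], those of ys bound
    the exceptional terms, and those of x0 keep each point h / (512 m) away from x0. Moving the
    centre by at most 2 h costs 4 h / r per zero, counting both sums. *)
Lemma circle_gap_le zs ys (D : pred ('I_K * 'I_K)) (s dd : R) :
  (0 < size zs)%N -> 0 < s -> s <= r -> 0 < dd <= 1 ->
  (32 * m * (size zs + size ys + 1) <= K)%N -> (8 * #|D| <= K ^ 2)%N ->
  (forall g, ~~ D g -> forall i : 'I_m, h / (512 * m%:R) <= normc (grid_point g i - x0) ->
     \sum_(y <- ys) (normc (grid_point g i - y))^-1 <= 512 / h * (size ys * m)%:R ->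
     dd <= normc (logder zs (grid_point g i))) ->
  `|circle_gap c r zs| <= (size zs)%:R * (4 * h / r) + (size zs)%:R / m%:R * ln (4 * r / s)
   + s * (512 / h) * (size zs)%:R + ln (size zs)%:R + ln (1 + (size zs)%:R * K%:R / h) - ln dd.
Proof.
move=> k0 s0 sr /andP[dd0 dd1] szK cD HD; set k := size zs in k0 szK *.
have mR : 0 < m%:R :> R by rewrite ltr0n.
have KR : 0 < K%:R :> R by rewrite ltr0n.
have szK' : (32 * (size (translates zs) + size (translates ys) + size (translates [:: x0])) <= K)%N.
  by rewrite !size_translates -!mulnDl mulnA mulnAC.
have [g [gD gfar gsum]] := shift_select h0 K0 szK' cD.
move: gfar; rewrite 2!all_cat => /and3P[far1 far2 far3].
have sum1 := gsum _ (mem_head _ _).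
have sum2 : \sum_(b <- translates ys) (normc (shift h g - b))^-1 <= 512 / h * (size ys * m)%:R.
  by rewrite -size_translates; apply: gsum; rewrite !inE eqxx orbT.
have sum3 : \sum_(b <- translates [:: x0]) (normc (shift h g - b))^-1 <= 512 / h * m%:R.
  have -> : m = size (translates [:: x0]) by rewrite size_translates mul1n.
  by apply: gsum; rewrite !inE eqxx !orbT.
rewrite sum_translates size_translates in sum1; rewrite !sum_translates in sum2 sum3.
have pt ys' (i : 'I_m) C : \sum_(i < m) \sum_(y <- ys') (normc (grid_point g i - y))^-1 <= C ->
    \sum_(y <- ys') (normc (grid_point g i - y))^-1 <= C.
  rewrite (bigD1 i)//=; apply: le_trans; rewrite lerDl.
  by apply: sumr_ge0 => j _; apply: sumr_ge0 => y _; rewrite invr_ge0 normc_ge0.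
have logd (i : 'I_m) : dd <= normc (logder zs (grid_point g i)).
  apply: HD => //; last exact: pt sum2.
  have := pt _ i _ sum3; rewrite big_seq1 => h3.
  have x0f : 0 < normc (grid_point g i - x0).
    apply: lt_le_trans (far_translates i far3 (mem_head _ _)); exact: divr_gt0.
  have E : h / (512 * m%:R) = (512 / h * m%:R)^-1 by rewrite [RHS]invfM invf_div invfM mulrA.
  have inv_le (a b : R) : 0 < a -> a^-1 <= b -> b^-1 <= a.
    move=> a0 ab; rewrite -[leRHS]invrK lef_pV2 ?posrE ?invr_gt0//.
    by apply: lt_le_trans ab; rewrite invr_gt0.
  by rewrite E; exact: inv_le.
have zsf (i : 'I_m) y : y \in zs -> h / K%:R <= normc (grid_point g i - y).
  exact: far_translates.
have B1 : 1 <= 1 + k%:R * K%:R / h :> R by rewrite lerDl mulr_ge0 ?invr_ge0 ?(ltW h0).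
have := @critical_circle R m w (c + shift h g) r m0 pw r0 zs s dd _ k0 s0 sr dd0 dd1 B1.
move=> /(_ _ logd) H.
have {}H : `|circle_gap (c + shift h g) r zs| <= k%:R / m%:R * ln (4 * r / s)
   + s / m%:R * \sum_(i < m) absder zs (grid_point g i) + ln k%:R + ln (1 + k%:R * K%:R / h) - ln dd.
  apply: H => i.
    apply/negP => /(zsf i); rewrite subrr normc0 leNgt divr_gt0//.
  apply: le_trans (_ : \sum_(y <- zs) (K%:R / h) <= _).
    rewrite /absder big_seq [leRHS]big_seq; apply: ler_sum => y /zsf-/(_ i) h1.
    rewrite -[leRHS]invrK invf_div lef_pV2 ?posrE ?divr_gt0//.
    by apply: lt_le_trans h1; rewrite divr_gt0.
  by rewrite big_const_seq count_predT iter_addr_0 -[leLHS]mulr_natl mulrA lerDr.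
have A1 : s / m%:R * \sum_(i < m) absder zs (grid_point g i) <= s * (512 / h) * k%:R.
  apply: le_trans (ler_wpM2l _ sum1) _; first by rewrite divr_ge0 ?ltW.
  rewrite natrM le_eqVlt; apply/orP; left; apply/eqP; field.
  by rewrite !gt_eqF.
have A2 : `|circle_gap c r zs - circle_gap (c + shift h g) r zs| <= k%:R * (2 * (2 * h) / r).
  apply: circle_gap_center => //.
  by rewrite opprD addrA subrr sub0r normcN normc_shift_le.
have := ler_normD (circle_gap c r zs - circle_gap (c + shift h g) r zs) (circle_gap (c + shift h g) r zs).
rewrite subrK.
have -> : k%:R * (4 * h / r) = k%:R * (2 * (2 * h) / r) :> R by congr (_ * (_ / r)); ring.
by move: H A1 A2; lra.
Qed.

End GridCircle.

(** * From a fixed shift to a shift depending on the sample *)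

Section LikelyCircle.
Context {R : realType} {d : measure_display} {Omega : measurableType d}.
Variable P : probability Omega R.
Variables (p : R) (A : nat -> set Omega) (z : nat -> R[i]) (x0 : R[i]).
Hypotheses (p01 : 0 < p < 1).
Hypotheses (mA : forall n, measurable (A n)) (pA : forall n, P (A n) = p%:E).
Hypothesis iA : mutually_independent P A.
Hypothesis clx : forall (r : R) n0, 0 < r -> exists2 n, (n0 <= n)%N & normc (z n - x0) < r.

(** The expected proportion of bad x is at most t, so it exceeds 1/8 with probability at most 8 t.
    Counting avoids a union bound over all shifts, whose number grows with k. *)
Lemma markov_count N (T : finType) (bad : T -> pred {ffun 'I_N -> bool}) (t : R) : 0 <= t ->
  (forall x, (P [set w | bad x (pattern N A w)] <= t%:E)%E) ->
  (P [set w | (#|T| < 8 * #|[pred x | bad x (pattern N A w)]|)%N] <= (8 * t)%:E)%E.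
Proof.
move=> t0 Hbad.
rewrite (prob_pattern P mA (fun y => (#|T| < 8 * #|[pred x | bad x y]|)%N)) lee_fin.
have [T0|T0] := posnP #|T|.
  rewrite big1 ?mulr_ge0// => y; rewrite T0 muln_gt0 /= => /card_gt0P[x _].
  by have := card0_eq T0 x; rewrite inE.
have TR : 0 < #|T|%:R :> R by rewrite ltr0n.
rewrite -(ler_pM2l TR); apply: le_trans (_ : \sum_y 8 * (law P A y * #|[pred x | bad x y]|%:R) <= _).
  rewrite mulr_sumr big_mkcond; apply: ler_sum => y _; case: ifPn => [h|_].
    have : #|T|%:R <= 8 * #|[pred x | bad x y]|%:R :> R by rewrite -natrM ler_nat ltnW.
    by move=> h'; rewrite mulrCA [leLHS]mulrC ler_wpM2l// law_ge0.
  by rewrite !mulr_ge0// law_ge0.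
rewrite -mulr_sumr mulrCA ler_wpM2l//.
have -> : \sum_y law P A y * #|[pred x | bad x y]|%:R = \sum_(x : T) \sum_(y | bad x y) law P A y.
  rewrite (exchange_big_dep xpredT)//=; apply: eq_bigr => y _.
  by rewrite -sum1_card natr_sum mulr_sumr; apply: eq_bigr => x _; rewrite mulr1.
rewrite -[#|T|]/#|{: T}| mulr_natl -sumr_const; apply: ler_sum => x _.
by rewrite -lee_fin -(prob_pattern P mA (bad x)).
Qed.

Lemma prob_exists N (I : finType) (b : I -> pred {ffun 'I_N -> bool}) (t : R) :
  (forall i, (P [set w | b i (pattern N A w)] <= t%:E)%E) ->
  (P [set w | [exists i, b i (pattern N A w)]] <= (#|I|%:R * t)%:E)%E.
Proof.
move=> Hb; rewrite (prob_pattern P mA (fun y => [exists i, b i y])) lee_fin.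
apply: le_trans (_ : \sum_(i : I) \sum_(y | b i y) law P A y <= _); last first.
  rewrite mulr_natl -sumr_const; apply: ler_sum => i _.
  by rewrite -lee_fin -(prob_pattern P mA (b i)).
rewrite (exchange_big_dep xpredT)//= big_mkcond; apply: ler_sum => y _.
case: ifPn => [/existsP[i bi]|_]; last by apply: sumr_ge0 => i _; exact: law_ge0.
by rewrite (bigD1 i)//= lerDl; apply: sumr_ge0 => j _; exact: law_ge0.
Qed.

Lemma exp_growth (C e : R) : 0 <= C -> 0 < e -> exists k0, forall k, (k0 <= k)%N ->
  C * k%:R ^+ 3 <= expR (e * k%:R).
Proof.
move=> C0 e0; exists (Num.truncn (24 * C / e ^+ 4)).+1 => k hk.
have kR : 0 <= e * k%:R by rewrite mulr_ge0// ltW.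
apply: le_trans (_ : (e * k%:R) ^+ 4 / (4`!)%:R <= _); last first.
  by apply: (le_trans _ (expR_ge1Dxn 3 kR)); rewrite lerDr.
have : 24 * C / e ^+ 4 <= k%:R.
  by apply: le_trans (ltW (truncnS_gt _)) _; rewrite ler_nat.
rewrite ler_pdivrMr ?exprn_gt0// => h.
rewrite ler_pdivlMr ?ltr0n ?fact_gt0// exprMn.
have -> : C * k%:R ^+ 3 * (4`!)%:R = (24 * C) * k%:R ^+ 3 by rewrite (_ : 4`! = 24)%N//; ring.
have -> : e ^+ 4 * k%:R ^+ 4 = k%:R * e ^+ 4 * k%:R ^+ 3 by ring.
by rewrite ler_wpM2r// exprn_ge0.
Qed.

(** Twice the expected length, so that a deviation of p / 2 per index still leaves k inclusions. *)
Definition long_horizon k : nat := (Num.truncn (2 * k%:R / p)).+1.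

Lemma long_horizon_ge k : (k <= long_horizon k)%N.
Proof.
have [p0 p1] := andP p01; rewrite -ltnS ltnS -(ler_nat R).
apply: le_trans (ltW (truncnS_gt _)); rewrite ler_pdivlMr//.
by rewrite mulrC ler_wpM2r//; lra.
Qed.

Lemma likely_enough : likely P (fun k => [set w | (k <= included_below A w (long_horizon k))%N]).
Proof.
have [p0 p1] := andP p01.
have b1 : forall i : nat, `|(fun=> 1 : R) i| <= 1 by move=> i; rewrite normr1.
have Noo m : exists k0, forall k, (k0 <= k)%N -> (m <= long_horizon k)%N.
  by exists m => k mk; exact: leq_trans mk (long_horizon_ge k).
have p20 : 0 < p / 2 by rewrite divr_gt0.
apply: (likelyS (k0 := 0%N) _ (likely_deviation p01 mA pA iA p20 b1 Noo)) => k _ w /=.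
have -> : deviation A p (fun=> 1) (long_horizon k) w =
    (included_below A w (long_horizon k))%:R - p * (long_horizon k)%:R.
  rewrite /deviation; under eq_bigr do rewrite mul1r.
  by rewrite sumrB sumr_const card_ord included_below_natr mulr_natr.
have : 2 * k%:R / p <= (long_horizon k)%:R by exact/ltW/truncnS_gt.
rewrite ler_pdivrMr// ler_norml -(ler_nat R) => h /andP[h1 _]; clear b1 Noo; lra.
Qed.

(** h, s and m are chosen in this order from e and r, each making one term of [circle_gap_le] at
    most e k / 4. Then n0 and dd are fixed independently of k, and K is linear in k, so the
    remaining terms are O(ln k). *)
Lemma likely_circle (c : R[i]) (r e : R) : 0 < r -> 0 < e ->
  likely P (fun k => [set w | `|circle_gap c r (sample z A w k)| <= e * k%:R]).
Proof.
have aux (n k : nat) : (0 < k)%N -> (k + n + 1 <= (n + 2) * k)%N.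
  by move=> k0; rewrite mulnDl; have := leq_pmulr n k0; lia.
move=> r0 e0.
have [q [q0 qE]] : exists q : R, 0 < q /\ q = 512 by exists 512; split; first exact: (ltr0Sn R 511).
have [h [h0 hr]] : exists h : R, 0 < h /\ 4 * h / r = e / 4.
  by exists (e * r / 16); split; [rewrite divr_gt0 ?mulr_gt0 | field; rewrite gt_eqF].
have [s [s0 sr sh]] : exists s : R, [/\ 0 < s, s <= r & s * (q / h) <= e / 4].
  exists (Num.min r (e * h / (4 * q))).
  split; [by rewrite lt_min r0 divr_gt0 ?mulr_gt0 | by rewrite ge_min lexx |].
  have hs : Num.min r (e * h / (4 * q)) <= e * h / (4 * q) by rewrite ge_min lexx orbT.
  apply: le_trans (ler_wpM2r (ltW (divr_gt0 q0 h0)) hs) _.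
  by rewrite le_eqVlt; apply/orP; left; apply/eqP; field; rewrite !gt_eqF.
have [m m0 lm] : exists2 m : nat, (0 < m)%N & ln (4 * r / s) / m%:R <= e / 4.
  exists (Num.truncn (4 * ln (4 * r / s) / e)).+1 => //.
  rewrite ler_pdivrMr//.
  have : 4 * ln (4 * r / s) / e <= (Num.truncn (4 * ln (4 * r / s) / e)).+1%:R by exact/ltW/truncnS_gt.
  by rewrite ler_pdivrMr//; lra.
have mR : 0 < m%:R :> R by rewrite ltr0n.
have [om pw] := @prim_root_complex R m m0.
(* The distance from x0 that [circle_gap_le] guarantees, with q = 512; [Da] bounds the distance from
   above. *)
pose eta := h / (q * m%:R).
have eta0 : 0 < eta by rewrite divr_gt0// mulr_gt0.
pose Da := normc (c - x0) + 2 * h + r.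
have [n0 Hn0] := logder_likely p01 mA pA iA clx Da eta0.
pose ys := mkseq z n0; pose C := q / h * (size ys * m)%:R.
move=> e1 e10.
(* The union over m points makes a shift bad with probability at most e1 / 16; the factor 8 of
   [markov_count] gives e1 / 2. *)
have e20 : 0 < e1 / (16 * m%:R) by rewrite divr_gt0// mulr_gt0.
have [dd /andP[dd0 dd1] [k0 Hk0]] := Hn0 C _ e20.
have e2 : 0 < e1 / 2 by rewrite divr_gt0.
have [k1 Hk1] := likely_enough e2.
pose K k := (32 * m * (k + n0 + 1))%N.
have e4 : 0 < e / 4 by rewrite divr_gt0.
(* The three logarithms combine to ln (k (1 + k K / h) / dd), and CC k^3 bounds its argument. *)
pose CC := (1 + 32 * m%:R * (n0%:R + 2) / h) / dd.
have CC0 : 0 <= CC.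
  by rewrite divr_ge0 ?(ltW dd0)// addr_ge0// divr_ge0 ?(ltW h0)// !mulr_ge0 ?addr_ge0// ltW.
have [k2 Hk2] := exp_growth CC0 e4.
exists (maxn (maxn k0 k1) (maxn k2 1)) => k.
rewrite !geq_max => /andP[/andP[kk0 kk1] /andP[kk2 k_gt0]].
have [B1 [mB1 PB1 HB1]] := Hk1 k kk1.
pose N := long_horizon k.
pose a g i := grid_point om c r h (K := K k) g i.
pose badi (g : 'I_(K k) * 'I_(K k)) (i : 'I_m) (x : {ffun 'I_N -> bool}) : bool :=
  [&& eta <= normc (a g i - x0), \sum_(y <- ys) (normc (a g i - y))^-1 <= C
    & pattern_small z k (a g i) dd x].
pose bad (g : 'I_(K k) * 'I_(K k)) (x : {ffun 'I_N -> bool}) : bool := [exists i, badi g i x].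
have K0 : (0 < K k)%N by rewrite /K !muln_gt0 m0 addn1.
have kR : 0 < k%:R :> R by rewrite ltr0n.
have KR : (K k)%:R <= 32 * m%:R * (n0%:R + 2) * k%:R :> R.
  have -> : 32 * m%:R * (n0%:R + 2) * k%:R = (32 * m * ((n0 + 2) * k))%:R :> R.
    by rewrite !natrM natrD !mulrA.
  by rewrite ler_nat leq_mul2l aux ?orbT.
have Pbad g : (P [set w | bad g (pattern N A w)] <= (e1 / 16)%:E)%E.
  have -> : e1 / 16 = #|'I_m|%:R * (e1 / (16 * m%:R)) by rewrite card_ord; field; rewrite gt_eqF.
  apply: (prob_exists (b := badi g)) => i.
  have [/andP[hi Ci]|ni] := boolP ((eta <= normc (a g i - x0)) && (\sum_(y <- ys) (normc (a g i - y))^-1 <= C)).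
    have -> : [set w | badi g i (pattern N A w)] = logder_small A z N k (a g i) dd.
      by apply/seteqP; split=> w; rewrite /= /badi hi Ci pattern_smallE in_setE.
    apply: Hk0; first by rewrite kk0 long_horizon_ge.
      rewrite hi /=; apply: le_trans (normc_triangle c _ _) _.
      rewrite addrC -[leRHS]addrA lerD// /a /grid_point /circle_point.
      have -> : c + shift h g + real_complex R r * om ^+ i - c = shift h g + real_complex R r * om ^+ i by ring.
      apply: le_trans (normcD _ _) _; rewrite lerD ?normc_shift_le//.
      by rewrite normcM normcR (normc_prim_root _ pw) mulr1 gtr0_norm.
    by move: Ci; rewrite /ys big_map -[X in iota 0 X]subn0 big_mkord.
  rewrite (_ : [set w | _] = set0) ?measure0 ?lee_fin ?(ltW e20)//.
  by apply/seteqP; split=> // w /=; rewrite /badi => /and3P[h1 h2 _]; move: ni; rewrite h1 h2.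
have PB2 := markov_count (ltW (divr_gt0 e10 (ltr0n _ 16))) Pbad.
set B2 := [set w | _] in PB2.
have mB2 : measurable B2 by exact: (measurable_pattern mA [set y | (#|{: 'I_(K k) * 'I_(K k)}| < 8 * #|[pred x | bad x y]|)%N]).
exists (B1 `|` B2); split; first exact: measurableU.
  apply: le_trans (measureU2 _ mB1 mB2) _.
  rewrite [leRHS](_ : _ = (e1 / 2)%:E + (8 * (e1 / 16))%:E)%E ?leeD//.
  by rewrite -EFinD; congr EFin; lra.
move=> w; rewrite setCU => -[/HB1 /= kw /= /negP]; rewrite -leqNgt => nB2.
have szs : size (sample z A w k) = k by rewrite size_sample.
have := @circle_gap_le R m om c x0 r h (K k) m0 pw r0 h0 K0 (sample z A w k) ys
   [pred g | bad g (pattern N A w)] s dd.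
rewrite szs -qE => /(_ k_gt0 s0 sr) H; apply: le_trans (H _ _ _ _) _.
- by rewrite dd0.
- by rewrite size_mkseq.
- by move: nB2; rewrite card_prod card_ord mulnn.
- move=> g ng i hi Ci; move: ng; rewrite /= negb_exists => /forallP/(_ i).
  rewrite [in X in _ -> X]leNgt; apply: contra => hd.
  rewrite /badi hi Ci /= pattern_smallE in_setE; apply/andP; split; first exact: kw.
  by rewrite first_logderE.
rewrite hr -[_ / m%:R * _]mulrA [m%:R^-1 * _]mulrC.
have L : ln k%:R + ln (1 + k%:R * (K k)%:R / h) - ln dd <= e / 4 * k%:R.
  have B0 : 0 < 1 + k%:R * (K k)%:R / h by rewrite ltr_pwDl// divr_ge0 ?(ltW h0)// mulr_ge0.
  rewrite -lnM ?posrE// -ln_div ?posrE ?mulr_gt0// -[leRHS]expRK.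
  rewrite ler_ln ?posrE ?expR_gt0 ?divr_gt0 ?mulr_gt0//.
  apply: (le_trans _ (Hk2 k kk2)); rewrite /CC [leRHS]mulrAC ler_pM2r ?invr_gt0//.
  rewrite exprS mulrCA ler_wpM2l// ?(ltW kR)//.
  have k1R : 1 <= k%:R :> R by rewrite ler1n.
  rewrite mulrDl mul1r lerD//; first by rewrite expr_ge1.
  rewrite [leRHS]mulrAC ler_wpM2r ?invr_ge0 ?(ltW h0)//.
  by rewrite expr2 mulrA [leRHS]mulrC ler_wpM2l.
have := ler_wpM2l (ltW kR) lm; have := ler_wpM2r (ltW kR) sh.
by move: L; lra.
Qed.

End LikelyCircle.

(** * Measurability and the weak topology *)

Section Measurability.
Context {R : realType} {d : measure_display} {Omega : measurableType d}.
Variable A : nat -> set Omega.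
Hypothesis mA : forall n, measurable (A n).

Lemma measurable_nth_included j n :
  measurable [set w | A n w /\ included_below A w n = j].
Proof.
have -> : [set w | A n w /\ included_below A w n = j] = A n `&`
    [set w | [set x : {ffun 'I_n -> bool} | below x n = j] (pattern n A w)].
  by apply/seteqP; split=> w [h1]; rewrite /= below_pattern.
by apply: measurableI => //; exact: measurable_pattern.
Qed.

Lemma measurable_included_index j n : measurable [set w | included_index A w j = n].
Proof.
pose S w := [set n | A n w /\ included_below A w n = j].
(* The outcomes with at most j inclusions, on which the index is 0 by default. *)
pose none := ~` \bigcup_n [set w | S w n].
have mnone : measurable none.
  by apply: measurableC; apply: bigcup_measurable => i _; exact: measurable_nth_included.
have -> : [set w | included_index A w j = n] =
    [set w | A n w /\ included_below A w n = j] `|` (none `&` [set w | n = 0%N]).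
  apply/seteqP; split=> w.
    move=> /= E; have [[i Si]|nS] := pselect (exists i, S w i).
      left; have : S w (included_index A w j) by apply: (@xgetPex _ 0%N (S w)); exists i.
      by rewrite E.
    right; split; first by move=> [i _ Si]; apply: nS; exists i.
    rewrite /= -E /included_index; change (xget 0%N (S w) = 0%N).
    by case: xgetP => // i _ Si; exfalso; apply: nS; exists i.
  move=> [[h1 h2] /=|[nS /= ->]].
    by rewrite -h2 included_index_below//; exact/mem_set.
  rewrite /included_index; change (xget 0%N (S w) = 0%N).
  by case: xgetP => // i _ Si; exfalso; apply: nS; exists i.
apply: measurableU; first exact: measurable_nth_included.
apply: measurableI => //; have [->|n0] := eqVneq n 0%N.
  by rewrite (_ : [set _ | _] = setT)//; apply/seteqP; split.
rewrite (_ : [set _ | _] = set0)//; apply/seteqP; split=> // w /= E.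
by rewrite E eqxx in n0.
Qed.

(** G is arbitrary because the indices take countably many values. Events defined by any
    neighbourhood of mu are therefore measurable, with no sigma-algebra on the space of measures. *)
Lemma measurable_included_seq k (G : set (seq nat)) :
  measurable [set w | G (mkseq (included_index A w) k)].
Proof.
elim: k G => [|k IH] G.
  have [g|ng] := pselect (G [::]).
    by rewrite (_ : [set _ | _] = setT)//; apply/seteqP; split.
  by rewrite (_ : [set _ | _] = set0)//; apply/seteqP; split.
have -> : [set w | G (mkseq (included_index A w) k.+1)] =
    \bigcup_n ([set w | included_index A w k = n] `&`
      [set w | [set s | G (rcons s n)] (mkseq (included_index A w) k)]).
  apply/seteqP; split=> w /=.
    by rewrite mkseqS => Gw; exists (included_index A w k).
  by move=> [n _ [<- /=]]; rewrite mkseqS.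
apply: bigcup_measurable => n _; apply: measurableI; last exact: IH.
exact: measurable_included_index.
Qed.

Lemma measurable_random_poly (z : nat -> R[i]) k (G : set {poly R[i]}) :
  measurable [set w | G (random_poly z A k w)].
Proof.
have -> : [set w | G (random_poly z A k w)] =
    [set w | [set s | G (poly_of (map z s))] (mkseq (included_index A w) k)].
  by apply/seteqP; split=> w /=; rewrite random_polyE /sample /mkseq -map_comp.
exact: measurable_included_seq.
Qed.

End Measurability.

Section WeakTopology.
Context {R : realType}.

Lemma cvg_initial_topology (S : choiceType) (T : topologicalType) (f : S -> T)
  (F : set_system S) (s : S) : Filter F -> f @ F --> f s -> F --> (s : initial_topology f).
Proof.
move=> FF cvfF U /= [_ [[B Bop <-] Bfs sBU]]; apply: filterS sBU _.
by apply: cvfF; apply: open_nbhs_nbhs.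
Qed.

Lemma cvg_weak_topology (F : set_system (probability R[i] R)) (mu : probability R[i] R) :
  Filter F ->
  (forall f, test_function f -> forall e : R, 0 < e ->
    F [set nu | `|(\int[nu]_x f x)%R - (\int[mu]_x f x)%R| < e]) ->
  F --> (mu : weak_topology).
Proof.
move=> FF H; apply: cvg_initial_topology; apply/cvg_sup => -[f tf].
apply: cvg_initial_topology; apply/cvgrPdist_lt => e e0.
by apply: (@filterS _ F FF _ _ _ (H f tf e e0)) => nu /=; rewrite distrC.
Qed.

End WeakTopology.

(** * Proof of the two convergence statements *)

Section Conclusion.
Context {R : realType} {d : measure_display} {Omega : measurableType d}.
Variable P : probability Omega R.
Variables (p : R) (A : nat -> set Omega) (z : nat -> R[i]) (mu : probability R[i] R).
Hypotheses (p01 : 0 < p < 1).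
Hypotheses (mA : forall n, measurable (A n)) (pA : forall n, P (A n) = p%:E).
Hypothesis iA : mutually_independent P A.
Hypothesis muz : distributed mu z.

Lemma likely_critical_sum (f : R[i] -> R) (e : R) : test_function f -> 0 < e ->
  likely P (fun k => [set w | `|\sum_(y <- zeros (poly_of (sample z A w k))^`()) f y -
    \sum_(y <- sample z A w k) f y| <= e * k%:R]).
Proof.
move=> tf e0; have [x0 clx] := distributed_cluster muz.
have [B HB] := test_bounded_support tf; have [Mf HM] := test_bounded tf.
have e4 : 0 < e / 4 by rewrite divr_gt0.
have [s [s0 sf]] := logmax_approx HB HM (test_unif_continuous tf) e4.
pose S := \sum_(q <- s) `|q.1.1|.
have S0 : 0 <= S by apply: sumr_ge0.
(* The weighted gaps add up to at most S c k <= e k / 2; the + 1 covers S = 0. Approximating f by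
   logarithms on the two root lists costs e k / 4 each. *)
pose c := e / (2 * (S + 1)).
have c0 : 0 < c by rewrite divr_gt0// mulr_gt0// ltr_wpDl.
have L := likely_seq (fun q (qs : q \in s) =>
  @likely_circle _ _ _ P p A z x0 p01 mA pA iA clx q.1.2 q.2 c (s0 q qs) c0).
apply: (likelyS (k0 := 1%N) _ L) => k k1 w /= H.
set zs := sample z A w k in H *; set ws := zeros _.
have szs : size zs = k by rewrite size_sample.
have swz : (size ws <= k)%N by rewrite size_zeros_deriv szs ?leq_pred.
pose g x := \sum_(q <- s) q.1.1 * logmax q.1.2 q.2 x.
have near ys : `|\sum_(y <- ys) f y - \sum_(y <- ys) g y| <= (size ys)%:R * (e / 4).
  rewrite -sumrB; apply: le_trans (ler_norm_sum _ _ _) _.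
  apply: le_trans (ler_sum _ (fun y _ => sf y)) _.
  by rewrite big_const_seq count_predT iter_addr_0 mulr_natl.
have gap : `|\sum_(y <- ws) g y - \sum_(y <- zs) g y| <= e / 2 * k%:R.
  have -> : \sum_(y <- ws) g y - \sum_(y <- zs) g y = \sum_(q <- s) q.1.1 * circle_gap q.1.2 q.2 zs.
    rewrite /g exchange_big [X in _ - X]exchange_big -sumrB; apply: eq_bigr => q _.
    by rewrite -!mulr_sumr -mulrBr.
  apply: le_trans (ler_norm_sum _ _ _) _.
  apply: le_trans (_ : \sum_(q <- s) `|q.1.1| * (c * k%:R) <= _).
    rewrite big_seq [leRHS]big_seq; apply: ler_sum => q qs.
    by rewrite normrM ler_wpM2l// H.
  rewrite -mulr_suml mulrA ler_wpM2r// -/S /c mulrCA ler_wpM2l ?(ltW e0)//.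
  rewrite invfM mulrA mulrAC -[leRHS]mul1r ler_wpM2r// ler_pdivrMr ?mul1r ?ltr_wpDl//.
  by rewrite lerDl.
have n1 := near ws; have n2 := near zs; rewrite szs in n2.
have n3 : (size ws)%:R * (e / 4) <= k%:R * (e / 4) by rewrite ler_wpM2r ?(ltW e4)// ler_nat.
set F1 := \sum_(y <- ws) f y in n1 *; set F2 := \sum_(y <- zs) f y in n2 *.
set G1 := \sum_(y <- ws) g y in n1 gap; set G2 := \sum_(y <- zs) g y in n2 gap.
have -> : F1 - F2 = (F1 - G1) + (G1 - G2) - (F2 - G2) by ring.
apply: le_trans (ler_normB _ _) _; have := ler_normD (F1 - G1) (G1 - G2).
by move: n1 n2 n3 gap; lra.
Qed.

Lemma likely_critical_integral (f : R[i] -> R) (e : R) : test_function f -> 0 < e ->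
  likely P (fun k => [set w | `|(\int[zero_measure (random_poly z A k w)^`()]_x f x)%R
    - (\int[mu]_x f x)%R| < e]).
Proof.
move=> tf e0; set I := (\int[mu]_x f x)%R.
have [Mf HM] := test_bounded tf.
pose M := Num.max Mf `|I|.
have FM n : `|(f \o z) n| <= M by rewrite /M le_max HM.
have IM : `|I| <= M by rewrite /M le_max lexx orbT.
have e16 : 0 < e / 16 by rewrite divr_gt0.
have avg (c : R) : 0 < c -> exists n0, forall n, (n0 <= n)%N ->
    `|\sum_(i < n) (f \o z) i - n%:R * I| <= c * n%:R.
  move=> c0; have [n0 Hn] := distributed_average muz tf c0; exists (maxn n0 1) => n.
  by rewrite geq_max => /andP[h1 h2]; exact: Hn.
have L1 := likely_average p01 mA pA iA e16 FM IM avg.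
have L2 := likely_critical_sum tf e16.
(* There are k - 1 critical points against k zeros, so one stray integral I is left over; 4 M < (k -
   1) e absorbs it. *)
apply: (likelyS (k0 := maxn 2 (Num.truncn (4 * M / e)).+2) _ (likelyI L1 L2)) => k.
rewrite geq_max => /andP[k2 kM] w [/= h1 h2].
set zs := sample z A w k in h2.
have szs : size zs = k by rewrite size_sample.
rewrite random_polyE integral_critical ?szs//; last exact: test_measurable.
have E : \sum_(y <- zs) f y = \sum_(j < k) (f \o z) (included_index A w j).
  by rewrite /zs /sample big_map -[X in iota 0 X]subn0 big_mkord.
rewrite E in h2; set S1 := \sum_(y <- zeros _) f y in h2 *.
set S2 := \sum_(j < k) _ in h1 h2.
have k1 : (0 < k.-1)%N by case: k k2 {kM h1 h2 zs szs E S1 S2} => [|[]].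
have k1R : 0 < k.-1%:R :> R by rewrite ltr0n.
have kE : k%:R = k.-1%:R + 1 :> R by rewrite natr1 prednK// (ltnW k2).
have MkR : 4 * M < k.-1%:R * e.
  rewrite -ltr_pdivrMr//; apply: lt_le_trans (truncnS_gt _) _.
  by rewrite ler_nat -ltnS prednK// (ltnW k2).
have -> : k.-1%:R^-1 * S1 - I = (S1 - k.-1%:R * I) / k.-1%:R.
  by field; rewrite gt_eqF.
rewrite normrM normfV (gtr0_norm k1R) ltr_pdivrMr//.
have -> : S1 - k.-1%:R * I = (S1 - S2) + (S2 - k%:R * I) + I by rewrite kE; ring.
have := ler_normD (S1 - S2 + (S2 - k%:R * I)) I; have := ler_normD (S1 - S2) (S2 - k%:R * I).
have k1e : e <= k.-1%:R * e by rewrite ler_peMl ?(ltW e0)// ler1n.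
have h3 : e / 16 * k%:R <= k.-1%:R * e / 8 by rewrite kE; clear L1 L2 avg FM HM; lra.
have := le_trans h1 h3; have := le_trans h2 h3; clear L1 L2 avg FM HM.
have : 0 < k.-1%:R * e by rewrite mulr_gt0.
by rewrite [e * _]mulrC; move: IM MkR; lra.
Qed.

Lemma likely_cvg1 (S : nat -> set Omega) : (forall k, measurable (S k)) -> likely P S ->
  P (S k) @[k --> \oo] --> 1%E.
Proof.
move=> mS lS; apply/fine_cvgP; split.
  apply: nearW => k; rewrite ge0_fin_numE ?measure_ge0// (le_lt_trans (probability_le1 _ _)) ?ltry//.
apply/cvgrPdist_le => e e0; have [k0 H] := lS e e0; exists k0 => // k k0k /=.
have [B [mB PB BS]] := H k k0k.
have PSf : P (S k) \is a fin_num.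
  by rewrite ge0_fin_numE ?measure_ge0// (le_lt_trans (probability_le1 _ _)) ?ltry.
have S1 : fine (P (S k)) <= 1 by rewrite -lee_fin fineK// probability_le1.
rewrite ger0_norm ?subr_ge0// lerBlDr -lerBlDl -lee_fin fineK// EFinB.
have PC : (1 - e%:E <= P (~` B))%E by rewrite probability_setC// leeB.
by apply: (le_trans PC); apply: le_measure BS; rewrite ?inE//; exact: measurableC.
Qed.

Lemma sample_cvg_as : weak_cvg_as P (fun k w => zero_measure (random_poly z A k w)) mu.
Proof.
have := ae_sample_average p01 mA pA iA muz; apply: filterS => w H f tf.
apply/cvgrPdist_le => e e0; have [k0 Hk] := H f tf e e0.
exists (maxn k0 1) => // k /=; rewrite geq_max => /andP[/Hk h k1].
have kR : 0 < k%:R :> R by rewrite ltr0n.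
rewrite random_polyE integral_zeros ?size_sample//; last exact: test_measurable.
rewrite /sample big_map -[X in iota 0 X]subn0 big_mkord.
move: h; set S := \sum_(j < k) _; set I := (\int[mu]_x f x)%R => h.
have -> : I - k%:R^-1 * S = - ((S - k%:R * I) / k%:R) by field; rewrite gt_eqF.
by rewrite normrN normrM normfV (gtr0_norm kR) ler_pdivrMr.
Qed.

Lemma critical_cvg_in_probability :
  weak_cvg_in_probability P (fun k w => zero_measure (random_poly z A k w)^`()) mu.
Proof.
move=> N muN.
have mN k : measurable [set w | N (zero_measure (random_poly z A k w)^`())].
  exact: (measurable_random_poly mA z k [set Q | N (zero_measure Q^`())]).
split=> //; apply: likely_cvg1 => //.
(* The sets of measures that are likely form a filter, so the claim is its convergence in the weak
   topology, which may be checked on one test function at a time. *)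
pose F : set_system (probability R[i] R) := fun N =>
  likely P (fun k => [set w | N (zero_measure (random_poly z A k w)^`())]).
have FF : Filter F.
  split=> [|X Y FX FY|X Y XY FX].
  - by apply: (@likelyT _ _ _ P _ 0%N) => k _; apply/seteqP; split.
  - exact: likelyI FX FY.
  - by apply: (likelyS (k0 := 0%N) _ FX) => k _ w; exact: XY.
by apply: (cvg_weak_topology FF _ muN) => f tf e e0; exact: likely_critical_integral.
Qed.

End Conclusion.

Unset Implicit Arguments.
Set Strict Implicit.

Theorem corollary1p18 (R : realType) (mu : probability R[i] R)
  (z : nat -> R[i]) (p : R)
  (d : measure_display) (Omega : measurableType d) (P : probability Omega R)
  (A : nat -> set Omega)
  (hsupp : measure_support mu <> setT)
  (hdistr : distributed mu z)
  (hdense : ~ dense (range z))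
  (hp : 0 < p < 1)
  (hmeas : forall n, measurable (A n))
  (hprob : forall n, P (A n) = p%:E)
  (hindep : mutually_independent P A) :
  weak_cvg_as P (fun k w => zero_measure (random_poly z A k w)) mu /\
  weak_cvg_in_probability P
    (fun k w => zero_measure (random_poly z A k w)^`()) mu.
Proof.
split; first exact: (sample_cvg_as hp hmeas hprob hindep hdistr).
exact: (critical_cvg_in_probability hp hmeas hprob hindep hdistr).
Qed.
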